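(* Let $f:\Sigma\to\mathbb{R}^3$ be a front with unit normal $\nu$ and let $p$ be a (non-degenerate) singular point of the second kind of $f$. Suppose that the principal curvature $\kappa_+$ is bounded near $p$ and $\kappa_+(p)\neq0$. Then the function $$\psi(u,v)=-\tfrac12\big(\|\bm{x}_0-f(u,v)\|^2-t_0^2\big),\qquad \bm{x}_0=f(p)+\frac{\nu(p)}{\kappa_+(p)},\quad t_0=\frac1{\kappa_+(p)},$$ has a $D_4$ singularity at $p$ if and only if $p$ is not a ridge point of $f$.
   Context: All maps are $C^\infty$. $\Sigma\subset\mathbb{R}^2$ is a domain. A map $f:\Sigma\to\mathbb{R}^3$ is a frontal if there is a unit normal vector $\nu:\Sigma\to S^2$ (orthogonal to the image of $df$ everywhere); it is a front if moreover $(f,\nu):\Sigma\to\mathbb{R}^3\times S^2$ is an immersion. $S(f)$ is the set of points where $f$ is not an immersion. The signed area density is $\lambda=\det(f_u,f_v,\nu)$, so $S(f)=\lambda^{-1}(0)$. A point $p\in S(f)$ is non-degenerate if $d\lambda(p)\ne0$; then near $p$, $S(f)$ is a regular curve $\gamma$ (the singular curve, $\gamma(0)=p$), and there is a non-vanishing vector field $\eta$ (null vector field) with $df(\eta)=0$ along $\gamma$. A non-degenerate singular point $p$ is of the second kind if $\eta$ is tangent to $\gamma$ at $p$. Adapted coordinates. A coordinate system $(U;u,v)$ centered at a singular point $p$ of the second kind, compatible with the orientation of $\Sigma$, is adapted if the $u$-axis is the singular curve, there are no singular points off the $u$-axis, and $\eta=\partial_u+\epsilon(u)\partial_v$ with $\epsilon(0)=0$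 on the $u$-axis. Such a system is fixed, with $U$ small. There is $\varphi:U\to\mathbb{R}^3\setminus\{0\}$ with $f_u+\epsilon(u)f_v=v\varphi$. Put $\widehat E=\|\varphi\|^2$, $\widehat F=\langle\varphi,f_v\rangle$, $\widehat G=\|f_v\|^2$, $\widehat L=-\langle\varphi,\nu_u\rangle$, $\widehat M=-\langle\varphi,\nu_v\rangle$, $\widehat N=-\langle f_v,\nu_v\rangle$, $\widehat Q=(\widehat L+\epsilon\widehat M)\widehat N-v\widehat M^2$, $\widehat A=\widehat G(\widehat L+\epsilon\widehat M)-2v\widehat F\widehat M+v\widehat E\widehat N$, $\widehat B=\sqrt{\widehat A^2-4v(\widehat E\widehat G-\widehat F^2)\widehat Q}$. The principal curvature $\kappa_+$ on $U\setminus\{v=0\}$ is $\kappa_+=\dfrac{2\widehat Q}{\widehat A+\widehat B}$. ''$\kappa_+$ is bounded near $p$'' means that it is (extends across $\{v=0\}$ to) a bounded $C^\infty$-function near $p$, also denoted $\kappa_+$. Then the principal vector (field) with respect to $\kappa_+$ is $\bm{v}=(-\widehat M+\kappa_+\widehat F)\,\partial_u+\big(\widehat L-\kappa_+(v\widehat E-\epsilon\widehat F)\big)\,\partial_v$, and $p$ is a ridge point of $f$ if the directional derivative $\bm v\kappa_+(p)=0$. A function-germ $h:(\mathbb{R}^2,0)\to(\mathbb{R},0)$ has a $D_4$ singularity at $0$ if it is $\mathcal{R}$-equivalent (equal up to a diffeomorphism-germ of the source) to $u^3+uv^2$ or $u^3-uv^2$ at $0$. *)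

(* Defs.v *)
From Stdlib Require Import Reals.
From Coquelicot Require Import Coquelicot.
Set Implicit Arguments.
Open Scope R_scope.

Notation R2 := (R * R)%type.
Notation R3 := (R * R * R)%type.

(* Functions are total; only their values on the open sets mentioned matter,
   since every derivative below is taken at an interior point of those sets. *)

Definition dot (x y : R3) : R :=
  fst (fst x) * fst (fst y) + snd (fst x) * snd (fst y) + snd x * snd y.

Definition sqnorm (x : R3) : R := dot x x.

Definition det3 (x y z : R3) : R :=
  fst (fst x) * (snd (fst y) * snd z - snd y * snd (fst z))
  - snd (fst x) * (fst (fst y) * snd z - snd y * fst (fst z))
  + snd x * (fst (fst y) * snd (fst z) - snd (fst y) * fst (fst z)).

Definition Du (g : R2 -> R) (q : R2) : R := Derive (fun s => g (s, snd q)) (fst q).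
Definition Dv (g : R2 -> R) (q : R2) : R := Derive (fun s => g (fst q, s)) (snd q).

Fixpoint Ck (n : nat) (U : R2 -> Prop) (g : R2 -> R) : Prop :=
  match n with
  | O => forall q, U q -> continuous g q
  | S m =>
      (forall q, U q -> ex_derive (fun s => g (s, snd q)) (fst q)
                        /\ ex_derive (fun s => g (fst q, s)) (snd q))
      /\ Ck m U (Du g) /\ Ck m U (Dv g)
  end.

Definition smooth (U : R2 -> Prop) (g : R2 -> R) : Prop := forall n, Ck n U g.

Definition smooth2 (U : R2 -> Prop) (g : R2 -> R2) : Prop :=
  smooth U (fun q => fst (g q)) /\ smooth U (fun q => snd (g q)).

Definition smooth3 (U : R2 -> Prop) (g : R2 -> R3) : Prop :=
  smooth U (fun q => fst (fst (g q)))
  /\ smooth U (fun q => snd (fst (g q)))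
  /\ smooth U (fun q => snd (g q)).

Definition smooth_R (I : R -> Prop) (g : R -> R) : Prop :=
  forall n t, I t -> ex_derive_n g n t.

Definition smooth_curve (I : R -> Prop) (c : R -> R2) : Prop :=
  smooth_R I (fun t => fst (c t)) /\ smooth_R I (fun t => snd (c t)).

Definition velocity (c : R -> R2) (t : R) : R2 :=
  (Derive (fun s => fst (c s)) t, Derive (fun s => snd (c s)) t).

Definition Du3 (g : R2 -> R3) (q : R2) : R3 :=
  (Du (fun x => fst (fst (g x))) q, Du (fun x => snd (fst (g x))) q,
   Du (fun x => snd (g x)) q).
Definition Dv3 (g : R2 -> R3) (q : R2) : R3 :=
  (Dv (fun x => fst (fst (g x))) q, Dv (fun x => snd (fst (g x))) q,
   Dv (fun x => snd (g x)) q).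

Definition dmap3 (g : R2 -> R3) (q w : R2) : R3 :=
  plus (scal (fst w) (Du3 g q)) (scal (snd w) (Dv3 g q)).

Definition jacobian (g : R2 -> R2) (q : R2) : R :=
  Du (fun x => fst (g x)) q * Dv (fun x => snd (g x)) q
  - Dv (fun x => fst (g x)) q * Du (fun x => snd (g x)) q.

Definition connected (S : R2 -> Prop) : Prop :=
  forall V W : R2 -> Prop, open V -> open W ->
    (forall q, S q -> V q \/ W q) ->
    (exists q, S q /\ V q) -> (exists q, S q /\ W q) ->
    exists q, S q /\ V q /\ W q.

Definition plane_domain (S : R2 -> Prop) : Prop :=
  open S /\ (exists q, S q) /\ connected S.

Definition diffeo (U V : R2 -> Prop) (g : R2 -> R2) : Prop :=
  open U /\ open V /\ smooth2 U g /\
  exists h : R2 -> R2, smooth2 V h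
    /\ (forall q, U q -> V (g q) /\ h (g q) = q)
    /\ (forall q, V q -> U (h q) /\ g (h q) = q).

Definition frontal (Sigma : R2 -> Prop) (f nu : R2 -> R3) : Prop :=
  smooth3 Sigma f /\ smooth3 Sigma nu /\
  forall q, Sigma q ->
    sqnorm (nu q) = 1 /\ forall w, dot (dmap3 f q w) (nu q) = 0.

Definition front (Sigma : R2 -> Prop) (f nu : R2 -> R3) : Prop :=
  frontal Sigma f nu /\
  forall q, Sigma q -> forall w : R2,
    dmap3 f q w = zero -> dmap3 nu q w = zero -> w = zero.

Definition singular (Sigma : R2 -> Prop) (f : R2 -> R3) (q : R2) : Prop :=
  Sigma q /\ ~ (forall w : R2, dmap3 f q w = zero -> w = zero).

Definition lambda (f nu : R2 -> R3) (q : R2) : R := det3 (Du3 f q) (Dv3 f q) (nu q).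

Definition nondegenerate (Sigma : R2 -> Prop) (f nu : R2 -> R3) (p : R2) : Prop :=
  singular Sigma f p /\ ~ (Du (lambda f nu) p = 0 /\ Dv (lambda f nu) p = 0).

Definition singular_curve (Sigma : R2 -> Prop) (f : R2 -> R3) (p : R2)
    (d : R) (gamma : R -> R2) : Prop :=
  smooth_curve (fun t => Rabs t < d) gamma /\ gamma 0 = p
  /\ (forall t, Rabs t < d ->
        velocity gamma t <> zero /\ singular Sigma f (gamma t))
  /\ locally p (fun q => singular Sigma f q -> exists t, Rabs t < d /\ gamma t = q).

Definition null_field (f : R2 -> R3) (d : R) (gamma eta : R -> R2) : Prop :=
  smooth_curve (fun t => Rabs t < d) eta
  /\ forall t, Rabs t < d -> eta t <> zero /\ dmap3 f (gamma t) (eta t) = zero.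

Definition second_kind (Sigma : R2 -> Prop) (f nu : R2 -> R3) (p : R2) : Prop :=
  nondegenerate Sigma f nu p /\
  exists (d : R) (gamma eta : R -> R2),
    0 < d /\ singular_curve Sigma f p d gamma /\ null_field f d gamma eta
    /\ exists c : R, eta 0 = scal c (velocity gamma 0).

(* [Phi] is the inverse of the chart: (u,v) in [U] are the coordinates of the
   point [Phi (u,v)] of [Sigma].  [eps] is required to be smooth on the
   projection of [U] to the u-axis because eps(u) is used at all points (u,v)
   of [U]. *)
Definition adapted (Sigma : R2 -> Prop) (f : R2 -> R3) (p : R2)
    (U : R2 -> Prop) (Phi : R2 -> R2) (eps : R -> R) : Prop :=
  (exists V : R2 -> Prop, diffeo U V Phi /\ forall q, V q -> Sigma q)
  /\ (forall q, U q -> 0 < jacobian Phi q)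
  /\ U (0, 0) /\ Phi (0, 0) = p
  /\ (forall q, U q -> (singular Sigma f (Phi q) <-> snd q = 0))
  /\ smooth_R (fun u => exists v, U (u, v)) eps
  /\ eps 0 = 0
  /\ (forall u, U (u, 0) -> dmap3 (fun q => f (Phi q)) (u, 0) (1, eps u) = zero).

(* From here on [F] and [n] are the front and its unit normal written in the
   adapted coordinates. *)

Definition phi_of (U : R2 -> Prop) (F : R2 -> R3) (eps : R -> R) (phi : R2 -> R3) : Prop :=
  smooth3 U phi /\
  forall q, U q -> phi q <> zero
    /\ plus (Du3 F q) (scal (eps (fst q)) (Dv3 F q)) = scal (snd q) (phi q).

Definition Ehat (phi : R2 -> R3) (q : R2) : R := sqnorm (phi q).
Definition Fhat (F phi : R2 -> R3) (q : R2) : R := dot (phi q) (Dv3 F q).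
Definition Ghat (F : R2 -> R3) (q : R2) : R := sqnorm (Dv3 F q).
Definition Lhat (n phi : R2 -> R3) (q : R2) : R := - dot (phi q) (Du3 n q).
Definition Mhat (n phi : R2 -> R3) (q : R2) : R := - dot (phi q) (Dv3 n q).
Definition Nhat (F n : R2 -> R3) (q : R2) : R := - dot (Dv3 F q) (Dv3 n q).

Definition Qhat (F n : R2 -> R3) (eps : R -> R) (phi : R2 -> R3) (q : R2) : R :=
  (Lhat n phi q + eps (fst q) * Mhat n phi q) * Nhat F n q
  - snd q * Mhat n phi q ^ 2.

Definition Ahat (F n : R2 -> R3) (eps : R -> R) (phi : R2 -> R3) (q : R2) : R :=
  Ghat F q * (Lhat n phi q + eps (fst q) * Mhat n phi q)
  - 2 * snd q * Fhat F phi q * Mhat n phi q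
  + snd q * Ehat phi q * Nhat F n q.

Definition Bhat (F n : R2 -> R3) (eps : R -> R) (phi : R2 -> R3) (q : R2) : R :=
  sqrt (Ahat F n eps phi q ^ 2
        - 4 * snd q * (Ehat phi q * Ghat F q - Fhat F phi q ^ 2) * Qhat F n eps phi q).

(* Only used where [snd q <> 0]; on the u-axis the denominator may vanish, and
   the value there is meaningless. *)
Definition kappa_plus (F n : R2 -> R3) (eps : R -> R) (phi : R2 -> R3) (q : R2) : R :=
  2 * Qhat F n eps phi q / (Ahat F n eps phi q + Bhat F n eps phi q).

Definition bounded_extension (U : R2 -> Prop) (k kappa : R2 -> R) : Prop :=
  exists W : R2 -> Prop, open W /\ W (0, 0) /\ (forall q, W q -> U q)
    /\ smooth W kappa
    /\ (exists C, forall q, W q -> Rabs (kappa q) <= C)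
    /\ (forall q, W q -> snd q <> 0 -> kappa q = k q).

Definition principal_vector (F n : R2 -> R3) (eps : R -> R) (phi : R2 -> R3)
    (kappa : R2 -> R) (q : R2) : R2 :=
  (- Mhat n phi q + kappa q * Fhat F phi q,
   Lhat n phi q - kappa q * (snd q * Ehat phi q - eps (fst q) * Fhat F phi q)).

Definition ridge (F n : R2 -> R3) (eps : R -> R) (phi : R2 -> R3)
    (kappa : R2 -> R) (q : R2) : Prop :=
  let w := principal_vector F n eps phi kappa q in
  fst w * Du kappa q + snd w * Dv kappa q = 0.

(* Equivalence of the germs of [g] at [x] and of [h] at [y]; letting the base
   points vary makes the notion independent of coordinates. *)
Definition R_equivalent (g : R2 -> R) (x : R2) (h : R2 -> R) (y : R2) : Prop :=
  exists (A B : R2 -> Prop) (theta : R2 -> R2),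
    diffeo A B theta /\ A x /\ theta x = y /\ forall q, A q -> h (theta q) = g q.

Definition has_D4 (h : R2 -> R) (p : R2) : Prop :=
  R_equivalent (fun q => fst q ^ 3 + fst q * snd q ^ 2) (0, 0) h p
  \/ R_equivalent (fun q => fst q ^ 3 - fst q * snd q ^ 2) (0, 0) h p.

Definition psi (f : R2 -> R3) (x0 : R3) (t0 : R) (q : R2) : R :=
  - (1 / 2) * (sqnorm (minus x0 (f q)) - t0 ^ 2).

(* Main.v *)
(* In the adapted chart write F = f o Phi, n = nu o Phi, c = 1/kappa(0), and let
   r = x0 - F - c n, which vanishes at the origin.  Since F_u and F_v are
   orthogonal to n, the function J = psi o Phi satisfies J_v = <r, F_v> and
   J_u = v <r, phi> - eps <r, F_v>.  Hence the 2-jet of J and J_uuu vanish at the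
   origin, while the remaining third derivatives are c L, -2 c a and an
   expression in F_vv, with a = -M + kappa F and L the coordinates of the
   principal vector w (hats are dropped from E, F, G, L, M, N).  The quadratic
   equation of kappa factors as
     (L + eps M - kappa v E) (N - kappa G) = v a^2;
   its first derivatives at the origin, together with (dn + kappa dF)(w) = 0,
   which eliminates F_vv, give
     4 J_uuv J_vvv - 3 J_uvv^2 = 4 c^2 G (w kappa).
   So the cubic part v (quadratic form) of J is non-degenerate exactly when p is
   not a ridge point.

   A function whose 3-jet is such a cubic form is D4 if and only if the form is
   non-degenerate.  If it is, write J = u^3 A + u^2 v B + u v^2 C + v^3 D with
   smooth coefficients (Hadamard).  The cubic A + s B + s^2 C + s^3 D has a smooth
   simple root s(u, v) with s(0) = 0; dividing by v - s u and completing the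
   square leaves y (al x^2 + de y^2) with al and de non-vanishing, and smooth
   rescalings of x and y give y^3 +- y x^2.  Conversely, a diffeomorphism acts on
   the cubic part through its linear part, so a double factor would survive. *)
Require Import Defs.
From Stdlib Require Import Reals Lra Lia ClassicalEpsilon.
From Coquelicot Require Import Coquelicot.
Open Scope R_scope.

(** * Calculus of the classes [Ck] *)

(** Each geometric hypothesis acts through one non-vanishing quantity at the origin. In the chart
    [lambda] is divisible by v, so non-degeneracy forces phi, F_v, n to be a frame, and G is
    non-zero. The front condition gives n_u non-zero; there n_u is orthogonal to n and to F_v, so
    its phi-component L cannot vanish. Hence J_uuv = c L is non-zero, v is a simple factor of the
    cubic part, and only the discriminant of the other factor is in question. The obstacle is F_vv,
    which enters J_vvv and over which the hypotheses give no control. Computing J_uvv once from J_u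
    and once from J_v determines the product of r_u with F_vv, and the kernel relation carries this
    value over to r_v. The formula for [kappa_plus] has a meaning only off the u-axis, so its
    quadratic equation reaches the axis by continuity. On the analytic side everything lives in two
    variables: implicit functions come from monotonicity in one real variable, and local inverses
    are composed of two shears. *)

Lemma open_slice_u (U : R2 -> Prop) (q : R2) :
  open U -> U q -> locally (fst q) (fun s => U (s, snd q)).
Proof.
  intros HU Hq; destruct q as [u v]; destruct (HU _ Hq) as [d Hd].
  exists d; intros s Hs; apply Hd; split; [exact Hs | apply ball_center].
Qed.

Lemma open_slice_v (U : R2 -> Prop) (q : R2) :
  open U -> U q -> locally (snd q) (fun s => U (fst q, s)).
Proof.
  intros HU Hq; destruct q as [u v]; destruct (HU _ Hq) as [d Hd].
  exists d; intros s Hs; apply Hd; split; [apply ball_center | exact Hs].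
Qed.

Lemma Du_ext_on (U : R2 -> Prop) (f g : R2 -> R) (q : R2) :
  open U -> (forall x, U x -> f x = g x) -> U q -> Du f q = Du g q.
Proof.
  intros HU Hfg Hq; apply Derive_ext_loc.
  eapply filter_imp; [|exact (open_slice_u _ _ HU Hq)]; intros s Hs; now apply Hfg.
Qed.

Lemma Dv_ext_on (U : R2 -> Prop) (f g : R2 -> R) (q : R2) :
  open U -> (forall x, U x -> f x = g x) -> U q -> Dv f q = Dv g q.
Proof.
  intros HU Hfg Hq; apply Derive_ext_loc.
  eapply filter_imp; [|exact (open_slice_v _ _ HU Hq)]; intros s Hs; now apply Hfg.
Qed.

Lemma Ck_ext (n : nat) (U : R2 -> Prop) (f g : R2 -> R) :
  open U -> (forall x, U x -> f x = g x) -> Ck n U f -> Ck n U g.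
Proof.
  intros HU; revert f g; induction n as [|n IH]; intros f g Hfg; cbn [Ck].
  - intros Hf q Hq; apply continuous_ext_loc with f; [|now apply Hf].
    eapply filter_imp; [|exact (HU q Hq)]; exact Hfg.
  - intros [Hd [Hu Hv]]; split; [|split].
    + intros q Hq; destruct (Hd q Hq) as [H1 H2]; split.
      * eapply ex_derive_ext_loc; [|exact H1].
        eapply filter_imp; [|exact (open_slice_u _ _ HU Hq)]; intros s Hs; now apply Hfg.
      * eapply ex_derive_ext_loc; [|exact H2].
        eapply filter_imp; [|exact (open_slice_v _ _ HU Hq)]; intros s Hs; now apply Hfg.
    + apply IH with (Du f); [|exact Hu]; intros x Hx; now apply Du_ext_on with U.
    + apply IH with (Dv f); [|exact Hv]; intros x Hx; now apply Dv_ext_on with U.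
Qed.

Lemma Ck_subset (n : nat) (U V : R2 -> Prop) (g : R2 -> R) :
  (forall q, V q -> U q) -> Ck n U g -> Ck n V g.
Proof.
  intros HVU; revert g; induction n as [|n IH]; intros g; cbn [Ck]; [now auto|].
  intros [Hd [Hu Hv]]; repeat split; try (apply Hd; now apply HVU); now apply IH.
Qed.

Lemma Ck1_filterdiff (U : R2 -> Prop) (g : R2 -> R) (q : R2) :
  open U -> U q -> Ck 1 U g ->
  filterdiff g (locally q) (fun w => fst w * Du g q + snd w * Dv g q).
Proof.
  intros HU Hq [Hd [Hu _]]; destruct q as [x y].
  apply filterdiff_ext with (fun w => g (fst w, snd w)); [now intros []|].
  apply (is_derive_filterdiff (fun a b => g (a, b)) x y
           (fun a b => Du g (a, b)) (Dv g (x, y))).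
  - eapply filter_imp; [|exact (HU _ Hq)]; intros [a b] Hab; cbn.
    apply Derive_correct; exact (proj1 (Hd _ Hab)).
  - apply Derive_correct; exact (proj2 (Hd _ Hq)).
  - apply continuous_ext with (Du g); [now intros []|]; now apply Hu.
Qed.

(** [Ck (S n)] asks for continuity only of the partial derivatives of top order. At the bottom level
    continuity of [g] itself comes from its differentiability, which continuous partial derivatives
    ensure. *)
Lemma Ck_pred (n : nat) (U : R2 -> Prop) (g : R2 -> R) :
  open U -> Ck (S n) U g -> Ck n U g.
Proof.
  intros HU; revert g; induction n as [|n IH]; intros g Hg.
  - intros q Hq.
    apply (@filterdiff_continuous R_AbsRing
             (prod_NormedModule R_AbsRing R_NormedModule R_NormedModule)
             R_NormedModule g q).
    eexists; now apply Ck1_filterdiff with U.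
  - destruct Hg as [Hd [Hu Hv]]; split; [exact Hd|split; now apply IH].
Qed.

Lemma Ck_le (n m : nat) (U : R2 -> Prop) (g : R2 -> R) :
  open U -> (n <= m)%nat -> Ck m U g -> Ck n U g.
Proof.
  intros HU Hnm; induction Hnm; [easy|]; intros H; apply IHHnm; now apply Ck_pred.
Qed.

Lemma Ck_Du (n : nat) (U : R2 -> Prop) (g : R2 -> R) : Ck (S n) U g -> Ck n U (Du g).
Proof. now intros [_ [H _]]. Qed.

Lemma Ck_Dv (n : nat) (U : R2 -> Prop) (g : R2 -> R) : Ck (S n) U g -> Ck n U (Dv g).
Proof. now intros [_ [_ H]]. Qed.

(** Introduction rule behind all closure properties: exhibit the partial derivatives on [U] by
    formulas that are of class [n] by induction. The formulas agree with [Du g] and [Dv g] on [U]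
    only. *)
Lemma Ck_S_intro (n : nat) (U : R2 -> Prop) (g gu gv : R2 -> R) :
  open U ->
  (forall q, U q -> is_derive (fun s => g (s, snd q)) (fst q) (gu q)
                    /\ is_derive (fun s => g (fst q, s)) (snd q) (gv q)) ->
  Ck n U gu -> Ck n U gv -> Ck (S n) U g.
Proof.
  intros HU Hd Hu Hv; split; [|split].
  - intros q Hq; destruct (Hd q Hq); split; eexists; eassumption.
  - apply Ck_ext with gu; [easy| |easy].
    intros q Hq; symmetry; apply is_derive_unique, (Hd q Hq).
  - apply Ck_ext with gv; [easy| |easy].
    intros q Hq; symmetry; apply is_derive_unique, (Hd q Hq).
Qed.

Lemma Ck_is_derive (n : nat) (U : R2 -> Prop) (g : R2 -> R) (q : R2) :
  Ck (S n) U g -> U q ->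
  is_derive (fun s => g (s, snd q)) (fst q) (Du g q)
  /\ is_derive (fun s => g (fst q, s)) (snd q) (Dv g q).
Proof. intros [Hd _] Hq; split; apply Derive_correct, Hd, Hq. Qed.

Lemma is_derive_cst (c x : R) : is_derive (fun _ : R => c) x 0.
Proof. exact (is_derive_const c x). Qed.

Lemma is_derive_idR (x : R) : is_derive (fun s : R => s) x 1.
Proof. exact (is_derive_id x). Qed.

Lemma Ck_const (n : nat) (U : R2 -> Prop) (c : R) : open U -> Ck n U (fun _ => c).
Proof.
  intros HU; revert c; induction n as [|n IH]; intros c.
  - intros q _; apply continuous_const.
  - apply Ck_S_intro with (fun _ => 0) (fun _ => 0); auto.
    intros [x y] _; cbn [fst snd]; split; apply is_derive_cst.
Qed.

Lemma Ck_fst (n : nat) (U : R2 -> Prop) : open U -> Ck n U (fun q => fst q).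
Proof.
  intros HU; destruct n as [|n].
  - intros [x y] _; apply continuous_fst.
  - apply Ck_S_intro with (fun _ => 1) (fun _ => 0); auto using Ck_const.
    intros [x y] _; cbn [fst snd]; split; [apply is_derive_idR | apply is_derive_cst].
Qed.

Lemma Ck_snd (n : nat) (U : R2 -> Prop) : open U -> Ck n U (fun q => snd q).
Proof.
  intros HU; destruct n as [|n].
  - intros [x y] _; apply continuous_snd.
  - apply Ck_S_intro with (fun _ => 0) (fun _ => 1); auto using Ck_const.
    intros [x y] _; cbn [fst snd]; split; [apply is_derive_cst | apply is_derive_idR].
Qed.

Lemma Ck_plus (n : nat) (U : R2 -> Prop) (f g : R2 -> R) :
  open U -> Ck n U f -> Ck n U g -> Ck n U (fun q => f q + g q).
Proof.
  intros HU; revert f g; induction n as [|n IH]; intros f g Hf Hg.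
  - intros q Hq; apply (continuous_plus f g); auto.
  - apply Ck_S_intro with (fun q => Du f q + Du g q) (fun q => Dv f q + Dv g q);
      auto using Ck_Du, Ck_Dv.
    intros q Hq; destruct (Ck_is_derive _ _ _ _ Hf Hq), (Ck_is_derive _ _ _ _ Hg Hq).
    destruct q as [x y]; split; cbn [fst snd] in *; now apply (@is_derive_plus R_AbsRing R_NormedModule).
Qed.

Lemma Ck_mult (n : nat) (U : R2 -> Prop) (f g : R2 -> R) :
  open U -> Ck n U f -> Ck n U g -> Ck n U (fun q => f q * g q).
Proof.
  intros HU; revert f g; induction n as [|n IH]; intros f g Hf Hg.
  - intros q Hq; apply (continuous_mult f g); auto.
  - apply Ck_S_intro with (fun q => Du f q * g q + f q * Du g q)
                          (fun q => Dv f q * g q + f q * Dv g q);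
      auto using Ck_Du, Ck_Dv, Ck_plus, Ck_pred.
    intros q Hq; destruct (Ck_is_derive _ _ _ _ Hf Hq), (Ck_is_derive _ _ _ _ Hg Hq).
    destruct q as [x y]; split; cbn in *.
    + apply (is_derive_mult (fun s => f (s, y)) (fun s => g (s, y))); auto.
      intros; apply Rmult_comm.
    + apply (is_derive_mult (fun s => f (x, s)) (fun s => g (x, s))); auto.
      intros; apply Rmult_comm.
Qed.

Lemma Ck_opp (n : nat) (U : R2 -> Prop) (f : R2 -> R) :
  open U -> Ck n U f -> Ck n U (fun q => - f q).
Proof.
  intros HU Hf; apply Ck_ext with (fun q => (-1) * f q); [easy|intros; ring|].
  now apply Ck_mult; [|apply Ck_const|].
Qed.

Lemma Ck_minus (n : nat) (U : R2 -> Prop) (f g : R2 -> R) :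
  open U -> Ck n U f -> Ck n U g -> Ck n U (fun q => f q - g q).
Proof. intros; apply Ck_plus; auto; now apply Ck_opp. Qed.

Lemma Ck_inv (n : nat) (U : R2 -> Prop) (f : R2 -> R) :
  open U -> (forall q, U q -> f q <> 0) -> Ck n U f -> Ck n U (fun q => / f q).
Proof.
  intros HU H0; induction n as [|n IH]; intros Hf.
  - intros q Hq; apply (continuous_comp f Rinv); [auto|].
    apply continuity_pt_filterlim, continuity_pt_inv; [|now apply H0].
    apply derivable_continuous_pt, derivable_pt_id.
  - assert (Hi : Ck n U (fun q => / f q)) by (apply IH, Ck_pred; auto).
    apply Ck_S_intro with (fun q => (- Du f q) * / f q * / f q)
                          (fun q => (- Dv f q) * / f q * / f q);
      auto using Ck_mult, Ck_opp, Ck_Du, Ck_Dv.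
    intros q Hq; destruct (Ck_is_derive _ _ _ _ Hf Hq); destruct q as [x y].
    specialize (H0 _ Hq); split; cbn in *.
    + replace (- Du f (x, y) * / f (x, y) * / f (x, y))
        with (- Du f (x, y) / f (x, y) ^ 2) by (field; auto).
      now apply is_derive_inv.
    + replace (- Dv f (x, y) * / f (x, y) * / f (x, y))
        with (- Dv f (x, y) / f (x, y) ^ 2) by (field; auto).
      now apply is_derive_inv.
Qed.

Lemma Ck_div (n : nat) (U : R2 -> Prop) (f g : R2 -> R) :
  open U -> (forall q, U q -> g q <> 0) -> Ck n U f -> Ck n U g ->
  Ck n U (fun q => f q / g q).
Proof. intros; apply Ck_mult; auto; now apply Ck_inv. Qed.

Lemma Ck_exp (n : nat) (U : R2 -> Prop) (f : R2 -> R) :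
  open U -> Ck n U f -> Ck n U (fun q => exp (f q)).
Proof.
  intros HU; induction n as [|n IH]; intros Hf.
  - intros q Hq; apply (continuous_comp f exp); [auto|].
    apply (@ex_derive_continuous R_AbsRing R_NormedModule).
    eexists; apply is_derive_exp.
  - assert (He : Ck n U (fun q => exp (f q))) by (apply IH, Ck_pred; auto).
    apply Ck_S_intro with (fun q => Du f q * exp (f q)) (fun q => Dv f q * exp (f q));
      auto using Ck_mult, Ck_Du, Ck_Dv.
    intros q Hq; destruct (Ck_is_derive _ _ _ _ Hf Hq); destruct q as [x y].
    split; cbn in *.
    + apply (is_derive_comp exp (fun s => f (s, y))); [apply is_derive_exp|easy].
    + apply (is_derive_comp exp (fun s => f (x, s))); [apply is_derive_exp|easy].
Qed.

Lemma Ck_ln (n : nat) (U : R2 -> Prop) (f : R2 -> R) :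
  open U -> (forall q, U q -> 0 < f q) -> Ck n U f -> Ck n U (fun q => ln (f q)).
Proof.
  intros HU H0; destruct n as [|n]; intros Hf.
  - intros q Hq; apply (continuous_comp f ln); [auto|].
    apply (@ex_derive_continuous R_AbsRing R_NormedModule).
    eexists; now apply is_derive_ln, H0.
  - assert (forall q, U q -> f q <> 0) by (intros q Hq; specialize (H0 q Hq); lra).
    apply Ck_S_intro with (fun q => Du f q * / f q) (fun q => Dv f q * / f q);
      auto using Ck_mult, Ck_Du, Ck_Dv, Ck_inv, Ck_pred.
    intros q Hq; destruct (Ck_is_derive _ _ _ _ Hf Hq); destruct q as [x y].
    specialize (H0 _ Hq); split; cbn in *.
    + apply (is_derive_comp ln (fun s => f (s, y))); [now apply is_derive_ln|easy].
    + apply (is_derive_comp ln (fun s => f (x, s))); [now apply is_derive_ln|easy].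
Qed.

Lemma is_derive_comp_pair (V : R2 -> Prop) (g : R2 -> R) (a b : R -> R) (t a' b' : R) :
  open V -> V (a t, b t) -> Ck 1 V g -> is_derive a t a' -> is_derive b t b' ->
  is_derive (fun s => g (a s, b s)) t (Du g (a t, b t) * a' + Dv g (a t, b t) * b').
Proof.
  intros HV Ht Hg Ha Hb; apply is_derive_Reals.
  apply (derivable_pt_lim_comp_2d (fun x y => g (x, y))); try now apply is_derive_Reals.
  apply filterdiff_differentiable_pt_lim.
  apply filterdiff_ext with g; [now intros []|].
  now apply (Ck1_filterdiff V).
Qed.

Lemma continuous_pair (T : UniformSpace) (a b : T -> R) (x : T) :
  continuous a x -> continuous b x -> continuous (fun t => (a t, b t)) x.
Proof.
  intros Ha Hb; apply (continuous_comp_2 a b (fun x y => (x, y))); auto.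
  apply continuous_ext with (fun q => q); [now intros []|apply continuous_id].
Qed.

Lemma Ck_comp (n : nat) (U V : R2 -> Prop) (g a b : R2 -> R) :
  open U -> open V -> (forall q, U q -> V (a q, b q)) ->
  Ck n V g -> Ck n U a -> Ck n U b -> Ck n U (fun q => g (a q, b q)).
Proof.
  intros HU HV HUV; revert g; induction n as [|n IH]; intros g Hg Ha Hb.
  - intros q Hq; apply (continuous_comp (fun q => (a q, b q)) g).
    + now apply continuous_pair; [apply Ha|apply Hb].
    + now apply Hg, HUV.
  - apply Ck_S_intro with
      (fun q => Du g (a q, b q) * Du a q + Dv g (a q, b q) * Du b q)
      (fun q => Du g (a q, b q) * Dv a q + Dv g (a q, b q) * Dv b q); auto.
    2, 3: apply Ck_plus; auto; apply Ck_mult; auto using Ck_pred, Ck_Du, Ck_Dv.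
    intros q Hq; destruct (Ck_is_derive _ _ _ _ Ha Hq), (Ck_is_derive _ _ _ _ Hb Hq).
    specialize (HUV _ Hq); destruct q as [x y].
    apply (Ck_le 1) in Hg; [|easy|lia]; split; cbn in *.
    + now apply (is_derive_comp_pair V g (fun s => a (s, y)) (fun s => b (s, y))).
    + now apply (is_derive_comp_pair V g (fun s => a (x, s)) (fun s => b (x, s))).
Qed.

Lemma Ck_of_fst (n : nat) (I : R -> Prop) (U : R2 -> Prop) (h : R -> R) :
  open U -> (forall q, U q -> I (fst q)) -> smooth_R I h -> Ck n U (fun q => h (fst q)).
Proof.
  intros HU HI; revert h; induction n as [|n IH]; intros h Hh.
  - intros q Hq; apply (continuous_comp fst h); [apply (Ck_fst 0 U HU q Hq)|].
    (* [ex_derive_n h 0] is [True], so continuity has to be drawn from the first derivative. *)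
    apply (@ex_derive_continuous R_AbsRing R_NormedModule), (Hh 1%nat), HI, Hq.
  - apply Ck_S_intro with (fun q => Derive h (fst q)) (fun _ => 0); auto using Ck_const.
    + intros [x y] Hq; cbn [fst snd]; split; [|apply is_derive_cst].
      apply Derive_correct, (Hh 1%nat), (HI _ Hq).
    + apply (IH (Derive h)); intros [|k] t Ht; [exact Logic.I|].
      specialize (Hh (S (S k)) t Ht); cbn in *.
      apply ex_derive_ext with (Derive_n h (S k)); [|exact Hh].
      intros s; symmetry; rewrite <- (Nat.add_1_r k); exact (Derive_n_comp h k 1 s).
Qed.

Lemma Du_Dv_comm (U : R2 -> Prop) (g : R2 -> R) (q : R2) :
  open U -> Ck 2 U g -> U q -> Du (Dv g) q = Dv (Du g) q.
Proof.
  intros HU Hg Hq; destruct q as [x y].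
  assert (C : forall h, Ck 0 U h -> continuity_2d_pt (fun a b => h (a, b)) x y).
  { intros h Hh; apply continuity_2d_pt_filterlim; cbn.
    apply (filterlim_ext h); [now intros []|]; now apply Hh. }
  apply (Schwarz (fun a b => g (a, b)) x y).
  - destruct (HU _ Hq) as [d Hd]; exists d; intros a b Ha Hb.
    assert (Hab : U (a, b)) by (apply Hd; split; assumption).
    destruct Hg as [Hd0 [[Hdu _] [Hdv _]]].
    repeat split; [apply (Hd0 _ Hab)|apply (Hd0 _ Hab)|apply (Hdv _ Hab)|apply (Hdu _ Hab)].
  - apply (C (Du (Dv g))); now apply Ck_Du, Ck_Dv.
  - apply (C (Dv (Du g))); now apply Ck_Dv, Ck_Du.
Qed.

(** * Hadamard's lemma *)

Definition star_shaped (S : R2 -> Prop) : Prop :=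
  forall q t, S q -> 0 <= t <= 1 -> S (t * fst q, t * snd q).

(** These integrals are the remainder coefficients in Hadamard's lemma. The weight [t ^ k] absorbs
    the factor [t] that each differentiation under the integral sign produces, so the family is
    closed under partial derivatives. *)
Definition radial_mean (k : nat) (g : R2 -> R) (q : R2) : R :=
  RInt (fun t => t ^ k * g (t * fst q, t * snd q)) 0 1.

Lemma ball_pair (q p : R2) (d : R) :
  Rabs (fst p - fst q) < d -> Rabs (snd p - snd q) < d -> ball q d p.
Proof. intros H1 H2; destruct q, p; split; assumption. Qed.

Lemma continuous_scaling (g : R2 -> R) (q : R2) (t : R) :
  continuous g (t * fst q, t * snd q) ->
  continuous (fun z : R * R2 => g (fst z * fst (snd z), fst z * snd (snd z))) (t, q).
Proof.
  intros Hg.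
  apply (continuous_comp (fun z : R * R2 => (fst z * fst (snd z), fst z * snd (snd z))) g);
    [|exact Hg].
  destruct q as [x y].
  assert (Ht : continuous (fun z : R * R2 => fst z) (t, (x, y))) by apply continuous_fst.
  assert (Hx : continuous (fun z : R * R2 => fst (snd z)) (t, (x, y))).
  { apply (continuous_comp (fun z : R * R2 => snd z) (fun w : R2 => fst w));
      [apply continuous_snd | apply continuous_fst]. }
  assert (Hy : continuous (fun z : R * R2 => snd (snd z)) (t, (x, y))).
  { apply (continuous_comp (fun z : R * R2 => snd z) (fun w : R2 => snd w));
      [apply continuous_snd | apply continuous_snd]. }
  apply continuous_pair.
  - now apply (continuous_mult (fun z : R * R2 => fst z) (fun z : R * R2 => fst (snd z))).
  - now apply (continuous_mult (fun z : R * R2 => fst z) (fun z : R * R2 => snd (snd z))).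
Qed.

(** Compactness of the segment from the origin to [q]: one [d] serves all [t] at once, which is what
    continuity of an integral over [t] requires. *)
Lemma radial_uniform_continuity (S : R2 -> Prop) (g : R2 -> R) (q : R2) (eps : posreal) :
  star_shaped S -> Ck 0 S g -> S q ->
  exists d : posreal, forall p, ball q d p -> forall t, 0 <= t <= 1 ->
    Rabs (g (t * fst p, t * snd p) - g (t * fst q, t * snd q)) < eps.
Proof.
  intros HS Hg Hq.
  assert (H : forall t, exists d : posreal, 0 <= t <= 1 -> forall t' p,
     Rabs (t' - t) < d -> ball q d p ->
     Rabs (g (t' * fst p, t' * snd p) - g (t * fst q, t * snd q)) < eps / 2).
  { intros t; destruct (classic (0 <= t <= 1)) as [Ht|Ht];
      [|exists (mkposreal 1 Rlt_0_1); tauto].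
    assert (C := continuous_scaling g q t (Hg _ (HS _ _ Hq Ht))).
    destruct (proj1 (filterlim_locally _ _) C (pos_div_2 eps)) as [d Hd].
    exists d; intros _ t' p Ht' Hp.
    apply (Hd (t', p)); split; [exact Ht' | exact Hp]. }
  set (delta := fun t => proj1_sig (constructive_indefinite_description _ (H t))).
  assert (Hdelta : forall t, 0 <= t <= 1 -> forall t' p,
     Rabs (t' - t) < delta t -> ball q (delta t) p ->
     Rabs (g (t' * fst p, t' * snd p) - g (t * fst q, t * snd q)) < eps / 2).
  { intros t; exact (proj2_sig (constructive_indefinite_description _ (H t))). }
  (* Every [t] in [0,1] is within [delta s] of some [s] with [d <= delta s]. Both values at time
     [t], at [p] and at [q], are then within [eps / 2] of the value of [g] on the ray of [q] at time
     [s]. The covering is stated under a double negation, whence the argument by contradiction. *)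
  destruct (compactness_value_1d 0 1 delta) as [d Hd].
  exists d; intros p Hp t Ht; apply NNPP; intros Hn.
  apply (Hd t Ht); intros [s [Hs [Hts Hds]]]; apply Hn.
  assert (H1 := Hdelta s Hs t p Hts (ball_le _ _ _ Hds _ Hp)).
  assert (H2 := Hdelta s Hs t q Hts (ball_center q (delta s))).
  apply Rabs_def2 in H1, H2; destruct H1, H2; destruct eps as [e He]; cbn in *; apply Rabs_def1; lra.
Qed.

Lemma continuous_radial_slice (S : R2 -> Prop) (g : R2 -> R) (k : nat) (q : R2) (t : R) :
  star_shaped S -> Ck 0 S g -> S q -> 0 <= t <= 1 ->
  continuous (fun t => t ^ k * g (t * fst q, t * snd q)) t.
Proof.
  intros HS Hg Hq Ht.
  apply (continuous_mult (fun t => t ^ k) (fun t => g (t * fst q, t * snd q))).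
  - apply (@ex_derive_continuous R_AbsRing R_NormedModule); auto_derive; trivial.
  - apply (continuous_comp (fun t : R => (t, q))
             (fun z : R * R2 => g (fst z * fst (snd z), fst z * snd (snd z)))).
    + apply (continuous_comp_2 (fun t : R => t) (fun _ => q) (fun x y => (x, y)));
        [apply continuous_id | apply continuous_const |].
      apply continuous_ext with (fun z => z); [now intros []|apply continuous_id].
    + apply continuous_scaling, Hg, HS; assumption.
Qed.

Lemma ex_RInt_radial (S : R2 -> Prop) (g : R2 -> R) (k : nat) (q : R2) :
  star_shaped S -> Ck 0 S g -> S q ->
  ex_RInt (fun t => t ^ k * g (t * fst q, t * snd q)) 0 1.
Proof.
  intros HS Hg Hq; apply (@ex_RInt_continuous R_CompleteNormedModule); intros t Ht.
  rewrite Rmin_left, Rmax_right in Ht by lra.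
  now apply continuous_radial_slice with S.
Qed.

Lemma radial_mean_continuous (S : R2 -> Prop) (g : R2 -> R) (k : nat) :
  open S -> star_shaped S -> Ck 0 S g -> Ck 0 S (radial_mean k g).
Proof.
  intros HO HS Hg q Hq; apply filterlim_locally; intros eps.
  destruct (radial_uniform_continuity S g q (pos_div_2 eps) HS Hg Hq) as [d Hd].
  destruct (HO q Hq) as [d' Hd'].
  assert (Hm : 0 < Rmin d d') by (apply Rmin_case; apply cond_pos).
  exists (mkposreal _ Hm); intros p Hp.
  assert (Hp1 : ball q d p) by (apply (ball_le q (Rmin d d')); [apply Rmin_l|exact Hp]).
  assert (Hp2 : S p) by (apply Hd', (ball_le q (Rmin d d')); [apply Rmin_r|exact Hp]).
  assert (I1 := ex_RInt_radial S g k p HS Hg Hp2).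
  assert (I2 := ex_RInt_radial S g k q HS Hg Hq).
  change (Rabs (radial_mean k g p - radial_mean k g q) < eps).
  assert (E : radial_mean k g p - radial_mean k g q =
    RInt (fun t => t ^ k * g (t * fst p, t * snd p) - t ^ k * g (t * fst q, t * snd q)) 0 1).
  { symmetry; apply (RInt_minus (V := R_CompleteNormedModule) _ _ _ _ I1 I2). }
  rewrite E; apply Rle_lt_trans with ((1 - 0) * (eps / 2)).
  - apply abs_RInt_le_const; [lra|now apply (ex_RInt_minus (V := R_NormedModule))|].
    intros t Ht; specialize (Hd p Hp1 t Ht); cbn in Hd.
    replace (t ^ k * g (t * fst p, t * snd p) - t ^ k * g (t * fst q, t * snd q))
      with (t ^ k * (g (t * fst p, t * snd p) - g (t * fst q, t * snd q))) by ring.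
    rewrite Rabs_mult, (Rabs_pos_eq (t ^ k)) by now apply pow_le.
    assert (t ^ k <= 1) by (rewrite <- (pow1 k); apply pow_incr; lra).
    assert (0 <= Rabs (g (t * fst p, t * snd p) - g (t * fst q, t * snd q)))
      by apply Rabs_pos.
    apply Rle_trans with (1 * Rabs (g (t * fst p, t * snd p) - g (t * fst q, t * snd q)));
      [now apply Rmult_le_compat_r | rewrite Rmult_1_l; apply Rlt_le; exact Hd].
  - destruct eps as [e He]; cbn; lra.
Qed.

Lemma is_derive_radial_mean_u (S : R2 -> Prop) (g : R2 -> R) (k : nat) (q : R2) :
  open S -> star_shaped S -> Ck 1 S g -> S q ->
  is_derive (fun s => radial_mean k g (s, snd q)) (fst q) (radial_mean (Datatypes.S k) (Du g) q).
Proof.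
  intros HO HS Hg Hq; destruct q as [x y].
  assert (D : forall s t, S (t * s, t * y) ->
    is_derive (fun z => t ^ k * g (t * z, t * y)) s (t ^ Datatypes.S k * Du g (t * s, t * y))).
  { intros s t Hs.
    replace (t ^ Datatypes.S k * Du g (t * s, t * y))
      with (t ^ k * (Du g (t * s, t * y) * t + Dv g (t * s, t * y) * 0)) by (cbn; ring).
    apply (is_derive_scal (fun z => g (t * z, t * y))).
    apply (is_derive_comp_pair S g (fun z => t * z) (fun _ => t * y)); auto.
    - auto_derive; [trivial|ring].
    - apply is_derive_cst. }
  assert (E : radial_mean (Datatypes.S k) (Du g) (x, y)
    = RInt (fun t => Derive (fun z => t ^ k * g (t * z, t * y)) x) 0 1).
  { apply RInt_ext; intros t Ht; rewrite Rmin_left, Rmax_right in Ht by lra.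
    symmetry; apply is_derive_unique, D; apply (HS (x, y)); [easy|lra]. }
  rewrite E; cbn [fst snd].
  apply (is_derive_RInt_param (fun s t => t ^ k * g (t * s, t * y)) 0 1 x).
  - eapply filter_imp; [|exact (open_slice_u _ _ HO Hq)]; intros s Hs t Ht.
    rewrite Rmin_left, Rmax_right in Ht by lra.
    eexists; apply D; now apply (HS (s, y)).
  - intros t Ht; rewrite Rmin_left, Rmax_right in Ht by lra.
    assert (HSt : S (t * x, t * y)) by now apply (HS (x, y)).
    (* The explicit formula for the derivative is valid only where the scaled point stays in [S];
       continuity of the scaling supplies a neighbourhood of (x,t) on which it does. *)
    apply continuity_2d_pt_ext_loc with (fun s r => r ^ Datatypes.S k * Du g (r * s, r * y)).
    + assert (C := continuous_scaling (fun q => fst q) (x, y) t (continuous_fst (t * x) (t * y))).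
      assert (C' := continuous_scaling (fun q => snd q) (x, y) t (continuous_snd (t * x) (t * y))).
      destruct (HO _ HSt) as [d Hd].
      destruct (proj1 (filterlim_locally _ _) C d) as [d1 Hd1].
      destruct (proj1 (filterlim_locally _ _) C' d) as [d2 Hd2].
      assert (Hm : 0 < Rmin d1 d2) by (apply Rmin_case; apply cond_pos).
      exists (mkposreal _ Hm); cbn; intros s r Hs Hr.
      symmetry; apply is_derive_unique.
      refine (D _ _ (Hd _ (ball_pair (t * x, t * y) (r * s, r * y) d _ _))); cbn.
      * apply (Hd1 (r, (s, y))); split; [|split; [|apply ball_center]]; cbn;
          [eapply Rlt_le_trans; [exact Hr|apply Rmin_l]
          |eapply Rlt_le_trans; [exact Hs|apply Rmin_l]].
      * apply (Hd2 (r, (s, y))); split; [|split; [|apply ball_center]]; cbn;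
          [eapply Rlt_le_trans; [exact Hr|apply Rmin_r]
          |eapply Rlt_le_trans; [exact Hs|apply Rmin_r]].
    + apply continuity_2d_pt_filterlim; cbn [fst snd].
      assert (C : continuous (fun z : R * R2 => Du g (fst z * fst (snd z), fst z * snd (snd z)))
                    (t, (x, y))) 
        by exact (continuous_scaling (Du g) (x, y) t (Ck_Du 0 S g Hg _ HSt)).
      apply (continuous_mult (fun z : R2 => snd z ^ Datatypes.S k)
               (fun z : R2 => Du g (snd z * fst z, snd z * y))).
      * apply (continuous_comp (fun z : R2 => snd z) (fun r => r ^ Datatypes.S k));
          [apply continuous_snd|].
        apply (@ex_derive_continuous R_AbsRing R_NormedModule); auto_derive; trivial.
      * apply (continuous_comp (fun z : R2 => (snd z, (fst z, y)))
          (fun z : R * R2 => Du g (fst z * fst (snd z), fst z * snd (snd z)))); [|exact C].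
        apply (continuous_comp_2 (fun z : R2 => snd z) (fun z : R2 => (fst z, y))
                 (fun a b => (a, b))); [apply continuous_snd| |].
        { apply continuous_pair; [apply continuous_fst | apply continuous_const]. }
        apply continuous_ext with (fun z => z); [now intros []|apply continuous_id].
  - eapply filter_imp; [|exact (open_slice_u _ _ HO Hq)]; intros s Hs.
    apply (ex_RInt_radial S g k (s, y)); auto; now apply Ck_pred.
Qed.

Lemma open_swap (U : R2 -> Prop) : open U -> open (fun q : R2 => U (snd q, fst q)).
Proof.
  intros HU; apply (open_comp (fun q : R2 => (snd q, fst q)) U); [|exact HU].
  intros [x y] _; apply continuous_pair; [apply continuous_snd | apply continuous_fst].
Qed.

Lemma Ck_swap (n : nat) (U : R2 -> Prop) (g : R2 -> R) :
  open U -> Ck n U g -> Ck n (fun q => U (snd q, fst q)) (fun q => g (snd q, fst q)).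
Proof.
  intros HU Hg.
  assert (HO := open_swap U HU).
  apply (Ck_comp n _ U g); auto using Ck_fst, Ck_snd.
Qed.

(** Exchanging the two coordinates commutes with radial scaling, so this is the previous case for
    the swapped function. *)
Lemma is_derive_radial_mean_v (S : R2 -> Prop) (g : R2 -> R) (k : nat) (q : R2) :
  open S -> star_shaped S -> Ck 1 S g -> S q ->
  is_derive (fun s => radial_mean k g (fst q, s)) (snd q) (radial_mean (Datatypes.S k) (Dv g) q).
Proof.
  intros HO HS Hg Hq; destruct q as [x y].
  apply (is_derive_radial_mean_u (fun q => S (snd q, fst q)) (fun q => g (snd q, fst q))
           k (y, x)); auto.
  - now apply open_swap.
  - intros p t Hp Ht; now apply (HS (snd p, fst p)).
  - now apply Ck_swap.
Qed.

Lemma Ck_radial_mean (n : nat) (S : R2 -> Prop) (g : R2 -> R) (k : nat) :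
  open S -> star_shaped S -> Ck n S g -> Ck n S (radial_mean k g).
Proof.
  intros HO HS; revert g k; induction n as [|n IH]; intros g k Hg.
  - now apply radial_mean_continuous.
  - apply Ck_S_intro with (radial_mean (Datatypes.S k) (Du g)) (radial_mean (Datatypes.S k) (Dv g));
      auto using Ck_Du, Ck_Dv.
    assert (Hg1 : Ck 1 S g) by (apply (Ck_le 1 (Datatypes.S n)); auto; lia).
    intros q Hq; split;
      [now apply is_derive_radial_mean_u with S | now apply is_derive_radial_mean_v with S].
Qed.

(** Fundamental theorem of calculus for [g] along the segment from the origin to [q], with the chain
    rule splitting the integrand. *)
Lemma hadamard (S : R2 -> Prop) (g : R2 -> R) (q : R2) :
  open S -> star_shaped S -> Ck 1 S g -> S q ->
  g q = g (0, 0) + fst q * radial_mean 0 (Du g) q + snd q * radial_mean 0 (Dv g) q.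
Proof.
  intros HO HS Hg Hq; destruct q as [x y].
  set (dg := fun t => x * (t ^ 0 * Du g (t * x, t * y)) + y * (t ^ 0 * Dv g (t * x, t * y))).
  assert (I1 := ex_RInt_radial S (Du g) 0 (x, y) HS (Ck_Du _ _ _ Hg) Hq).
  assert (I2 := ex_RInt_radial S (Dv g) 0 (x, y) HS (Ck_Dv _ _ _ Hg) Hq).
  assert (H1 : is_RInt dg 0 1 (x * radial_mean 0 (Du g) (x, y) + y * radial_mean 0 (Dv g) (x, y))).
  { apply (is_RInt_plus (V := R_NormedModule)); apply (is_RInt_scal (V := R_NormedModule));
      apply (RInt_correct (V := R_CompleteNormedModule)); assumption. }
  assert (H2 : is_RInt dg 0 1 (minus (g (1 * x, 1 * y)) (g (0 * x, 0 * y)))).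
  { apply (is_RInt_derive (V := R_CompleteNormedModule) (fun t => g (t * x, t * y)));
      intros t Ht; rewrite Rmin_left, Rmax_right in Ht by lra.
    - unfold dg; replace (x * (t ^ 0 * Du g (t * x, t * y)) + y * (t ^ 0 * Dv g (t * x, t * y)))
        with (Du g (t * x, t * y) * x + Dv g (t * x, t * y) * y) by (cbn; ring).
      apply (is_derive_comp_pair S g (fun t => t * x) (fun t => t * y)); auto.
      + now apply (HS (x, y)).
      + auto_derive; [trivial|ring].
      + auto_derive; [trivial|ring].
    - apply (continuous_plus (V := R_NormedModule)
        (fun t => x * (t ^ 0 * Du g (t * x, t * y))) (fun t => y * (t ^ 0 * Dv g (t * x, t * y)))).
      + apply (continuous_mult (fun _ => x)); [apply continuous_const|].
        now apply (continuous_radial_slice S (Du g) 0 (x, y)); [|apply Ck_Du| |].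
      + apply (continuous_mult (fun _ => y)); [apply continuous_const|].
        now apply (continuous_radial_slice S (Dv g) 0 (x, y)); [|apply Ck_Dv| |]. }
  assert (E : minus (g (1 * x, 1 * y)) (g (0 * x, 0 * y)) =
     x * radial_mean 0 (Du g) (x, y) + y * radial_mean 0 (Dv g) (x, y)).
  { rewrite <- (is_RInt_unique _ _ _ _ H1); symmetry.
    now apply (is_RInt_unique (V := R_CompleteNormedModule)). }
  unfold minus, plus, opp in E; cbn in E |- *.
  rewrite !Rmult_1_l, !Rmult_0_l in E; lra.
Qed.

(** * Implicit functions *)

(** When [f] vanishes at [x], the difference quotient of the product is that of [f] times a value of
    [w], so continuity of [w] suffices. Below, [w] involves a mean value point about which no more
    than continuity is known. *)
Lemma is_derive_mult_vanishing (f w : R -> R) (x l : R) :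
  is_derive f x l -> f x = 0 -> continuous w x -> is_derive (fun t => f t * w t) x (l * w x).
Proof.
  intros Hf Hx Hw; apply is_derive_Reals in Hf; apply is_derive_Reals.
  apply uniqueness_step3; apply uniqueness_step2 in Hf.
  assert (Hw' : limit1_in (fun h => w (x + h)) (fun h => h <> 0) (w x) 0).
  { intros eps He; destruct (proj1 (filterlim_locally _ _) Hw (mkposreal eps He)) as [d Hd].
    exists d; split; [apply cond_pos|]; intros h [_ Hh]; cbn in Hh; unfold Rdist in Hh.
    apply (Hd (x + h)); unfold ball; cbn; unfold AbsRing_ball, abs, minus, plus, opp; cbn.
    replace (x + h + - x) with (h - 0) by ring; exact Hh. }
  assert (H := limit_mul _ _ _ _ _ _ Hf Hw').
  intros eps He; destruct (H eps He) as [d [Hd Hl]]; exists d; split; [exact Hd|].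
  intros h Hh; specialize (Hl h Hh); rewrite Hx in *.
  replace ((f (x + h) * w (x + h) - 0 * w x) / h) with ((f (x + h) - 0) / h * w (x + h))
    by (field; apply Hh); exact Hl.
Qed.

(** The mean value theorem in the second variable gives [sigma t - sigma t0] as minus
    [p t (sigma t0)] divided by [ps t xi], with [xi] between [sigma t0] and [sigma t]. The numerator
    vanishes at [t0] and the denominator is continuous there, so the preceding product rule
    applies. *)
Lemma is_derive_implicit (p ps : R -> R -> R) (sigma : R -> R) (t0 pt : R) :
  continuous sigma t0 ->
  locally t0 (fun t => p t (sigma t) = 0
     /\ forall s, Rmin (sigma t0) (sigma t) <= s <= Rmax (sigma t0) (sigma t) ->
          is_derive (p t) s (ps t s)) ->
  continuous (fun z : R2 => ps (fst z) (snd z)) (t0, sigma t0) ->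
  ps t0 (sigma t0) <> 0 ->
  is_derive (fun t => p t (sigma t0)) t0 pt ->
  is_derive sigma t0 (- pt / ps t0 (sigma t0)).
Proof.
  intros Hs Hloc Hps Hnz Hpt; set (s0 := sigma t0) in *.
  (* The premise is placed under the existential so that a mean value point can be chosen as a total
     function of [t]. *)
  assert (H : forall t, exists xi,
     (p t (sigma t) = 0
     /\ (forall s, Rmin s0 (sigma t) <= s <= Rmax s0 (sigma t) ->
          is_derive (p t) s (ps t s))) ->
     Rabs (xi - s0) <= Rabs (sigma t - s0) /\ - p t s0 = ps t xi * (sigma t - s0)).
  { intros t.
    destruct (classic (p t (sigma t) = 0
     /\ (forall s, Rmin s0 (sigma t) <= s <= Rmax s0 (sigma t) ->
          is_derive (p t) s (ps t s)))) as [[H1 H2]|Hn]; [|exists 0; tauto].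
    destruct (MVT_gen (p t) s0 (sigma t) (ps t)) as [xi [Hxi Hm]].
    - intros s Hs'; apply H2; lra.
    - intros s Hs'; apply continuity_pt_filterlim.
      apply (@ex_derive_continuous R_AbsRing R_NormedModule); eexists; now apply H2.
    - exists xi; intros _; split; [|rewrite H1 in Hm; lra].
      revert Hxi; unfold Rmin, Rmax, Rabs; destruct (Rle_dec s0 (sigma t));
        repeat destruct (Rcase_abs _); lra. }
  set (xi := fun t => proj1_sig (constructive_indefinite_description _ (H t))).
  assert (Hxi : forall t, (p t (sigma t) = 0
     /\ (forall s, Rmin s0 (sigma t) <= s <= Rmax s0 (sigma t) ->
          is_derive (p t) s (ps t s))) ->
     Rabs (xi t - s0) <= Rabs (sigma t - s0) /\ - p t s0 = ps t (xi t) * (sigma t - s0)).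
  { intros t; exact (proj2_sig (constructive_indefinite_description _ (H t))). }
  clearbody xi; clear H.
  assert (Hxi0 : xi t0 = s0).
  { destruct (Hxi t0 (locally_singleton _ _ Hloc)) as [H1 _]; fold s0 in H1.
    rewrite Rminus_diag, Rabs_R0 in H1; assert (H2 := Rabs_pos (xi t0 - s0)).
    destruct (Req_dec (xi t0 - s0) 0); [lra|]; apply Rabs_no_R0 in H; lra. }
  assert (Hp0 : p t0 s0 = 0) by exact (proj1 (locally_singleton _ _ Hloc)).
  assert (Cxi : continuous xi t0).
  { apply filterlim_locally; intros eps; rewrite Hxi0.
    assert (H1 := proj1 (filterlim_locally _ _) Hs eps).
    generalize (filter_and _ _ H1 Hloc); apply filter_imp.
    intros t [Ht1 Ht2]; apply (Rle_lt_trans _ _ _ (proj1 (Hxi t Ht2)) Ht1). }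
  set (w := fun t => - / ps t (xi t)).
  assert (Cp : continuous (fun t => ps t (xi t)) t0).
  { apply (continuous_comp_2 (fun t => t) xi ps); [apply continuous_id|exact Cxi|].
    rewrite Hxi0; exact Hps. }
  assert (Cw : continuous w t0).
  { apply (continuous_opp (V := R_NormedModule) (fun t => / ps t (xi t))).
    apply (continuous_comp (fun t => ps t (xi t)) Rinv); [exact Cp|].
    apply continuity_pt_filterlim, continuity_pt_inv; [|now rewrite Hxi0].
    apply derivable_continuous_pt, derivable_pt_id. }
  assert (Hnz' : locally t0 (fun t => ps t (xi t) <> 0)).
  { apply (Cp (fun z => z <> 0)); rewrite Hxi0.
    apply (open_neq 0); exact Hnz. }
  apply is_derive_ext_loc with (fun t => p t s0 * w t + s0).
  { generalize (filter_and _ _ Hnz' Hloc); apply filter_imp; intros t [Ht1 Ht2].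
    destruct (Hxi t Ht2) as [_ H2]; unfold w.
    replace (p t s0) with (- (ps t (xi t) * (sigma t - s0))) by lra.
    apply Rminus_diag_uniq; field; exact Ht1. }
  replace (- pt / ps t0 s0) with (pt * w t0 + 0)
    by (unfold w; rewrite Hxi0; field; exact Hnz).
  apply (is_derive_plus (V := R_NormedModule) (fun t => p t s0 * w t) (fun _ => s0));
    [|apply is_derive_cst].
  now apply is_derive_mult_vanishing.
Qed.

Lemma increasing_of_derive_pos (f df : R -> R) (r a b : R) :
  (forall s, Rabs s < r -> is_derive f s (df s) /\ 0 < df s) ->
  Rabs a < r -> Rabs b < r -> a < b -> f a < f b.
Proof.
  intros H Ha Hb Hab; apply Rabs_def2 in Ha, Hb.
  assert (Hr : forall s, a <= s <= b -> Rabs s < r) by (intros; apply Rabs_def1; lra).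
  destruct (MVT_gen f a b df) as [c [Hc Hm]]; rewrite ?Rmin_left, ?Rmax_right in * by lra.
  - intros s Hs; apply H, Hr; lra.
  - intros s Hs; apply continuity_pt_filterlim.
    apply (@ex_derive_continuous R_AbsRing R_NormedModule); eexists; apply H, Hr; lra.
  - destruct (H c (Hr c Hc)) as [_ Hd]; nra.
Qed.

Lemma Ck0_pos_locally (U : R2 -> Prop) (g : R2 -> R) (q : R2) (c : R) :
  open U -> Ck 0 U g -> U q -> c < g q -> locally q (fun x => U x /\ c < g x).
Proof.
  intros HU Hg Hq Hc; apply filter_and; [now apply HU|].
  apply (Hg q Hq (fun y => c < y)); now apply (open_gt c).
Qed.

Lemma open_Ck0_gt (U : R2 -> Prop) (g : R2 -> R) (c : R) :
  open U -> Ck 0 U g -> open (fun x => U x /\ c < g x).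
Proof. intros HU Hg q [Hq Hc]; now apply Ck0_pos_locally. Qed.

(** [P q] is strictly increasing on (-r, r): the intermediate value theorem gives the root, and
    monotonicity gives its uniqueness and continuity. Higher smoothness is left to each application,
    because [Ck] speaks of functions of two variables while [P] has three; there the derivative
    formulas of the conclusion are bootstrapped. *)
Lemma implicit_function (P Ps Pu Pv : R2 -> R -> R) (U : R2 -> Prop) (r : R) :
  open U -> U (0, 0) -> 0 < r ->
  (forall q s, U q -> Rabs s < r -> is_derive (P q) s (Ps q s) /\ 0 < Ps q s) ->
  (forall q s, U q -> Rabs s < r ->
     continuous (fun z : R2 * R => Ps (fst z) (snd z)) (q, s)) ->
  (forall q s, U q -> Rabs s < r ->
     is_derive (fun t => P (t, snd q) s) (fst q) (Pu q s)
     /\ is_derive (fun t => P (fst q, t) s) (snd q) (Pv q s)) ->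
  (forall s, Rabs s < r -> Ck 0 U (fun q => P q s)) ->
  P (0, 0) 0 = 0 ->
  exists (V : R2 -> Prop) (sigma : R2 -> R),
    open V /\ V (0, 0) /\ sigma (0, 0) = 0
    /\ (forall q, V q -> U q /\ Rabs (sigma q) < r /\ P q (sigma q) = 0)
    /\ (forall q s, V q -> Rabs s < r -> P q s = 0 -> s = sigma q)
    /\ Ck 0 V sigma
    /\ (forall q, V q ->
          is_derive (fun t => sigma (t, snd q)) (fst q) (- Pu q (sigma q) / Ps q (sigma q))
          /\ is_derive (fun t => sigma (fst q, t)) (snd q) (- Pv q (sigma q) / Ps q (sigma q))).
Proof.
  intros HU U0 Hr HPs CPs HPuv HC HP0.
  assert (Hmono : forall q a b, U q -> Rabs a < r -> Rabs b < r -> a < b -> P q a < P q b).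
  { intros q a b Hq; apply (increasing_of_derive_pos (P q) (Ps q)).
    intros s Hs; now apply HPs. }
  assert (Huniq : forall q a b, U q -> Rabs a < r -> Rabs b < r ->
      P q a = 0 -> P q b = 0 -> a = b).
  { intros q a b Hq Ha Hb H1 H2; destruct (Rtotal_order a b) as [L|[L|L]]; auto.
    - apply (Hmono q) in L; auto; lra.
    - apply (Hmono q) in L; auto; lra. }
  assert (Rr1 : Rabs (r / 2) < r) by (apply Rabs_def1; lra).
  assert (Rr2 : Rabs (- (r / 2)) < r) by (apply Rabs_def1; lra).
  assert (Rr0 : Rabs 0 < r) by (rewrite Rabs_R0; lra).
  (* The sign change between -r/2 and r/2 is an open condition on [q], true at the origin by
     monotonicity. *)
  set (V := fun q => (U q /\ 0 < P q (r / 2)) /\ (U q /\ 0 < - P q (- (r / 2)))).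
  assert (HV : open V).
  { apply open_and; apply open_Ck0_gt; auto; apply Ck_opp; auto. }
  assert (HVU : forall q, V q -> U q) by (unfold V; tauto).
  assert (V0 : V (0, 0)).
  { assert (H1 := Hmono (0, 0) 0 (r / 2) U0 Rr0 Rr1 ltac:(lra)).
    assert (H2 := Hmono (0, 0) (- (r / 2)) 0 U0 Rr2 Rr0 ltac:(lra)).
    unfold V; repeat split; auto; lra. }
  assert (Hex : forall q, exists s, V q -> Rabs s < r /\ P q s = 0).
  { intros q; destruct (classic (V q)) as [Hq|Hq]; [|exists 0; tauto].
    assert (Hc : forall s, - (r / 2) <= s <= r / 2 -> continuity_pt (P q) s).
    { intros s Hs; apply continuity_pt_filterlim.
      apply (@ex_derive_continuous R_AbsRing R_NormedModule); eexists; apply HPs;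
        [now apply HVU | apply Rabs_def1; lra]. }
    destruct (Ranalysis5.IVT_interv (P q) (- (r / 2)) (r / 2)) as [s [Hs Hs0]];
      [exact Hc|lra|destruct Hq; lra|destruct Hq; lra|].
    exists s; intros _; split; [apply Rabs_def1; lra|exact Hs0]. }
  set (sigma := fun q => proj1_sig (constructive_indefinite_description _ (Hex q))).
  assert (Hsig : forall q, V q -> Rabs (sigma q) < r /\ P q (sigma q) = 0).
  { intros q; exact (proj2_sig (constructive_indefinite_description _ (Hex q))). }
  clearbody sigma; clear Hex.
  assert (Csig : Ck 0 V sigma).
  { intros q Hq; destruct (Hsig q Hq) as [Hs H0]; apply filterlim_locally; intros eps.
    (* With this [e] both [sigma q - e] and [sigma q + e] remain in (-r, r). The signs of [P q] at
       these two points persist for nearby [x] and trap [sigma x] between them. *)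
    set (e := Rmin (eps / 2) ((r - Rabs (sigma q)) / 2)).
    assert (He : 0 < e) by (apply Rmin_case; [destruct eps; cbn|]; lra).
    assert (He1 : e < eps)
      by (apply Rle_lt_trans with (eps / 2); [apply Rmin_l|destruct eps; cbn; lra]).
    assert (He2 : e < r - Rabs (sigma q))
      by (apply Rle_lt_trans with ((r - Rabs (sigma q)) / 2); [apply Rmin_r|lra]).
    assert (Hs' := Rabs_def2 _ _ Hs).
    assert (Rp : Rabs (sigma q + e) < r).
    { apply Rle_lt_trans with (1 := Rabs_triang _ _); rewrite (Rabs_pos_eq e); lra. }
    assert (Rm : Rabs (sigma q - e) < r).
    { apply Rle_lt_trans with (1 := Rabs_triang _ _).
      rewrite Rabs_Ropp, (Rabs_pos_eq e); lra. }
    assert (H1 := Hmono q (sigma q) (sigma q + e) (HVU q Hq) Hs Rp ltac:(lra)).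
    assert (H2 := Hmono q (sigma q - e) (sigma q) (HVU q Hq) Rm Hs ltac:(lra)).
    assert (L1 := Ck0_pos_locally U (fun x => P x (sigma q + e)) q 0 HU (HC _ Rp) (HVU q Hq)
                    ltac:(lra)).
    assert (L2 := Ck0_pos_locally U (fun x => - P x (sigma q - e)) q 0 HU
                    (Ck_opp 0 U (fun x => P x (sigma q - e)) HU (HC _ Rm)) (HVU q Hq) ltac:(cbn; lra)).
    generalize (filter_and _ _ (filter_and _ _ L1 L2) (HV q Hq)); apply filter_imp.
    intros x [[[Ux P1] [_ P2]] Vx]; destruct (Hsig x Vx) as [Sx S0].
    apply Rabs_def1.
    - cut (sigma x < sigma q + e); [intros; unfold minus, plus, opp; cbn; lra|].
      apply Rnot_le_lt; intros [L|L]; [apply (Hmono x) in L; auto; lra|].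
      rewrite <- L in S0; lra.
    - cut (sigma q - e < sigma x); [intros; unfold minus, plus, opp; cbn; lra|].
      apply Rnot_le_lt; intros [L|L]; [apply (Hmono x) in L; auto; lra|].
      rewrite L in S0; lra. }
  exists V, sigma; split; [exact HV|split; [exact V0|]].
  split; [|split; [|split; [|split; [exact Csig|]]]].
  - destruct (Hsig _ V0); now apply (Huniq (0, 0)).
  - intros q Hq; destruct (Hsig q Hq); auto.
  - intros q s Hq Hs H0; destruct (Hsig q Hq); apply (Huniq q); auto.
  - intros [x y] Hq; destruct (Hsig _ Hq) as [Hs H0]; cbn [fst snd].
    destruct (HPuv (x, y) (sigma (x, y)) (HVU _ Hq) Hs) as [Du0 Dv0]; cbn [fst snd] in *.
    assert (Between : forall x' y' s, V (x', y') ->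
       Rmin (sigma (x, y)) (sigma (x', y')) <= s <= Rmax (sigma (x, y)) (sigma (x', y')) ->
       Rabs s < r).
    { intros x' y' s Hv Hb; destruct (Hsig _ Hv) as [Hs' _].
      apply Rabs_def2 in Hs, Hs'; revert Hb; unfold Rmin, Rmax.
      destruct (Rle_dec _ _); intros Hb; apply Rabs_def1; lra. }
    assert (Cu : continuous (fun t => sigma (t, y)) x).
    { apply (continuous_comp (fun t => (t, y)) sigma); [|now apply Csig].
      apply continuous_pair; [apply continuous_id|apply continuous_const]. }
    assert (Cv : continuous (fun t => sigma (x, t)) y).
    { apply (continuous_comp (fun t => (x, t)) sigma); [|now apply Csig].
      apply continuous_pair; [apply continuous_const|apply continuous_id]. }
    split.
    + apply (is_derive_implicit (fun t s => P (t, y) s) (fun t s => Ps (t, y) s)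
              (fun t => sigma (t, y))); auto.
      * eapply filter_imp; [|exact (open_slice_u _ _ HV Hq)]; cbn; intros t Ht.
        split; [now apply Hsig|]; intros s Hb; apply HPs; [now apply HVU|].
        now apply (Between t y).
      * apply (continuous_comp (fun z : R2 => ((fst z, y), snd z))
                 (fun z : R2 * R => Ps (fst z) (snd z))); [|now apply CPs; [apply HVU|]].
        apply (continuous_comp_2 (fun z : R2 => (fst z, y)) (fun z : R2 => snd z)
                 (fun a b => (a, b))); [|apply continuous_snd|].
        { apply continuous_pair; [apply continuous_fst | apply continuous_const]. }
        apply continuous_ext with (fun z => z); [now intros []|apply continuous_id].
      * apply Rgt_not_eq, HPs; auto.
    + apply (is_derive_implicit (fun t s => P (x, t) s) (fun t s => Ps (x, t) s)
              (fun t => sigma (x, t))); auto.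
      * eapply filter_imp; [|exact (open_slice_v _ _ HV Hq)]; cbn; intros t Ht.
        split; [now apply Hsig|]; intros s Hb; apply HPs; [now apply HVU|].
        now apply (Between x t).
      * apply (continuous_comp (fun z : R2 => ((x, fst z), snd z))
                 (fun z : R2 * R => Ps (fst z) (snd z))); [|now apply CPs; [apply HVU|]].
        apply (continuous_comp_2 (fun z : R2 => (x, fst z)) (fun z : R2 => snd z)
                 (fun a b => (a, b))); [|apply continuous_snd|].
        { apply continuous_pair; [apply continuous_const | apply continuous_fst]. }
        apply continuous_ext with (fun z => z); [now intros []|apply continuous_id].
      * apply Rgt_not_eq, HPs; auto.
Qed.

(** * Smooth functions and diffeomorphisms *)

Lemma smooth_const (U : R2 -> Prop) (c : R) : open U -> smooth U (fun _ => c).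
Proof. intros HU n; now apply Ck_const. Qed.

Lemma smooth_fst (U : R2 -> Prop) : open U -> smooth U (fun q => fst q).
Proof. intros HU n; now apply Ck_fst. Qed.

Lemma smooth_snd (U : R2 -> Prop) : open U -> smooth U (fun q => snd q).
Proof. intros HU n; now apply Ck_snd. Qed.

Lemma smooth_plus (U : R2 -> Prop) (f g : R2 -> R) :
  open U -> smooth U f -> smooth U g -> smooth U (fun q => f q + g q).
Proof. intros HU Hf Hg n; now apply Ck_plus. Qed.

Lemma smooth_minus (U : R2 -> Prop) (f g : R2 -> R) :
  open U -> smooth U f -> smooth U g -> smooth U (fun q => f q - g q).
Proof. intros HU Hf Hg n; now apply Ck_minus. Qed.

Lemma smooth_opp (U : R2 -> Prop) (f : R2 -> R) :
  open U -> smooth U f -> smooth U (fun q => - f q).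
Proof. intros HU Hf n; now apply Ck_opp. Qed.

Lemma smooth_mult (U : R2 -> Prop) (f g : R2 -> R) :
  open U -> smooth U f -> smooth U g -> smooth U (fun q => f q * g q).
Proof. intros HU Hf Hg n; now apply Ck_mult. Qed.

Lemma smooth_pow (U : R2 -> Prop) (f : R2 -> R) (k : nat) :
  open U -> smooth U f -> smooth U (fun q => f q ^ k).
Proof.
  intros HU Hf; induction k as [|k IH]; [exact (smooth_const U 1 HU)|].
  now apply (smooth_mult U f (fun q => f q ^ k)).
Qed.

Lemma smooth_div (U : R2 -> Prop) (f g : R2 -> R) :
  open U -> (forall q, U q -> g q <> 0) -> smooth U f -> smooth U g ->
  smooth U (fun q => f q / g q).
Proof. intros HU H0 Hf Hg n; now apply Ck_div. Qed.

Lemma smooth_Du (U : R2 -> Prop) (f : R2 -> R) : smooth U f -> smooth U (Du f).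
Proof. intros Hf n; apply Ck_Du, Hf. Qed.

Lemma smooth_Dv (U : R2 -> Prop) (f : R2 -> R) : smooth U f -> smooth U (Dv f).
Proof. intros Hf n; apply Ck_Dv, Hf. Qed.

Lemma smooth_ext (U : R2 -> Prop) (f g : R2 -> R) :
  open U -> (forall q, U q -> f q = g q) -> smooth U f -> smooth U g.
Proof. intros HU Hfg Hf n; now apply Ck_ext with f. Qed.

Lemma smooth_subset (U V : R2 -> Prop) (g : R2 -> R) :
  (forall q, V q -> U q) -> smooth U g -> smooth V g.
Proof. intros HVU Hg n; now apply Ck_subset with U. Qed.

Lemma smooth_comp (U V : R2 -> Prop) (g a b : R2 -> R) :
  open U -> open V -> (forall q, U q -> V (a q, b q)) ->
  smooth V g -> smooth U a -> smooth U b -> smooth U (fun q => g (a q, b q)).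
Proof. intros HU HV HUV Hg Ha Hb n; now apply Ck_comp with V. Qed.

Lemma smooth_comp_map (U V : R2 -> Prop) (g : R2 -> R) (T : R2 -> R2) :
  open U -> open V -> (forall q, U q -> V (T q)) ->
  smooth V g -> smooth2 U T -> smooth U (fun q => g (T q)).
Proof.
  intros HU HV HUV Hg [H1 H2].
  apply smooth_ext with (fun q => g (fst (T q), snd (T q))); auto.
  - now intros q _; rewrite <- surjective_pairing.
  - apply smooth_comp with V; auto; intros q Hq; rewrite <- surjective_pairing; auto.
Qed.

Lemma smooth_continuous (U : R2 -> Prop) (g : R2 -> R) (q : R2) :
  smooth U g -> U q -> continuous g q.
Proof. intros Hg; exact (Hg 0%nat q). Qed.

Lemma smooth_is_derive (U : R2 -> Prop) (g : R2 -> R) (q : R2) :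
  smooth U g -> U q ->
  is_derive (fun s => g (s, snd q)) (fst q) (Du g q)
  /\ is_derive (fun s => g (fst q, s)) (snd q) (Dv g q).
Proof. intros Hg; exact (Ck_is_derive 0 U g q (Hg 1%nat)). Qed.

Lemma open_preimage (U V : R2 -> Prop) (T : R2 -> R2) :
  open U -> open V -> smooth2 U T -> open (fun q => U q /\ V (T q)).
Proof.
  intros HU HV [H1 H2] q [Hq HT]; apply filter_and; [now apply HU|].
  assert (C : continuous T q).
  { apply continuous_ext with (fun q => (fst (T q), snd (T q)));
      [intros; now rewrite <- surjective_pairing|].
    apply continuous_pair; [now apply smooth_continuous with U|].
    now apply (smooth_continuous U (fun q => snd (T q))). }
  apply (C V); now apply HV.
Qed.

Definition box (r : R) (q : R2) : Prop := Rabs (fst q) < r /\ Rabs (snd q) < r.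

Lemma open_box (r : R) : open (box r).
Proof.
  assert (H : open (fun q : R2 => (True /\ - r < fst q) /\ (True /\ - r < - fst q)
                /\ (True /\ - r < snd q) /\ (True /\ - r < - snd q))).
  { assert (O : open (fun _ : R2 => True)) by apply open_true.
    apply open_and; [|apply open_and; [|apply open_and]];
      apply (open_Ck0_gt (fun _ => True)); auto using Ck_opp, Ck_fst, Ck_snd. }
  intros q [H1 H2]; apply Rabs_def2 in H1, H2.
  eapply filter_imp; [|apply H; repeat split; lra].
  intros x Hx; split; apply Rabs_def1; lra.
Qed.

Lemma star_shaped_box (r : R) : star_shaped (box r).
Proof.
  intros q t [H1 H2] Ht; split; cbn; rewrite Rabs_mult, (Rabs_pos_eq t) by lra;
    [assert (H := Rabs_pos (fst q)) | assert (H := Rabs_pos (snd q))]; nra.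
Qed.

Lemma box_in_open (U : R2 -> Prop) :
  open U -> U (0, 0) -> exists r, 0 < r /\ forall q, box r q -> U q.
Proof.
  intros HU H0; destruct (HU _ H0) as [d Hd]; exists d; split; [apply cond_pos|].
  intros q [H1 H2]; apply Hd, ball_pair; cbn; rewrite Rminus_0_r; assumption.
Qed.

(** * Inversion and composition of diffeomorphisms *)

Lemma diffeo_inv (U V : R2 -> Prop) (g : R2 -> R2) :
  diffeo U V g -> exists h, diffeo V U h
    /\ (forall q, U q -> V (g q) /\ h (g q) = q) /\ (forall q, V q -> U (h q) /\ g (h q) = q).
Proof.
  intros [HU [HV [Hg [h [Hh [H1 H2]]]]]]; exists h; split; [|now split].
  split; [exact HV|split; [exact HU|split; [exact Hh|]]]; exists g; now split.
Qed.

Lemma smooth2_comp (U V : R2 -> Prop) (g T : R2 -> R2) :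
  open U -> open V -> (forall q, U q -> V (T q)) ->
  smooth2 V g -> smooth2 U T -> smooth2 U (fun q => g (T q)).
Proof.
  intros HU HV HUV [H1 H2] HT; split.
  - now apply (smooth_comp_map U V (fun q => fst (g q))).
  - now apply (smooth_comp_map U V (fun q => snd (g q))).
Qed.

Lemma smooth2_subset (U V : R2 -> Prop) (g : R2 -> R2) :
  (forall q, V q -> U q) -> smooth2 U g -> smooth2 V g.
Proof. intros HVU [H1 H2]; split; now apply smooth_subset with U. Qed.

(** Germs share a base point but not their domains: the target of [g] and the source of [k] are
    unrelated, so the composite lives on the points that [g] sends into [V']. *)
Lemma diffeo_comp (U V V' W : R2 -> Prop) (g k : R2 -> R2) :
  diffeo U V g -> diffeo V' W k -> exists B,
    diffeo (fun q => U q /\ V' (g q)) B (fun q => k (g q)) /\ (forall q, B q -> W q).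
Proof.
  intros [HU [HV [Hg [h [Hh [H1 H2]]]]]] [HV' [HW [Hk [l [Hl [H3 H4]]]]]].
  assert (HA := open_preimage _ _ _ HU HV' Hg).
  assert (HB := open_preimage _ _ _ HW HV Hl).
  exists (fun q => W q /\ V (l q)); split; [|tauto].
  split; [exact HA|split; [exact HB|split]].
  - apply (smooth2_comp _ V'); auto; [now intros q []|].
    apply smooth2_subset with U; auto; now intros q [].
  - exists (fun q => h (l q)); split; [|split].
    + apply (smooth2_comp _ V); auto; [now intros q []|].
      apply smooth2_subset with W; auto; now intros q [].
    + intros q [Hq Hgq]; destruct (H1 q Hq), (H3 _ Hgq) as [Hw E]; rewrite E; auto.
    + intros q [Hq Hlq]; destruct (H4 q Hq) as [H5 E5], (H2 _ Hlq) as [H6 E6].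
      rewrite E6, E5; auto.
Qed.

Lemma diffeo_ext (U V : R2 -> Prop) (g k : R2 -> R2) :
  (forall q, U q -> g q = k q) -> diffeo U V g -> diffeo U V k.
Proof.
  intros E [HU [HV [[Ha Hb] [h [Hh [H1 H2]]]]]].
  split; [exact HU|split; [exact HV|split]].
  - split; [apply smooth_ext with (fun q => fst (g q))|apply smooth_ext with (fun q => snd (g q))];
      auto; intros q Hq; now rewrite E.
  - exists h; split; [exact Hh|split].
    + intros q Hq; rewrite <- E by exact Hq; auto.
    + intros q Hq; destruct (H2 q Hq) as [H3 H4]; rewrite <- E by exact H3; auto.
Qed.

Lemma diffeo_swap : diffeo (fun _ => True) (fun _ => True) (fun q => (snd q, fst q)).
Proof.
  assert (O : open (fun _ : R2 => True)) by apply open_true.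
  assert (S : smooth2 (fun _ => True) (fun q => (snd q, fst q)))
    by (split; [now apply smooth_snd | now apply smooth_fst]).
  split; [exact O|split; [exact O|split; [exact S|]]].
  exists (fun q => (snd q, fst q)); split; [exact S|split]; now intros [].
Qed.

(** The last clause eta-reduces, so that an atom matches a hypothesis; whatever is not settled is
    left as a goal. *)
Ltac smooth_auto :=
  repeat match goal with
  | |- smooth _ _ => assumption
  | |- open _ => assumption
  | |- smooth _ (fun _ => ?c) => apply smooth_const
  | |- smooth _ (fun q => fst q) => apply smooth_fst
  | |- smooth _ (fun q => snd q) => apply smooth_snd
  | |- smooth _ (fun q => @?f q + @?g q) => apply (smooth_plus _ f g)
  | |- smooth _ (fun q => @?f q - @?g q) => apply (smooth_minus _ f g)
  | |- smooth _ (fun q => @?f q * @?g q) => apply (smooth_mult _ f g)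
  | |- smooth _ (fun q => - @?f q) => apply (smooth_opp _ f)
  | |- smooth _ (fun q => @?f q ^ ?k) => apply (smooth_pow _ f k)
  | |- smooth _ fst => apply smooth_fst
  | |- smooth _ snd => apply smooth_snd
  | |- smooth _ (Du _) => apply smooth_Du
  | |- smooth _ (Dv _) => apply smooth_Dv
  | |- smooth _ (fun q => Du ?f q) => apply (smooth_Du _ f)
  | |- smooth _ (fun q => Dv ?f q) => apply (smooth_Dv _ f)
  | |- smooth _ (fun q => ?f q) => change (smooth _ f)
  end.

(** At the origin the cubic in [s] has the root 0 with derivative 1. The coefficient of [s] is
    normalised to 1 so that the positivity required by [implicit_function] is a perturbation of this
    value. *)
Lemma smooth_cubic_root (U : R2 -> Prop) (a c e : R2 -> R) :
  open U -> U (0, 0) -> smooth U a -> smooth U c -> smooth U e -> a (0, 0) = 0 ->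
  exists (V : R2 -> Prop) (s : R2 -> R),
    open V /\ V (0, 0) /\ (forall q, V q -> U q) /\ smooth V s /\ s (0, 0) = 0
    /\ forall q, V q -> a q + s q + s q ^ 2 * c q + s q ^ 3 * e q = 0.
Proof.
  intros HU U0 Ha Hc He a0.
  (* A strict bound for [c] and [e] at the origin, which therefore persists nearby. *)
  set (M := 1 + Rabs (c (0, 0)) + Rabs (e (0, 0))).
  assert (P1 := Rabs_pos (c (0, 0))); assert (P2 := Rabs_pos (e (0, 0))).
  assert (HM : 1 <= M) by (unfold M; lra).
  set (U' := fun q => (U q /\ - M < c q) /\ (U q /\ - M < - c q)
                   /\ (U q /\ - M < e q) /\ (U q /\ - M < - e q)).
  assert (HU' : open U').
  { apply open_and; [|apply open_and; [|apply open_and]];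
      apply open_Ck0_gt; auto; try apply Ck_opp; auto. }
  assert (HUU : forall q, U' q -> U q) by (unfold U'; tauto).
  assert (U'0 : U' (0, 0)).
  { unfold U', M; assert (H1 := Rle_abs (c (0, 0))); assert (H2 := Rle_abs (- c (0, 0))).
    assert (H3 := Rle_abs (e (0, 0))); assert (H4 := Rle_abs (- e (0, 0))).
    rewrite Rabs_Ropp in H2, H4; repeat split; auto; lra. }
  (* For [Rabs s < r] both [s * c] and [s * e] are at most 1/10 in absolute value, and [s * (s * e)]
     at most 1/100, so the derivative is at least 1 - 2/10 - 3/100. *)
  set (r := / (10 * M)).
  assert (Hr : 0 < r) by (apply Rinv_0_lt_compat; lra).
  assert (HrM : r * M = / 10) by (unfold r; field; lra).
  assert (Hr1 : r <= / 10) by (rewrite <- HrM; nra).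
  set (P := fun q s => a q + s + s ^ 2 * c q + s ^ 3 * e q).
  set (Ps := fun q s => 1 + 2 * s * c q + 3 * s ^ 2 * e q).
  assert (HPs : forall q s, U' q -> Rabs s < r -> 0 < Ps q s).
  { intros q s Hq Hs; unfold Ps; apply Rabs_def2 in Hs.
    assert (Hc' : - M < c q < M) by (unfold U' in Hq; lra).
    assert (He' : - M < e q < M) by (unfold U' in Hq; lra).
    assert (A1 : Rabs (s * c q) <= / 10).
    { rewrite Rabs_mult, <- HrM; apply Rmult_le_compat; try apply Rabs_pos;
        apply Rlt_le, Rabs_def1; lra. }
    assert (A2 : Rabs (s * e q) <= / 10).
    { rewrite Rabs_mult, <- HrM; apply Rmult_le_compat; try apply Rabs_pos;
        apply Rlt_le, Rabs_def1; lra. }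
    assert (A3 : Rabs (s * (s * e q)) <= / 10 * / 10).
    { rewrite Rabs_mult; apply Rmult_le_compat; try apply Rabs_pos; auto.
      apply Rlt_le, Rabs_def1; lra. }
    apply Rabs_le_between in A1, A3.
    replace (1 + 2 * s * c q + 3 * s ^ 2 * e q)
      with (1 + 2 * (s * c q) + 3 * (s * (s * e q))) by ring; lra. }
  destruct (implicit_function P Ps
     (fun q s => Du a q + s ^ 2 * Du c q + s ^ 3 * Du e q)
     (fun q s => Dv a q + s ^ 2 * Dv c q + s ^ 3 * Dv e q) U' r)
    as [V [sg [HV [V0 [sg0 [Hsg [_ [Csg Dsg]]]]]]]]; auto.
  - intros q s Hq Hs; split; [|now apply HPs].
    unfold P, Ps; auto_derive; [trivial|ring].
  - intros q s Hq Hs; unfold Ps.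
    assert (C1 : continuous (fun z : R2 * R => c (fst z)) (q, s)).
    { apply (continuous_comp (fun z : R2 * R => fst z) c); [apply continuous_fst|].
      apply (smooth_continuous U); auto. }
    assert (C2 : continuous (fun z : R2 * R => e (fst z)) (q, s)).
    { apply (continuous_comp (fun z : R2 * R => fst z) e); [apply continuous_fst|].
      apply (smooth_continuous U); auto. }
    assert (C3 : forall k, continuous (fun z : R2 * R => snd z ^ k) (q, s)).
    { intros k; apply (continuous_comp (fun z : R2 * R => snd z) (fun s => s ^ k));
        [apply continuous_snd|].
      apply (@ex_derive_continuous R_AbsRing R_NormedModule); auto_derive; trivial. }
    apply continuous_ext with (fun z : R2 * R =>
      plus (plus 1 (mult 2 (mult (snd z ^ 1) (c (fst z)))))
           (mult 3 (mult (snd z ^ 2) (e (fst z))))).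
    { intros z; unfold plus, mult; cbn; ring. }
    apply (continuous_plus (V := R_NormedModule)); [apply (continuous_plus (V := R_NormedModule))|].
    + apply continuous_const.
    + apply (continuous_mult (K := R_AbsRing)); [apply continuous_const|].
      now apply (continuous_mult (K := R_AbsRing) (fun z : R2 * R => snd z ^ 1)).
    + apply (continuous_mult (K := R_AbsRing)); [apply continuous_const|].
      now apply (continuous_mult (K := R_AbsRing) (fun z : R2 * R => snd z ^ 2)).
  - intros [x y] s Hq Hs; apply HUU in Hq.
    destruct (smooth_is_derive U a _ Ha Hq) as [a1 a2], (smooth_is_derive U c _ Hc Hq) as [c1 c2],
      (smooth_is_derive U e _ He Hq) as [e1 e2]; unfold P; cbn [fst snd] in *.
    split.
    + replace (Du a (x, y) + s ^ 2 * Du c (x, y) + s ^ 3 * Du e (x, y))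
        with (Du a (x, y) + 0 + s ^ 2 * Du c (x, y) + s ^ 3 * Du e (x, y)) by ring.
      repeat apply (is_derive_plus (V := R_NormedModule)); auto.
      * apply is_derive_cst.
      * now apply (is_derive_scal (fun t => c (t, y))).
      * now apply (is_derive_scal (fun t => e (t, y))).
    + replace (Dv a (x, y) + s ^ 2 * Dv c (x, y) + s ^ 3 * Dv e (x, y))
        with (Dv a (x, y) + 0 + s ^ 2 * Dv c (x, y) + s ^ 3 * Dv e (x, y)) by ring.
      repeat apply (is_derive_plus (V := R_NormedModule)); auto.
      * apply is_derive_cst.
      * now apply (is_derive_scal (fun t => c (x, t))).
      * now apply (is_derive_scal (fun t => e (x, t))).
  - intros s Hs; apply Ck_subset with U; auto.
    assert (S : smooth U (fun q => P q s)) by (unfold P; smooth_auto).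
    apply S.
  - unfold P; rewrite a0; ring.
  - exists V, sg; split; [exact HV|split; [exact V0|split; [|split; [|split; [exact sg0|]]]]].
    + intros q Hq; apply HUU, Hsg, Hq.
    (* Bootstrap: if [sg] is of class [n], the quotients giving its partial derivatives are too, so
       [sg] is of class n+1. *)
    + intros n; induction n as [|n IH]; [exact Csg|].
      assert (HVU : forall q, V q -> U q) by (intros q Hq; apply HUU, Hsg, Hq).
      assert (Sub : forall g, smooth U g -> Ck n V g)
        by (intros g Hg; apply (smooth_subset U V g HVU Hg n)).
      assert (Hpow : forall k, Ck n V (fun q => sg q ^ k)).
      { intros k; induction k as [|k IHk]; [exact (Ck_const n V 1 HV)|now apply (Ck_mult n V sg)]. }
      assert (Hden : Ck n V (fun q => Ps q (sg q))).
      { unfold Ps; repeat (apply Ck_plus || apply Ck_mult); auto using Ck_const. }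
      apply Ck_S_intro with (2 := Dsg); auto.
      * apply Ck_div; auto.
        { intros q Hq; apply Rgt_not_eq, HPs; apply Hsg, Hq. }
        apply Ck_opp; auto; repeat (apply Ck_plus || apply Ck_mult);
          auto using smooth_Du, Ck_const.
      * apply Ck_div; auto.
        { intros q Hq; apply Rgt_not_eq, HPs; apply Hsg, Hq. }
        apply Ck_opp; auto; repeat (apply Ck_plus || apply Ck_mult);
          auto using smooth_Dv, Ck_const.
    + intros q Hq; apply Hsg, Hq.
Qed.

(** * The inverse function theorem *)

(** The second coordinate is kept, so inverting amounts to solving g(s, y) = x for [s]. Dividing by
    [Du g (0, 0)] makes the derivative positive whatever its sign. *)
Lemma shear_diffeo (U : R2 -> Prop) (g : R2 -> R) :
  open U -> U (0, 0) -> smooth U g -> g (0, 0) = 0 -> Du g (0, 0) <> 0 ->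
  exists A B, diffeo A B (fun q => (g q, snd q)) /\ A (0, 0) /\ (forall q, A q -> U q).
Proof.
  intros HU U0 Hg g0 Hd; set (d := Du g (0, 0)) in *.
  assert (HU1 : open (fun q => U q /\ 1 / 2 < / d * Du g q)).
  { apply open_Ck0_gt; auto.
    assert (S : smooth U (fun q => / d * Du g q)) by smooth_auto; exact (S 0%nat). }
  destruct (box_in_open _ HU1) as [r [Hr Hbox]].
  { split; [exact U0|]; fold d; rewrite Rinv_l; auto; lra. }
  assert (HbU : forall q, box r q -> U q) by (intros q Hq; apply Hbox, Hq).
  (* The parameter of the equation is (x, y) with [x] the target value; [x] is unrestricted and only
     [y] is confined. *)
  set (W := fun q : R2 => (True /\ - r < snd q) /\ (True /\ - r < - snd q)).
  assert (HW : open W).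
  { assert (O : open (fun _ : R2 => True)) by apply open_true.
    apply open_and; apply (open_Ck0_gt (fun _ => True)); auto using Ck_opp, Ck_snd. }
  assert (HWb : forall q s, W q -> Rabs s < r -> box r (s, snd q)).
  { intros q s Hq Hs; split; [exact Hs|]; apply Rabs_def1; cbn; destruct Hq; lra. }
  destruct (implicit_function (fun q s => / d * (g (s, snd q) - fst q))
     (fun q s => / d * Du g (s, snd q)) (fun q s => - / d) (fun q s => / d * Dv g (s, snd q)) W r)
    as [V [a [HV [V0 [a0 [Ha [Huniq [Ca Da]]]]]]]]; auto.
  - split; split; cbn; auto; lra.
  - intros q s Hq Hs; assert (Hb := HWb q s Hq Hs); split.
    + apply (is_derive_scal (fun s => g (s, snd q) - fst q)).
      rewrite <- (Rminus_0_r (Du g _)).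
      apply (is_derive_minus (V := R_NormedModule) (fun s => g (s, snd q)) (fun _ => fst q));
        [|apply is_derive_cst].
      apply (smooth_is_derive U g (s, snd q)); auto.
    + assert (H := Hbox _ Hb); lra.
  - intros q s Hq Hs; assert (Hb := HWb q s Hq Hs).
    apply (continuous_mult (K := R_AbsRing)); [apply continuous_const|].
    apply (continuous_comp (fun z : R2 * R => (snd z, snd (fst z))) (Du g)).
    + apply continuous_pair; [apply continuous_snd|].
      apply (continuous_comp (fun z : R2 * R => fst z) (fun w : R2 => snd w));
        [apply continuous_fst|destruct q; apply continuous_snd].
    + apply (smooth_continuous U); auto using smooth_Du.
  - intros [x y] s Hq Hs; assert (Hb := HWb _ s Hq Hs); cbn [fst snd] in *; split.
    + auto_derive; [trivial|ring].
    + apply (is_derive_scal (fun t => g (s, t) - x)).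
      rewrite <- (Rminus_0_r (Dv g _)).
      apply (is_derive_minus (V := R_NormedModule) (fun t => g (s, t)) (fun _ => x));
        [|apply is_derive_cst].
      apply (smooth_is_derive U g (s, y)); auto.
  - intros s Hs.
    assert (Sg : smooth W (fun q => / d * (g (s, snd q) - fst q))).
    { smooth_auto; apply (smooth_comp W U g (fun _ => s)); auto; smooth_auto. }
    apply Sg.
  - cbn [fst snd]; rewrite g0; ring.
  - assert (Hab : forall q, V q -> box r (a q, snd q)) by (intros q Hq; apply HWb; apply Ha, Hq).
    assert (Hga : forall q, V q -> g (a q, snd q) = fst q).
    { intros q Hq; destruct (Ha q Hq) as [_ [_ H]]; apply Rmult_integral in H.
      destruct H as [H|H]; [|lra]; now apply Rinv_neq_0_compat in H. }
    assert (Sa : smooth V a).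
    { intros n; induction n as [|n IH]; [exact Ca|].
      assert (Hcomp : forall h, smooth U h -> Ck n V (fun q => h (a q, snd q))).
      { intros h Hh; apply (Ck_comp n V U h a); auto using Ck_snd. }
      assert (Hnz : forall q, V q -> / d * Du g (a q, snd q) <> 0).
      { intros q Hq; assert (H := Hbox _ (Hab q Hq)); lra. }
      apply Ck_S_intro with (2 := Da); auto;
        apply Ck_div; auto; repeat (apply Ck_opp || apply Ck_mult);
        auto using Ck_const, smooth_Du, smooth_Dv. }
    assert (Sgb : smooth2 (box r) (fun q => (g q, snd q))).
    { split; cbn [fst snd]; [now apply smooth_subset with U|apply smooth_snd, open_box]. }
    exists (fun q => box r q /\ V (g q, snd q)), V; split; [|split].
    + split; [apply (open_preimage (box r) V); auto using open_box|split; [exact HV|split]].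
      * apply smooth2_subset with (2 := Sgb); now intros q [].
      * exists (fun q => (a q, snd q)); split; [|split].
        { split; cbn [fst snd]; auto using smooth_snd. }
        { intros [x y] [Hb Hv]; split; [exact Hv|]; f_equal.
          symmetry; apply (Huniq (g (x, y), y)); [exact Hv|apply Hb|cbn; ring]. }
        { intros [x y] Hq; assert (H := Hga _ Hq); assert (H' := Hab _ Hq); cbn in *.
          rewrite H; auto. }
    + split; [split; cbn; rewrite Rabs_R0; auto|]; now rewrite g0.
    + intros q [Hq _]; auto.
Qed.

(** The condition on the first component makes the first shear invertible; the Jacobian condition
    then does the same for the second. *)
Lemma inverse_function (U : R2 -> Prop) (G : R2 -> R2) :
  open U -> U (0, 0) -> smooth2 U G -> G (0, 0) = (0, 0) ->
  Du (fun q => fst (G q)) (0, 0) <> 0 -> jacobian G (0, 0) <> 0 ->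
  exists A B, diffeo A B G /\ A (0, 0) /\ (forall q, A q -> U q).
Proof.
  intros HU U0 [S1 S2] G0 Hu Hj.
  set (g1 := fun q => fst (G q)) in *; set (g2 := fun q => snd (G q)) in *.
  assert (E1 : g1 (0, 0) = 0) by (unfold g1; now rewrite G0).
  assert (E2 : g2 (0, 0) = 0) by (unfold g2; now rewrite G0).
  destruct (shear_diffeo U g1) as [A1 [B1 [D1 [A10 A1U]]]]; auto.
  destruct (diffeo_inv _ _ _ D1) as [h [Dh [Hgh Hhg]]].
  assert (OA := proj1 D1); assert (OB := proj1 Dh).
  assert (B10 : B1 (0, 0)) by (generalize (proj1 (Hgh _ A10)); cbn; now rewrite E1).
  set (k := fun q => g2 (h (snd q, fst q))).
  set (B1' := fun q : R2 => B1 (snd q, fst q)).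
  assert (OB' : open B1') by now apply open_swap.
  assert (Sk0 : smooth B1 (fun q => g2 (h q))).
  { apply (smooth_comp_map B1 A1 g2 h); auto; [intros q Hq; apply Hhg, Hq| |apply Dh].
    now apply smooth_subset with U. }
  assert (Sk : smooth B1' k).
  { apply (smooth_comp B1' B1 (fun q => g2 (h q)) (fun q => snd q) (fun q => fst q)); auto;
      smooth_auto. }
  (* [G] factors through the first shear, and its determinant is the product of those of the two
     factors. *)
  assert (Hchain : Du g1 (0, 0) * Du k (0, 0) = jacobian G (0, 0)).
  { assert (C : forall q, A1 q -> g2 q = g2 (h (g1 q, snd q))).
    { intros q Hq; destruct (Hgh q Hq) as [_ H]; unfold k; cbn [fst snd]; now rewrite H. }
    set (m := fun q => g2 (h q)) in *.
    assert (Hm : Du k (0, 0) = Dv m (0, 0)) by reflexivity.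
    destruct (smooth_is_derive U g1 (0, 0) S1 U0) as [g1u g1v]; cbn [fst snd] in *.
    assert (Bg : B1 (g1 (0, 0), 0)) by now rewrite E1.
    assert (X := is_derive_comp_pair B1 m (fun s => g1 (s, 0)) (fun _ => 0) 0 _ 0
                   OB Bg (Sk0 1%nat) g1u (is_derive_cst 0 0)).
    assert (Y := is_derive_comp_pair B1 m (fun s => g1 (0, s)) (fun s => s) 0 _ 1
                   OB Bg (Sk0 1%nat) g1v (is_derive_idR 0)).
    cbv beta in X, Y; rewrite E1 in X, Y; apply is_derive_unique in X, Y.
    assert (X' := Du_ext_on A1 g2 (fun q => m (g1 q, snd q)) (0, 0) OA C A10).
    assert (Y' := Dv_ext_on A1 g2 (fun q => m (g1 q, snd q)) (0, 0) OA C A10).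
    unfold Du at 1 in X'; cbn [fst snd] in X'; unfold Dv at 1 in Y'; cbn [fst snd] in Y'.
    unfold jacobian; fold g1 g2; rewrite Hm.
    replace (Du g2 (0, 0)) with (Du m (0, 0) * Du g1 (0, 0) + Dv m (0, 0) * 0)
      by (symmetry; etransitivity; [exact X'|exact X]).
    replace (Dv g2 (0, 0)) with (Du m (0, 0) * Dv g1 (0, 0) + Dv m (0, 0) * 1)
      by (symmetry; etransitivity; [exact Y'|exact Y]).
    ring. }
  destruct (shear_diffeo B1' k) as [A2 [B2 [D2 [A20 A2B]]]]; auto.
  { change (g2 (h (0, 0)) = 0); destruct (Hgh _ A10) as [_ H]; cbn [snd] in H.
    rewrite E1 in H; now rewrite H. }
  { intros H; rewrite H in Hchain; apply Hj; lra. }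
  (* [G] is the shear [(g1, v)] followed by the shear [(x, k)] in the other variable. *)
  destruct (diffeo_comp _ _ _ _ _ _ D1 diffeo_swap) as [C1 [E3 _]].
  destruct (diffeo_comp _ _ _ _ _ _ E3 D2) as [C2 [E4 _]].
  destruct (diffeo_comp _ _ _ _ _ _ E4 diffeo_swap) as [C3 [E5 _]].
  cbn [fst snd] in E5.
  exists (fun q => ((A1 q /\ True) /\ A2 (snd q, g1 q)) /\ True), C3; split; [|split].
  - apply diffeo_ext with (2 := E5); intros q [[[Hq _] _] _].
    destruct (Hgh q Hq) as [_ H]; unfold k; cbn [fst snd]; rewrite H.
    unfold g1, g2; now rewrite <- surjective_pairing.
  - cbn; rewrite E1; auto.
  - intros q [[[Hq _] _] _]; auto.
Qed.

(** * Cubic expansions and right equivalence *)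

Lemma smooth_radial_mean (S : R2 -> Prop) (g : R2 -> R) (k : nat) :
  open S -> star_shaped S -> smooth S g -> smooth S (radial_mean k g).
Proof. intros HO HS Hg n; now apply Ck_radial_mean. Qed.

Lemma radial_mean_0 (k : nat) (g : R2 -> R) :
  radial_mean k g (0, 0) = g (0, 0) / INR (S k).
Proof.
  assert (Hk : INR (S k) <> 0) by (apply not_0_INR; lia).
  unfold radial_mean; apply (is_RInt_unique (V := R_CompleteNormedModule)).
  assert (H : is_RInt (fun t => t ^ k * g (0, 0)) 0 1
     (minus (1 ^ S k * (g (0, 0) / INR (S k))) (0 ^ S k * (g (0, 0) / INR (S k))))).
  { apply (is_RInt_derive (V := R_CompleteNormedModule)
             (fun t => t ^ S k * (g (0, 0) / INR (S k)))).
    - intros t _; auto_derive; [trivial|].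
      change (1 * (INR (S k) * t ^ k) * (g (0, 0) / INR (S k)) = t ^ k * g (0, 0)).
      field; exact Hk.
    - intros t _; apply (@ex_derive_continuous R_AbsRing R_NormedModule).
      auto_derive; trivial. }
  replace (g (0, 0) / INR (S k))
    with (minus (1 ^ S k * (g (0, 0) / INR (S k))) (0 ^ S k * (g (0, 0) / INR (S k)))).
  - apply is_RInt_ext with (2 := H); intros t _; cbn [fst snd].
    now rewrite !Rmult_0_r.
  - change (1 ^ S k * (g (0, 0) / INR (S k)) - 0 ^ S k * (g (0, 0) / INR (S k))
            = g (0, 0) / INR (S k)).
    rewrite pow1, pow_i by lia; ring.
Qed.

Lemma Du_radial_mean (S : R2 -> Prop) (g : R2 -> R) (k : nat) (q : R2) :
  open S -> star_shaped S -> smooth S g -> S q ->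
  Du (radial_mean k g) q = radial_mean (Datatypes.S k) (Du g) q.
Proof.
  intros HO HS Hg Hq; apply is_derive_unique; now apply is_derive_radial_mean_u with S.
Qed.

Lemma Dv_radial_mean (S : R2 -> Prop) (g : R2 -> R) (k : nat) (q : R2) :
  open S -> star_shaped S -> smooth S g -> S q ->
  Dv (radial_mean k g) q = radial_mean (Datatypes.S k) (Dv g) q.
Proof.
  intros HO HS Hg Hq; apply is_derive_unique; now apply is_derive_radial_mean_v with S.
Qed.

Lemma radial_mean_ext (S : R2 -> Prop) (f g : R2 -> R) (k : nat) (q : R2) :
  star_shaped S -> (forall x, S x -> f x = g x) -> S q ->
  radial_mean k f q = radial_mean k g q.
Proof.
  intros HS Hfg Hq; apply RInt_ext; intros t Ht.
  rewrite Rmin_left, Rmax_right in Ht by lra; rewrite Hfg; [easy|apply HS; [easy|lra]].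
Qed.

(** Hadamard's lemma applied three times. A coefficient of one stage is differentiated at the next,
    which raises its weight by one; hence the nested weights in [T2] and [T3], whose values at the
    origin carry 1/2 and 1/6. Equality of mixed derivatives merges three orderings of each mixed
    term, hence the factor 3 in B and C. *)
Lemma cubic_expansion (S : R2 -> Prop) (J : R2 -> R) :
  open S -> star_shaped S -> S (0, 0) -> smooth S J ->
  J (0, 0) = 0 -> Du J (0, 0) = 0 -> Dv J (0, 0) = 0 ->
  Du (Du J) (0, 0) = 0 -> Dv (Du J) (0, 0) = 0 -> Dv (Dv J) (0, 0) = 0 ->
  exists A B C D : R2 -> R,
    smooth S A /\ smooth S B /\ smooth S C /\ smooth S D
    /\ (forall q, S q -> J q = fst q ^ 3 * A q + fst q ^ 2 * snd q * B q
                               + fst q * snd q ^ 2 * C q + snd q ^ 3 * D q)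
    /\ A (0, 0) = Du (Du (Du J)) (0, 0) / 6
    /\ B (0, 0) = Dv (Du (Du J)) (0, 0) / 2
    /\ C (0, 0) = Dv (Dv (Du J)) (0, 0) / 2
    /\ D (0, 0) = Dv (Dv (Dv J)) (0, 0) / 6.
Proof.
  intros HO HS S0 HJ j0 ju jv juu juv jvv.
  set (T1 := fun g => radial_mean 0 g).
  set (T2 := fun g => radial_mean 0 (radial_mean 1 g)).
  set (T3 := fun g => radial_mean 0 (radial_mean 1 (radial_mean 2 g))).
  assert (HT3 : forall g, smooth S g -> smooth S (T3 g)).
  { intros g Hg; unfold T3; auto using smooth_radial_mean. }
  assert (E1 : forall g q, smooth S g -> S q ->
     T1 g q = g (0, 0) + fst q * T2 (Du g) q + snd q * T2 (Dv g) q).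
  { intros g q Hg Hq; unfold T1, T2.
    rewrite (hadamard S (radial_mean 0 g) q HO HS) at 1;
      [|now apply (smooth_radial_mean S g 0)|exact Hq].
    rewrite radial_mean_0; cbn [INR].
    rewrite (radial_mean_ext S (Du (radial_mean 0 g)) (radial_mean 1 (Du g)) 0 q HS);
      [|intros; now apply Du_radial_mean with S|exact Hq].
    rewrite (radial_mean_ext S (Dv (radial_mean 0 g)) (radial_mean 1 (Dv g)) 0 q HS);
      [|intros; now apply Dv_radial_mean with S|exact Hq].
    field. }
  assert (E2 : forall g q, smooth S g -> S q ->
     T2 g q = g (0, 0) / 2 + fst q * T3 (Du g) q + snd q * T3 (Dv g) q).
  { intros g q Hg Hq; unfold T2, T3.
    assert (Hg1 : smooth S (radial_mean 1 g)) by now apply smooth_radial_mean.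
    rewrite (hadamard S (radial_mean 0 (radial_mean 1 g)) q HO HS) at 1;
      [|now apply (smooth_radial_mean S _ 0)|exact Hq].
    rewrite !radial_mean_0; cbn [INR].
    rewrite (radial_mean_ext S (Du (radial_mean 0 (radial_mean 1 g)))
               (radial_mean 1 (radial_mean 2 (Du g))) 0 q HS); [| |exact Hq].
    2: { intros x Hx; rewrite (Du_radial_mean S) by auto.
         apply radial_mean_ext with S; auto; intros; now apply Du_radial_mean with S. }
    rewrite (radial_mean_ext S (Dv (radial_mean 0 (radial_mean 1 g)))
               (radial_mean 1 (radial_mean 2 (Dv g))) 0 q HS); [| |exact Hq].
    2: { intros x Hx; rewrite (Dv_radial_mean S) by auto.
         apply radial_mean_ext with S; auto; intros; now apply Dv_radial_mean with S. }
    field. }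
  assert (Hu : smooth S (Du J)) by now apply smooth_Du.
  assert (Hv : smooth S (Dv J)) by now apply smooth_Dv.
  assert (Comm : forall g q, smooth S g -> S q -> Du (Dv g) q = Dv (Du g) q).
  { intros g q Hg Hq; now apply Du_Dv_comm with S; [|apply Hg|]. }
  assert (X1 : forall q, S q -> T2 (Du (Dv J)) q = T2 (Dv (Du J)) q).
  { intros q Hq; unfold T2.
    apply (radial_mean_ext S _ _ 0 q HS); [intros x Hx|exact Hq].
    apply (radial_mean_ext S _ _ 1 x HS); [intros y Hy; now apply Comm|exact Hx]. }
  assert (X2 : forall g h q, (forall x, S x -> g x = h x) -> S q -> T3 g q = T3 h q).
  { intros g h q Hgh Hq; unfold T3.
    apply (radial_mean_ext S _ _ 0 q HS); [intros x Hx|exact Hq].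
    apply (radial_mean_ext S _ _ 1 x HS); [intros y Hy|exact Hx].
    now apply (radial_mean_ext S _ _ 2 y HS). }
  assert (X3 : forall x, S x -> Du (Dv (Dv J)) x = Dv (Dv (Du J)) x).
  { intros x Hx; rewrite Comm by assumption; apply Dv_ext_on with S; auto. }
  assert (V3 : forall g, T3 g (0, 0) = g (0, 0) / 6).
  { intros g; unfold T3; rewrite !radial_mean_0; cbn [INR]; field. }
  exists (T3 (Du (Du (Du J)))), (fun q => 3 * T3 (Dv (Du (Du J))) q),
    (fun q => 3 * T3 (Dv (Dv (Du J))) q), (T3 (Dv (Dv (Dv J)))).
  assert (Huu : smooth S (Du (Du J))) by now apply smooth_Du.
  assert (Huv : smooth S (Dv (Du J))) by now apply smooth_Dv.
  assert (Hvv : smooth S (Dv (Dv J))) by now apply smooth_Dv.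
  split; [now apply HT3, smooth_Du|].
  split; [apply smooth_mult; auto using smooth_const, smooth_Du, smooth_Dv|].
  split; [apply smooth_mult; auto using smooth_const, smooth_Du, smooth_Dv|].
  split; [now apply HT3, smooth_Dv|].
  split; [|rewrite !V3; repeat split; field].
  intros q Hq; rewrite (hadamard S J q HO HS (HJ 1%nat) Hq).
  change (radial_mean 0 (Du J)) with (T1 (Du J)); change (radial_mean 0 (Dv J)) with (T1 (Dv J)).
  rewrite (E1 (Du J) q), (E1 (Dv J) q), X1 by assumption.
  rewrite (E2 (Du (Du J)) q), (E2 (Dv (Du J)) q), (E2 (Dv (Dv J)) q) by assumption.
  rewrite (X2 (Du (Dv (Du J))) (Dv (Du (Du J))) q), (X2 _ _ q X3) by auto.
  rewrite j0, ju, jv, juu, juv, jvv; field.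
Qed.

(** * Right equivalence and changes of chart *)

Lemma R_equivalent_sym (g h : R2 -> R) (x y : R2) :
  R_equivalent g x h y -> R_equivalent h y g x.
Proof.
  intros [A [B [th [D [Ax [E H]]]]]]; destruct (diffeo_inv _ _ _ D) as [k [Dk [H1 H2]]].
  exists B, A, k; split; [exact Dk|]; rewrite <- E; destruct (H1 x Ax) as [Hb Hk].
  split; [exact Hb|split; [exact Hk|]].
  intros q Hq; destruct (H2 q Hq) as [Ha Hq']; rewrite <- (H _ Ha); now rewrite Hq'.
Qed.

Lemma R_equivalent_chart (U V : R2 -> Prop) (Phi : R2 -> R2) (h g : R2 -> R) (x y : R2) :
  diffeo U V Phi -> U y ->
  R_equivalent h x (fun q => g (Phi q)) y <-> R_equivalent h x g (Phi y).
Proof.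
  intros D Uy; split.
  - intros [A [B [th [Dt [Ax [E H]]]]]].
    destruct (diffeo_comp _ _ _ _ _ _ Dt D) as [C [DC _]].
    eexists; exists C, (fun q => Phi (th q)); split; [exact DC|]; cbn beta; rewrite E.
    split; [now split|split; [easy|]]; intros q [Hq _]; now apply H.
  - intros [A [B [th [Dt [Ax [E H]]]]]].
    destruct (diffeo_inv _ _ _ D) as [k [Dk [H1 H2]]].
    destruct (diffeo_comp _ _ _ _ _ _ Dt Dk) as [C [DC _]].
    destruct (H1 y Uy) as [Hv Hk].
    eexists; exists C, (fun q => k (th q)); split; [exact DC|]; cbn beta; rewrite E.
    split; [now split|split; [exact Hk|]].
    intros q [Hq Hvq]; destruct (H2 _ Hvq) as [_ E']; rewrite E'; auto.
Qed.

Lemma has_D4_chart (U V : R2 -> Prop) (Phi : R2 -> R2) (g : R2 -> R) (y : R2) :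
  diffeo U V Phi -> U y -> has_D4 (fun q => g (Phi q)) y <-> has_D4 g (Phi y).
Proof.
  intros D Uy; unfold has_D4; now rewrite !(R_equivalent_chart U V Phi _ g _ y D Uy).
Qed.

(** Reads the Jacobian at the origin off a map written in Hadamard form. *)
Lemma Du_Dv_linear_0 (U : R2 -> Prop) (m n : R2 -> R) :
  open U -> U (0, 0) -> smooth U m -> smooth U n ->
  Du (fun q => fst q * m q + snd q * n q) (0, 0) = m (0, 0)
  /\ Dv (fun q => fst q * m q + snd q * n q) (0, 0) = n (0, 0).
Proof.
  intros HU U0 Hm Hn.
  destruct (smooth_is_derive U m _ Hm U0) as [m1 m2], (smooth_is_derive U n _ Hn U0) as [n1 n2].
  cbn [fst snd] in *; split; apply is_derive_unique; cbn [fst snd].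
  - replace (m (0, 0)) with ((1 * m (0, 0) + 0 * Du m (0, 0)) + 0 * Du n (0, 0)) by ring.
    apply (is_derive_plus (V := R_NormedModule)).
    + apply (is_derive_mult (fun s => s) (fun s => m (s, 0))); auto using is_derive_idR.
      intros; apply Rmult_comm.
    + now apply (is_derive_scal (fun s => n (s, 0))).
  - replace (n (0, 0)) with (0 * Dv m (0, 0) + (1 * n (0, 0) + 0 * Dv n (0, 0))) by ring.
    apply (is_derive_plus (V := R_NormedModule)).
    + now apply (is_derive_scal (fun s => m (0, s))).
    + apply (is_derive_mult (fun s => s) (fun s => n (0, s))); auto using is_derive_idR.
      intros; apply Rmult_comm.
Qed.

(** The root is of order k+1: [k = 2] yields cube roots and [k = 1] square roots. *)
Lemma smooth_root_power (U : R2 -> Prop) (f : R2 -> R) (k : nat) :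
  open U -> (forall q, U q -> 0 < f q) -> smooth U f ->
  exists g, smooth U g /\ forall q, U q -> 0 < g q /\ g q ^ S k = f q.
Proof.
  intros HU Hpos Hf; exists (fun q => exp (/ INR (S k) * ln (f q))); split.
  - intros n; apply Ck_exp; auto; apply Ck_mult; auto using Ck_const, Ck_ln.
  - intros q Hq; split; [apply exp_pos|].
    assert (E : forall (j : nat) (x : R), exp x ^ j = exp (INR j * x)).
    { intros j x; induction j as [|j IH]; [cbn; now rewrite Rmult_0_l, exp_0|].
      change (exp x * exp x ^ j = exp (INR (S j) * x)).
      rewrite IH, <- exp_plus, S_INR; f_equal; ring. }
    rewrite E, <- Rmult_assoc, Rinv_r, Rmult_1_l by (apply not_0_INR; lia).
    now apply exp_ln, Hpos.
Qed.

(** * Recognition of D4 singularities *)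

Lemma D4_of_cubic (U : R2 -> Prop) (J A B C D : R2 -> R) :
  open U -> U (0, 0) -> smooth U A -> smooth U B -> smooth U C -> smooth U D ->
  (forall q, U q -> J q = fst q ^ 3 * A q + fst q ^ 2 * snd q * B q
                          + fst q * snd q ^ 2 * C q + snd q ^ 3 * D q) ->
  A (0, 0) = 0 -> B (0, 0) <> 0 -> C (0, 0) ^ 2 <> 4 * B (0, 0) * D (0, 0) ->
  has_D4 J (0, 0).
Proof.
  intros HU U0 HA HB HC HD HJ A0 B0 Disc.
  (* The product condition keeps the sign that [B] has at the origin, so one open condition covers
     both signs; [V1] and [V2] do the same for [al] and [de]. *)
  set (U1 := fun q => U q /\ 0 < B (0, 0) * B q).
  assert (OU1 : open U1).
  { assert (S : smooth U (fun q => B (0, 0) * B q)) by smooth_auto.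
    apply open_Ck0_gt; [exact HU|exact (S 0%nat)]. }
  assert (U10 : U1 (0, 0)) by (split; [exact U0|nra]).
  assert (S1 : forall g, smooth U g -> smooth U1 g)
    by (intros g; apply smooth_subset; now intros q []).
  assert (Bnz : forall q, U1 q -> B q <> 0) by (intros q [_ H] E; rewrite E in H; lra).
  destruct (smooth_cubic_root U1 (fun q => A q / B q) (fun q => C q / B q) (fun q => D q / B q))
    as [V [s [OV [V0 [VU [Hs [s0 Hroot]]]]]]]; auto using smooth_div.
  { rewrite A0; unfold Rdiv; ring. }
  assert (S2 : forall g, smooth U g -> smooth V g).
  { intros g Hg; apply smooth_subset with U1; auto. }
  (* With [y = v - s u], division of the cubic by its root [s] gives
     [J = y (al u^2 + be u y + ga y^2)]. *)
  set (al := fun q => B q + 2 * (C q * s q) + 3 * (D q * s q ^ 2)).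
  set (be := fun q => C q + 3 * (D q * s q)).
  set (y := fun q => snd q - s q * fst q).
  assert (Sal : smooth V al) by (unfold al; smooth_auto; auto).
  assert (Sbe : smooth V be) by (unfold be; smooth_auto; auto).
  assert (Fac : forall q, V q ->
     J q = y q * (al q * fst q ^ 2 + be q * fst q * y q + D q * y q ^ 2)).
  { intros q Hq; assert (Hr := Hroot q Hq); rewrite HJ by (apply VU; exact Hq).
    assert (HB' := Bnz q (VU q Hq)).
    assert (EA : A q = - (s q * B q + s q ^ 2 * C q + s q ^ 3 * D q)).
    { apply (f_equal (fun z => B q * z)) in Hr; rewrite Rmult_0_r in Hr.
      field_simplify in Hr; [lra|exact HB']. }
    unfold al, be, y; rewrite EA; ring. }
  assert (al0 : al (0, 0) = B (0, 0)) by (unfold al; rewrite s0; ring).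
  assert (be0 : be (0, 0) = C (0, 0)) by (unfold be; rewrite s0; ring).
  set (V1 := fun q => V q /\ 0 < al (0, 0) * al q).
  assert (OV1 : open V1).
  { assert (S : smooth V (fun q => al (0, 0) * al q)) by smooth_auto.
    apply open_Ck0_gt; [exact OV|exact (S 0%nat)]. }
  assert (V10 : V1 (0, 0)) by (split; [exact V0|rewrite al0; nra]).
  assert (alnz : forall q, V1 q -> al q <> 0) by (intros q [_ H] E; rewrite E in H; lra).
  assert (S3 : forall g, smooth V g -> smooth V1 g)
    by (intros g; apply smooth_subset; now intros q []).
  set (k := fun q => be q / (2 * al q)).
  assert (Sk : smooth V1 k).
  { apply smooth_div; auto; smooth_auto; auto. }
  set (de := fun q => D q - al q * k q ^ 2).
  assert (Sde : smooth V1 de) by (unfold de; smooth_auto; auto).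
  assert (Sq : forall q, V1 q -> J q = y q * (al q * (fst q + k q * y q) ^ 2 + de q * y q ^ 2)).
  { intros q Hq; rewrite Fac by apply Hq; unfold de, k; field; auto. }
  assert (de0 : de (0, 0) <> 0).
  { unfold de, k; rewrite al0, be0; intros E; apply Disc.
    apply (f_equal (fun z => 4 * B (0, 0) * z)) in E; field_simplify in E; lra. }
  set (V2 := fun q => V1 q /\ 0 < de (0, 0) * de q).
  assert (OV2 : open V2).
  { assert (S : smooth V1 (fun q => de (0, 0) * de q)) by smooth_auto.
    apply open_Ck0_gt; [exact OV1|exact (S 0%nat)]. }
  assert (V20 : V2 (0, 0)) by (split; [exact V10|nra]).
  assert (S4 : forall g, smooth V1 g -> smooth V2 g)
    by (intros g; apply smooth_subset; now intros q []).
  (* [sg] is the sign of [de]; since its cube is itself, it moves inside the cube and only a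
     positive function needs a cube root. *)
  assert (Hsig : exists sg, sg * sg = 1 /\ forall q, V2 q -> 0 < sg * de q).
  { destruct (Rlt_dec 0 (de (0, 0))) as [L|L]; [exists 1|exists (-1)]; split; try ring;
      intros q [_ Hq]; nra. }
  destruct Hsig as [sg [sg2 Hsg]].
  destruct (smooth_root_power V2 (fun q => sg * de q) 2) as [b [Sb Hb]]; auto.
  { smooth_auto; auto. }
  assert (bpos : forall q, V2 q -> 0 < b q) by (intros q Hq; apply Hb, Hq).
  (* With Y = sg b y one has Y^3 = de y^3, and [w] is what remains of [al] once y is replaced by Y.
     Its sign [tau] decides between the two D4 normal forms. *)
  set (w := fun q => sg * al q / b q).
  assert (Sw : smooth V2 w).
  { apply smooth_div; auto; [intros q Hq; specialize (bpos q Hq); lra|smooth_auto; auto]. }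
  assert (Htau : exists tau, (tau = 1 \/ tau = -1) /\ forall q, V2 q -> 0 < tau * w q).
  { assert (Hin : forall q, V2 q -> 0 < / b q) by (intros q Hq; now apply Rinv_0_lt_compat, bpos).
    destruct (Rlt_dec 0 (sg * al (0, 0))) as [L|L]; [exists 1|exists (-1)]; split; auto;
      intros q Hq; specialize (Hin q Hq); destruct Hq as [[_ Hq] _]; unfold w, Rdiv.
    - rewrite Rmult_1_l; apply Rmult_lt_0_compat; [nra|exact Hin].
    - replace (-1 * (sg * al q * / b q)) with ((- (sg * al q)) * / b q) by ring.
      apply Rmult_lt_0_compat; [nra|exact Hin]. }
  destruct Htau as [tau [Htau Hw]].
  assert (tau2 : tau * tau = 1) by (destruct Htau; subst; ring).
  destruct (smooth_root_power V2 (fun q => tau * w q) 1) as [c [Sc Hc]]; auto.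
  { smooth_auto; auto. }
  (* Coefficients of u and v in X = c (u + k y) and Y = sg b y after substituting y = v - s u. *)
  set (m1 := fun q => c q * (1 - k q * s q)); set (m2 := fun q => c q * k q).
  set (n1 := fun q => - (sg * b q * s q)); set (n2 := fun q => sg * b q).
  assert (Sm1 : smooth V2 m1) by (unfold m1; smooth_auto; auto).
  assert (Sm2 : smooth V2 m2) by (unfold m2; smooth_auto; auto).
  assert (Sn1 : smooth V2 n1) by (unfold n1; smooth_auto; auto).
  assert (Sn2 : smooth V2 n2) by (unfold n2; smooth_auto; auto).
  set (G := fun q : R2 => (fst q * m1 q + snd q * m2 q, fst q * n1 q + snd q * n2 q)).
  assert (SG : smooth2 V2 G) by (split; unfold G; cbn [fst snd]; smooth_auto).
  assert (EG : forall q, V2 q -> J q = snd (G q) ^ 3 + tau * (snd (G q) * fst (G q) ^ 2)).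
  { intros q Hq; rewrite Sq by apply Hq.
    assert (EX : fst (G q) = c q * (fst q + k q * y q)) by (unfold G, m1, m2, y; cbn; ring).
    assert (EY : snd (G q) = sg * b q * y q) by (unfold G, n1, n2, y; cbn; ring).
    destruct (Hb q Hq) as [Hb1 Hb2], (Hc q Hq) as [Hc1 Hc2].
    rewrite EX, EY.
    replace ((sg * b q * y q) ^ 3) with ((sg * sg) * sg * b q ^ 3 * y q ^ 3) by ring.
    replace ((c q * (fst q + k q * y q)) ^ 2) with (c q ^ 2 * (fst q + k q * y q) ^ 2) by ring.
    rewrite Hb2, Hc2, sg2; unfold w.
    replace (1 * sg * (sg * de q)) with (sg * sg * de q) by ring; rewrite sg2.
    replace (tau * (sg * b q * y q * (tau * (sg * al q / b q) * (fst q + k q * y q) ^ 2)))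
      with ((tau * tau) * (sg * sg) * al q * y q * (fst q + k q * y q) ^ 2) by (field; lra).
    rewrite tau2, sg2; ring. }
  destruct (Du_Dv_linear_0 V2 m1 m2 OV2 V20 Sm1 Sm2) as [X1 X2].
  destruct (Du_Dv_linear_0 V2 n1 n2 OV2 V20 Sn1 Sn2) as [Y1 Y2].
  assert (P1 := bpos _ V20); assert (P2 : 0 < c (0, 0)) by apply (Hc _ V20).
  destruct (inverse_function V2 G) as [A' [B' [DG [A'0 A'V]]]]; auto.
  - unfold G; cbn [fst snd]; f_equal; ring.
  - change (Du (fun q => fst q * m1 q + snd q * m2 q) (0, 0) <> 0); rewrite X1.
    unfold m1; rewrite s0; nra.
  - unfold jacobian.
    change (Du (fun q => fst q * m1 q + snd q * m2 q) (0, 0)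
            * Dv (fun q => fst q * n1 q + snd q * n2 q) (0, 0)
            - Dv (fun q => fst q * m1 q + snd q * m2 q) (0, 0)
              * Du (fun q => fst q * n1 q + snd q * n2 q) (0, 0) <> 0).
    rewrite X1, X2, Y1, Y2; unfold m1, m2, n1, n2; rewrite s0.
    replace (c (0, 0) * (1 - k (0, 0) * 0) * (sg * b (0, 0))
             - c (0, 0) * k (0, 0) * - (sg * b (0, 0) * 0))
      with (sg * (c (0, 0) * b (0, 0))) by ring.
    intros E; assert (0 < c (0, 0) * b (0, 0)) by nra.
    apply Rmult_integral in E; destruct E as [E|E]; [rewrite E in sg2|]; lra.
  (* The normal forms have the linear factor in the first coordinate whereas [G] carries it in the
     second, hence the swap. *)
  - destruct (diffeo_comp _ _ _ _ _ _ DG diffeo_swap) as [W [DS _]].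
    assert (E : forall h : R2 -> R, (forall q, A' q -> h (snd (G q), fst (G q)) = J q) ->
       R_equivalent h (0, 0) J (0, 0)).
    { intros h Hh; apply R_equivalent_sym.
      exists (fun q => A' q /\ True), W, (fun q => (snd (G q), fst (G q))).
      split; [exact DS|split; [now split|split; [|now intros q [Hq _]; apply Hh]]].
      unfold G; cbn [fst snd]; f_equal; ring. }
    destruct Htau; subst tau; [left|right]; apply E; intros q Hq;
      rewrite (EG q (A'V q Hq)); cbn [fst snd]; ring.
Qed.

(** Differentiating [h (g q) = q] in both directions shows that the product of the two Jacobian
    determinants is 1. *)
Lemma diffeo_jacobian (U V : R2 -> Prop) (g : R2 -> R2) (q : R2) :
  diffeo U V g -> U q -> jacobian g q <> 0.
Proof.
  intros [HU [HV [[G1 G2] [h [[H1 H2] [Hgh _]]]]]] Hq.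
  set (g1 := fun q => fst (g q)) in *; set (g2 := fun q => snd (g q)) in *.
  destruct q as [a b].
  destruct (smooth_is_derive U g1 _ G1 Hq) as [u1 v1], (smooth_is_derive U g2 _ G2 Hq) as [u2 v2].
  cbn [fst snd] in *.
  assert (Hv : V (g1 (a, b), g2 (a, b))).
  { unfold g1, g2; rewrite <- surjective_pairing; apply (Hgh _ Hq). }
  set (h1 := fun q => fst (h q)) in *; set (h2 := fun q => snd (h q)) in *.
  assert (K : forall s, U s -> h1 (g1 s, g2 s) = fst s /\ h2 (g1 s, g2 s) = snd s).
  { intros s Hs; unfold h1, h2, g1, g2; rewrite <- surjective_pairing.
    destruct (Hgh s Hs) as [_ E]; now rewrite E. }
  assert (Lu := open_slice_u U (a, b) HU Hq); assert (Lv := open_slice_v U (a, b) HU Hq).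
  cbn [fst snd] in Lu, Lv.
  assert (E1 := is_derive_comp_pair V h1 _ _ _ _ _ HV Hv (H1 1%nat) u1 u2).
  assert (E2 := is_derive_comp_pair V h2 _ _ _ _ _ HV Hv (H2 1%nat) u1 u2).
  assert (E3 := is_derive_comp_pair V h1 _ _ _ _ _ HV Hv (H1 1%nat) v1 v2).
  assert (E4 := is_derive_comp_pair V h2 _ _ _ _ _ HV Hv (H2 1%nat) v1 v2).
  apply is_derive_unique in E1, E2, E3, E4; cbv beta in E1, E2, E3, E4.
  rewrite (Derive_ext_loc _ (fun s => s)), Derive_id in E1.
  2: { eapply filter_imp; [|exact Lu]; intros s Hs; apply (K _ Hs). }
  rewrite (Derive_ext_loc _ (fun s => b)), Derive_const in E2.
  2: { eapply filter_imp; [|exact Lu]; intros s Hs; apply (K _ Hs). }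
  rewrite (Derive_ext_loc _ (fun s => a)), Derive_const in E3.
  2: { eapply filter_imp; [|exact Lv]; intros s Hs; apply (K _ Hs). }
  rewrite (Derive_ext_loc _ (fun s => s)), Derive_id in E4.
  2: { eapply filter_imp; [|exact Lv]; intros s Hs; apply (K _ Hs). }
  unfold jacobian; fold g1 g2; intros J0.
  set (p1 := Du h1 (g1 (a, b), g2 (a, b))) in *; set (p2 := Dv h1 (g1 (a, b), g2 (a, b))) in *.
  set (p3 := Du h2 (g1 (a, b), g2 (a, b))) in *; set (p4 := Dv h2 (g1 (a, b), g2 (a, b))) in *.
  assert (F1 : p1 * Du g1 (a, b) + p2 * Du g2 (a, b) = 1) by exact (eq_sym E1).
  assert (F2 : p3 * Du g1 (a, b) + p4 * Du g2 (a, b) = 0) by exact (eq_sym E2).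
  assert (F3 : p1 * Dv g1 (a, b) + p2 * Dv g2 (a, b) = 0) by exact (eq_sym E3).
  assert (F4 : p3 * Dv g1 (a, b) + p4 * Dv g2 (a, b) = 1) by exact (eq_sym E4).
  assert (X : (p1 * p4 - p2 * p3) * (Du g1 (a, b) * Dv g2 (a, b) - Dv g1 (a, b) * Du g2 (a, b)) = 1).
  { transitivity ((p1 * Du g1 (a, b) + p2 * Du g2 (a, b)) * (p3 * Dv g1 (a, b) + p4 * Dv g2 (a, b))
      - (p3 * Du g1 (a, b) + p4 * Du g2 (a, b)) * (p1 * Dv g1 (a, b) + p2 * Dv g2 (a, b)));
      [ring|rewrite F1, F2, F3, F4; ring]. }
  rewrite J0 in X; lra.
Qed.

Lemma continuous_eq_off_point (f : R -> R) (x c : R) :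
  continuous f x -> locally x (fun t => t <> x -> f t = c) -> f x = c.
Proof.
  intros Cf [d Hd]; apply NNPP; intros Hn.
  assert (Hf : locally x (fun t => f t <> c)) by (apply (Cf (fun z => z <> c)); now apply (open_neq c)).
  destruct Hf as [e He].
  assert (Hm : 0 < Rmin d e) by (apply Rmin_case; apply cond_pos).
  assert (B : forall e' : posreal, Rmin d e <= e' -> ball x e' (x + Rmin d e / 2)).
  { intros e' He'; change (Rabs (x + Rmin d e / 2 - x) < e').
    replace (x + Rmin d e / 2 - x) with (Rmin d e / 2) by ring.
    rewrite Rabs_pos_eq; lra. }
  apply (He (x + Rmin d e / 2)); [apply B, Rmin_r|].
  apply Hd; [apply B, Rmin_l|lra].
Qed.

(** Compares leading terms along the line t (a, b). Each component of the diffeomorphism is t times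
    a smooth function there, so t^3 cancels from both sides; letting t tend to 0 leaves the cubic
    forms related by the linear part. No third derivative of a composite is computed. *)
Lemma cubic_of_R_equivalent (U : R2 -> Prop) (J A B C D : R2 -> R) (sg : R) :
  open U -> U (0, 0) -> smooth U A -> smooth U B -> smooth U C -> smooth U D ->
  (forall q, U q -> J q = fst q ^ 3 * A q + fst q ^ 2 * snd q * B q
                          + fst q * snd q ^ 2 * C q + snd q ^ 3 * D q) ->
  R_equivalent (fun q => fst q ^ 3 + sg * (fst q * snd q ^ 2)) (0, 0) J (0, 0) ->
  exists x1 x2 y1 y2 : R, x1 * y2 - x2 * y1 <> 0 /\ forall a b : R,
    a ^ 3 + sg * (a * b ^ 2)
    = (x1 * a + x2 * b) ^ 3 * A (0, 0) + (x1 * a + x2 * b) ^ 2 * (y1 * a + y2 * b) * B (0, 0)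
      + (x1 * a + x2 * b) * (y1 * a + y2 * b) ^ 2 * C (0, 0) + (y1 * a + y2 * b) ^ 3 * D (0, 0).
Proof.
  intros HU U0 HA HB HC HD HJ [V [W [th [Dth [V0 [th0 Hth]]]]]].
  assert (HV := proj1 Dth); assert (Sth : smooth2 V th) by apply Dth.
  assert (OX := open_preimage V U th HV HU Sth).
  destruct (box_in_open _ OX) as [r [Hr Hbox]]; [now rewrite th0|].
  set (S := box r) in *; assert (HS := open_box r); fold S in HS.
  assert (Star := star_shaped_box r); fold S in Star.
  assert (SV : forall q, S q -> V q) by (intros q Hq; apply Hbox, Hq).
  assert (SU : forall q, S q -> U (th q)) by (intros q Hq; apply Hbox, Hq).
  assert (S0 : S (0, 0)) by (split; cbn; rewrite Rabs_R0; exact Hr).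
  destruct Sth as [T1 T2].
  set (t1 := fun q => fst (th q)) in *; set (t2 := fun q => snd (th q)) in *.
  assert (ST1 : smooth S t1) by now apply smooth_subset with V.
  assert (ST2 : smooth S t2) by now apply smooth_subset with V.
  exists (Du t1 (0, 0)), (Dv t1 (0, 0)), (Du t2 (0, 0)), (Dv t2 (0, 0)).
  split; [exact (diffeo_jacobian V W th (0, 0) Dth V0)|intros a b].
  set (M := fun (g : R2 -> R) q => a * radial_mean 0 (Du g) q + b * radial_mean 0 (Dv g) q).
  assert (SM : forall g, smooth S g -> smooth S (M g)).
  { intros g Hg; unfold M; smooth_auto; apply smooth_radial_mean; auto;
      [now apply smooth_Du|now apply smooth_Dv]. }
  assert (EM : forall g t, smooth S g -> g (0, 0) = 0 -> S (t * a, t * b) ->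
     g (t * a, t * b) = t * M g (t * a, t * b)).
  { intros g t Hg g0 Ht; rewrite (hadamard S g _ HS Star (Hg 1%nat) Ht), g0; unfold M.
    cbn [fst snd]; ring. }
  assert (M0 : forall g, M g (0, 0) = Du g (0, 0) * a + Dv g (0, 0) * b).
  { intros g; unfold M; rewrite !radial_mean_0; cbn [INR]; field. }
  assert (Sth : smooth2 S th) by now split.
  set (K := fun q => M t1 q ^ 3 * A (th q) + M t1 q ^ 2 * M t2 q * B (th q)
                     + M t1 q * M t2 q ^ 2 * C (th q) + M t2 q ^ 3 * D (th q)).
  assert (SK : smooth S K).
  { assert (Hc : forall g, smooth U g -> smooth S (fun q => g (th q)))
      by (intros g Hg; now apply (smooth_comp_map S U)).
    unfold K; smooth_auto; auto. }
  (* Along the line [K] is constant for t different from 0, hence has the same value at 0. *)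
  assert (E : K (0 * a, 0 * b) = a ^ 3 + sg * (a * b ^ 2)).
  { assert (Cp : continuous (fun t : R => (t * a, t * b)) 0).
    { apply continuous_pair; apply (@ex_derive_continuous R_AbsRing R_NormedModule);
        auto_derive; trivial. }
    assert (O0 : S (0 * a, 0 * b)) by (rewrite !Rmult_0_l; exact S0).
    apply (continuous_eq_off_point (fun t => K (t * a, t * b)) 0).
    - apply (continuous_comp (fun t : R => (t * a, t * b)) K); [exact Cp|].
      now apply (smooth_continuous S).
    - assert (L : locally 0 (fun t => S (t * a, t * b))) by (apply Cp, HS, O0).
      eapply filter_imp; [|exact L]; intros t Ht t0.
      assert (H := Hth _ (SV _ Ht)); cbn [fst snd] in H.
      rewrite HJ in H by now apply SU.
      change (fst (th (t * a, t * b))) with (t1 (t * a, t * b)) in H.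
      change (snd (th (t * a, t * b))) with (t2 (t * a, t * b)) in H.
      rewrite (EM t1), (EM t2) in H; auto; try (unfold t1, t2; now rewrite th0).
      apply (Rmult_eq_reg_l (t ^ 3)); [|now apply pow_nonzero].
      unfold K; lra. }
  rewrite !Rmult_0_l in E; rewrite <- E; unfold K; rewrite th0, !M0; ring.
Qed.

(** With p = J_uuv, q = J_uvv, l = J_vvv the cubic part is v (p u^2 / 2 + q u v / 2 + l v^2 / 6). As
    p is non-zero, v does not divide the quadratic factor, so a repeated factor can only come from
    its discriminant q^2 / 4 - p l / 3. *)
Lemma D4_criterion (U : R2 -> Prop) (J : R2 -> R) :
  open U -> U (0, 0) -> smooth U J ->
  J (0, 0) = 0 -> Du J (0, 0) = 0 -> Dv J (0, 0) = 0 ->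
  Du (Du J) (0, 0) = 0 -> Dv (Du J) (0, 0) = 0 -> Dv (Dv J) (0, 0) = 0 ->
  Du (Du (Du J)) (0, 0) = 0 -> Dv (Du (Du J)) (0, 0) <> 0 ->
  has_D4 J (0, 0) <->
  3 * Dv (Dv (Du J)) (0, 0) ^ 2 <> 4 * Dv (Du (Du J)) (0, 0) * Dv (Dv (Dv J)) (0, 0).
Proof.
  intros HU U0 HJ j0 ju jv juu juv jvv juuu juuv.
  destruct (box_in_open U HU U0) as [r [Hr Hbox]].
  assert (O := open_box r); assert (St := star_shaped_box r).
  assert (B0 : box r (0, 0)) by (split; cbn; rewrite Rabs_R0; exact Hr).
  destruct (cubic_expansion (box r) J) as [A [B [C [D [SA [SB [SC [SD [E [a0 [b0 [c0 d0]]]]]]]]]]]];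
    auto; [now apply smooth_subset with U|].
  set (p := Dv (Du (Du J)) (0, 0)) in *; set (q := Dv (Dv (Du J)) (0, 0)) in *.
  set (l := Dv (Dv (Dv J)) (0, 0)) in *.
  rewrite juuu in a0; replace (0 / 6) with 0 in a0 by field.
  split.
  - intros HD Disc.
    assert (H : exists sg, (sg <> 0) /\
      R_equivalent (fun q => fst q ^ 3 + sg * (fst q * snd q ^ 2)) (0, 0) J (0, 0)).
    { destruct HD as [[V [W [th [D1 [D2 [D3 D4]]]]]]|[V [W [th [D1 [D2 [D3 D4]]]]]]];
        [exists 1|exists (-1)]; (split; [lra|]); exists V, W, th; repeat split; auto;
        try apply D1; intros x Hx; rewrite D4 by exact Hx; ring. }
    destruct H as [sg [Hsg H]].
    destruct (cubic_of_R_equivalent (box r) J A B C D sg) as [x1 [x2 [y1 [y2 [Det Hc]]]]]; auto.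
    (* The cubic form is [p/2 y (x + k y)^2], and its double factor survives a linear change. *)
    set (k := q / (2 * p)).
    set (z1 := x1 + k * y1); set (z2 := x2 + k * y2).
    assert (Hz : forall a b, a ^ 3 + sg * (a * b ^ 2)
       = p / 2 * (y1 * a + y2 * b) * (z1 * a + z2 * b) ^ 2).
    { intros a b; rewrite Hc, a0, b0, c0, d0; unfold z1, z2, k.
      replace l with (3 * q ^ 2 / (4 * p)) by (rewrite Disc; field; exact juuv).
      field; exact juuv. }
    assert (Det' : z1 * y2 - z2 * y1 <> 0) by (unfold z1, z2; intros E'; apply Det; lra).
    (* These four values isolate the coefficients of a^3, b^3 and a^2 b. The first makes [y1] and
       [z1] non-zero, the other two then force [y2 = z2 = 0], against the independence of the two
       factors. *)
    assert (H1 := Hz 1 0); assert (H2 := Hz 0 1); assert (H3 := Hz 1 1); assert (H4 := Hz 1 (-1)).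
    assert (F1 : p / 2 * (y1 * z1 ^ 2) = 1) by lra.
    assert (F2 : p / 2 * (y2 * z2 ^ 2) = 0) by lra.
    assert (F3 : p / 2 * (y2 * z1 ^ 2 + 2 * y1 * z1 * z2) = 0) by lra.
    assert (p2 : p / 2 <> 0) by lra.
    apply Rmult_integral in F2, F3; destruct F2 as [F2|F2]; [lra|].
    destruct F3 as [F3|F3]; [lra|].
    assert (N1 : y1 <> 0) by (intros N; rewrite N in F1; lra).
    assert (N2 : z1 <> 0) by (intros N; rewrite N in F1; lra).
    apply Rmult_integral in F2; destruct F2 as [F2|F2].
    + assert (Z : y1 * z1 * z2 = 0) by (rewrite F2 in F3; lra).
      assert (Zz : z2 = 0).
      { apply Rmult_integral in Z; destruct Z as [Z|Z]; auto.
        apply Rmult_integral in Z; tauto. }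
      apply Det'; rewrite F2, Zz; ring.
    + assert (Zz : z2 = 0) by (apply NNPP; intros N; now apply (pow_nonzero z2 2) in N).
      assert (Z : y2 * z1 ^ 2 = 0) by (rewrite Zz in F3; lra).
      apply Rmult_integral in Z; destruct Z as [Z|Z];
        [apply Det'; rewrite Z, Zz; ring | now apply (pow_nonzero z1 2) in N2].
  - intros Disc; apply (D4_of_cubic (box r) J A B C D); auto; rewrite ?b0, ?c0, ?d0; lra.
Qed.

(** * Vector-valued functions *)

Lemma Du_plus (U : R2 -> Prop) (f g : R2 -> R) (q : R2) :
  smooth U f -> smooth U g -> U q -> Du (fun x => f x + g x) q = Du f q + Du g q.
Proof.
  intros Hf Hg Hq; destruct q as [x y].
  exact (Derive_plus (fun s => f (s, y)) (fun s => g (s, y)) x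
    (proj1 (proj1 (Hf 1%nat) _ Hq)) (proj1 (proj1 (Hg 1%nat) _ Hq))).
Qed.

Lemma Dv_plus (U : R2 -> Prop) (f g : R2 -> R) (q : R2) :
  smooth U f -> smooth U g -> U q -> Dv (fun x => f x + g x) q = Dv f q + Dv g q.
Proof.
  intros Hf Hg Hq; destruct q as [x y].
  exact (Derive_plus (fun s => f (x, s)) (fun s => g (x, s)) y
    (proj2 (proj1 (Hf 1%nat) _ Hq)) (proj2 (proj1 (Hg 1%nat) _ Hq))).
Qed.

Lemma Du_minus (U : R2 -> Prop) (f g : R2 -> R) (q : R2) :
  smooth U f -> smooth U g -> U q -> Du (fun x => f x - g x) q = Du f q - Du g q.
Proof.
  intros Hf Hg Hq; destruct q as [x y].
  exact (Derive_minus (fun s => f (s, y)) (fun s => g (s, y)) x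
    (proj1 (proj1 (Hf 1%nat) _ Hq)) (proj1 (proj1 (Hg 1%nat) _ Hq))).
Qed.

Lemma Dv_minus (U : R2 -> Prop) (f g : R2 -> R) (q : R2) :
  smooth U f -> smooth U g -> U q -> Dv (fun x => f x - g x) q = Dv f q - Dv g q.
Proof.
  intros Hf Hg Hq; destruct q as [x y].
  exact (Derive_minus (fun s => f (x, s)) (fun s => g (x, s)) y
    (proj2 (proj1 (Hf 1%nat) _ Hq)) (proj2 (proj1 (Hg 1%nat) _ Hq))).
Qed.

Lemma Du_mult (U : R2 -> Prop) (f g : R2 -> R) (q : R2) :
  smooth U f -> smooth U g -> U q ->
  Du (fun x => f x * g x) q = Du f q * g q + f q * Du g q.
Proof.
  intros Hf Hg Hq; destruct q as [x y].
  exact (Derive_mult (fun s => f (s, y)) (fun s => g (s, y)) x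
    (proj1 (proj1 (Hf 1%nat) _ Hq)) (proj1 (proj1 (Hg 1%nat) _ Hq))).
Qed.

Lemma Dv_mult (U : R2 -> Prop) (f g : R2 -> R) (q : R2) :
  smooth U f -> smooth U g -> U q ->
  Dv (fun x => f x * g x) q = Dv f q * g q + f q * Dv g q.
Proof.
  intros Hf Hg Hq; destruct q as [x y].
  exact (Derive_mult (fun s => f (x, s)) (fun s => g (x, s)) y
    (proj2 (proj1 (Hf 1%nat) _ Hq)) (proj2 (proj1 (Hg 1%nat) _ Hq))).
Qed.

Lemma Du_scal (c : R) (g : R2 -> R) (q : R2) : Du (fun x => c * g x) q = c * Du g q.
Proof. exact (Derive_scal (fun s => g (s, snd q)) c (fst q)). Qed.

Lemma Dv_scal (c : R) (g : R2 -> R) (q : R2) : Dv (fun x => c * g x) q = c * Dv g q.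
Proof. exact (Derive_scal (fun s => g (fst q, s)) c (snd q)). Qed.

Lemma Du_const (c : R) (q : R2) : Du (fun _ => c) q = 0.
Proof. exact (Derive_const c (fst q)). Qed.

Lemma Dv_const (c : R) (q : R2) : Dv (fun _ => c) q = 0.
Proof. exact (Derive_const c (snd q)). Qed.

Lemma Du_snd (q : R2) : Du (fun x => snd x) q = 0.
Proof. exact (Derive_const (snd q) (fst q)). Qed.

Lemma Dv_snd (q : R2) : Dv (fun x => snd x) q = 1.
Proof. exact (Derive_id (snd q)). Qed.

Lemma Du_comp (U V : R2 -> Prop) (g : R2 -> R) (T : R2 -> R2) (q : R2) :
  open V -> smooth V g -> smooth2 U T -> U q -> V (T q) ->
  Du (fun x => g (T x)) q
  = Du g (T q) * Du (fun x => fst (T x)) q + Dv g (T q) * Du (fun x => snd (T x)) q.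
Proof.
  intros HV Hg [H1 H2] Hq HT; destruct q as [x y].
  destruct (smooth_is_derive U _ _ H1 Hq) as [a1 _], (smooth_is_derive U _ _ H2 Hq) as [a2 _].
  cbn [fst snd] in a1, a2.
  rewrite (surjective_pairing (T (x, y))) in HT |- *.
  assert (D := is_derive_comp_pair V g _ _ _ _ _ HV HT (Hg 1%nat) a1 a2).
  apply is_derive_unique in D.
  etransitivity; [|exact D].
  unfold Du at 1; cbn [fst snd]; apply Derive_ext; intros s; now rewrite <- surjective_pairing.
Qed.

Lemma Dv_comp (U V : R2 -> Prop) (g : R2 -> R) (T : R2 -> R2) (q : R2) :
  open V -> smooth V g -> smooth2 U T -> U q -> V (T q) ->
  Dv (fun x => g (T x)) q
  = Du g (T q) * Dv (fun x => fst (T x)) q + Dv g (T q) * Dv (fun x => snd (T x)) q.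
Proof.
  intros HV Hg [H1 H2] Hq HT; destruct q as [x y].
  destruct (smooth_is_derive U _ _ H1 Hq) as [_ a1], (smooth_is_derive U _ _ H2 Hq) as [_ a2].
  cbn [fst snd] in a1, a2.
  rewrite (surjective_pairing (T (x, y))) in HT |- *.
  assert (D := is_derive_comp_pair V g _ _ _ _ _ HV HT (Hg 1%nat) a1 a2).
  apply is_derive_unique in D.
  etransitivity; [|exact D].
  unfold Dv at 1; cbn [fst snd]; apply Derive_ext; intros s; now rewrite <- surjective_pairing.
Qed.

(** * Inner products and frames in three-space *)

Lemma dot_plus_l (x y z : R3) : dot (plus x y) z = dot x z + dot y z.
Proof. destruct x as [[]], y as [[]], z as [[]]; unfold dot, plus; cbn; ring. Qed.

Lemma dot_scal_l (c : R) (x z : R3) : dot (scal c x) z = c * dot x z.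
Proof. destruct x as [[]], z as [[]]; unfold dot, scal; cbn; unfold mult; cbn; ring. Qed.

Lemma dot_comm (x y : R3) : dot x y = dot y x.
Proof. unfold dot; ring. Qed.

Lemma dot_zero_l (x : R3) : dot zero x = 0.
Proof. destruct x as [[]]; unfold dot, zero; cbn; ring. Qed.

(** Cramer's rule: the cofactors combine the three equations into the determinant times each
    coordinate of [w]. *)
Lemma orthogonal_to_frame (w x y z : R3) :
  det3 x y z <> 0 -> dot w x = 0 -> dot w y = 0 -> dot w z = 0 -> w = zero.
Proof.
  destruct w as [[w1 w2] w3], x as [[x1 x2] x3], y as [[y1 y2] y3], z as [[z1 z2] z3].
  unfold det3, dot; cbn; intros HD H1 H2 H3.
  set (D := x1 * (y2 * z3 - y3 * z2) - x2 * (y1 * z3 - y3 * z1) + x3 * (y1 * z2 - y2 * z1)) in *.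
  assert (E1 : D * w1 = 0).
  { transitivity ((y2 * z3 - y3 * z2) * (w1 * x1 + w2 * x2 + w3 * x3)
      + (z2 * x3 - z3 * x2) * (w1 * y1 + w2 * y2 + w3 * y3)
      + (x2 * y3 - x3 * y2) * (w1 * z1 + w2 * z2 + w3 * z3)); [unfold D; ring|].
    rewrite H1, H2, H3; ring. }
  assert (E2 : D * w2 = 0).
  { transitivity ((y3 * z1 - y1 * z3) * (w1 * x1 + w2 * x2 + w3 * x3)
      + (z3 * x1 - z1 * x3) * (w1 * y1 + w2 * y2 + w3 * y3)
      + (x3 * y1 - x1 * y3) * (w1 * z1 + w2 * z2 + w3 * z3)); [unfold D; ring|].
    rewrite H1, H2, H3; ring. }
  assert (E3 : D * w3 = 0).
  { transitivity ((y1 * z2 - y2 * z1) * (w1 * x1 + w2 * x2 + w3 * x3)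
      + (z1 * x2 - z2 * x1) * (w1 * y1 + w2 * y2 + w3 * y3)
      + (x1 * y2 - x2 * y1) * (w1 * z1 + w2 * z2 + w3 * z3)); [unfold D; ring|].
    rewrite H1, H2, H3; ring. }
  apply Rmult_integral in E1, E2, E3.
  destruct E1, E2, E3; try contradiction; subst; reflexivity.
Qed.

Lemma smooth_dot (U : R2 -> Prop) (f g : R2 -> R3) :
  open U -> smooth3 U f -> smooth3 U g -> smooth U (fun q => dot (f q) (g q)).
Proof. intros HU [f1 [f2 f3]] [g1 [g2 g3]]; unfold dot; smooth_auto; assumption. Qed.

Lemma smooth3_Du3 (U : R2 -> Prop) (f : R2 -> R3) : smooth3 U f -> smooth3 U (Du3 f).
Proof. intros [f1 [f2 f3]]; split; [|split]; now apply smooth_Du in f1, f2, f3. Qed.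

Lemma smooth3_Dv3 (U : R2 -> Prop) (f : R2 -> R3) : smooth3 U f -> smooth3 U (Dv3 f).
Proof. intros [f1 [f2 f3]]; split; [|split]; now apply smooth_Dv in f1, f2, f3. Qed.

Lemma smooth3_subset (U V : R2 -> Prop) (f : R2 -> R3) :
  (forall q, V q -> U q) -> smooth3 U f -> smooth3 V f.
Proof. intros H [f1 [f2 f3]]; split; [|split]; now apply smooth_subset with U. Qed.

Lemma Du_dot (U : R2 -> Prop) (f g : R2 -> R3) (q : R2) :
  open U -> smooth3 U f -> smooth3 U g -> U q ->
  Du (fun x => dot (f x) (g x)) q = dot (Du3 f q) (g q) + dot (f q) (Du3 g q).
Proof.
  intros HU [f1 [f2 f3]] [g1 [g2 g3]] Hq; unfold dot.
  rewrite (Du_plus U (fun x => fst (fst (f x)) * fst (fst (g x)) + snd (fst (f x)) * snd (fst (g x)))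
             (fun x => snd (f x) * snd (g x))) by (smooth_auto; assumption).
  rewrite (Du_plus U (fun x => fst (fst (f x)) * fst (fst (g x)))
             (fun x => snd (fst (f x)) * snd (fst (g x)))) by (smooth_auto; assumption).
  rewrite (Du_mult U (fun x => fst (fst (f x))) (fun x => fst (fst (g x)))),
    (Du_mult U (fun x => snd (fst (f x))) (fun x => snd (fst (g x)))),
    (Du_mult U (fun x => snd (f x)) (fun x => snd (g x))) by assumption.
  unfold Du3; cbn [fst snd]; ring.
Qed.

Lemma Dv_dot (U : R2 -> Prop) (f g : R2 -> R3) (q : R2) :
  open U -> smooth3 U f -> smooth3 U g -> U q ->
  Dv (fun x => dot (f x) (g x)) q = dot (Dv3 f q) (g q) + dot (f q) (Dv3 g q).
Proof.
  intros HU [f1 [f2 f3]] [g1 [g2 g3]] Hq; unfold dot.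
  rewrite (Dv_plus U (fun x => fst (fst (f x)) * fst (fst (g x)) + snd (fst (f x)) * snd (fst (g x)))
             (fun x => snd (f x) * snd (g x))) by (smooth_auto; assumption).
  rewrite (Dv_plus U (fun x => fst (fst (f x)) * fst (fst (g x)))
             (fun x => snd (fst (f x)) * snd (fst (g x)))) by (smooth_auto; assumption).
  rewrite (Dv_mult U (fun x => fst (fst (f x))) (fun x => fst (fst (g x)))),
    (Dv_mult U (fun x => snd (fst (f x))) (fun x => snd (fst (g x)))),
    (Dv_mult U (fun x => snd (f x)) (fun x => snd (g x))) by assumption.
  unfold Dv3; cbn [fst snd]; ring.
Qed.

Lemma Du3_Dv3_comm (U : R2 -> Prop) (f : R2 -> R3) (q : R2) :
  open U -> smooth3 U f -> U q -> Du3 (Dv3 f) q = Dv3 (Du3 f) q.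
Proof.
  intros HU [f1 [f2 f3]] Hq; unfold Du3, Dv3; cbn [fst snd].
  apply f_equal2; [apply f_equal2|]; apply (Du_Dv_comm U); auto.
Qed.

Lemma dmap3E (g : R2 -> R3) (q : R2) (a b : R) :
  dmap3 g q (a, b)
  = (a * Du (fun x => fst (fst (g x))) q + b * Dv (fun x => fst (fst (g x))) q,
     a * Du (fun x => snd (fst (g x))) q + b * Dv (fun x => snd (fst (g x))) q,
     a * Du (fun x => snd (g x)) q + b * Dv (fun x => snd (g x)) q).
Proof. reflexivity. Qed.

Lemma Du3_comp (U V : R2 -> Prop) (g : R2 -> R3) (T : R2 -> R2) (q : R2) :
  open V -> smooth3 V g -> smooth2 U T -> U q -> V (T q) ->
  Du3 (fun x => g (T x)) q
  = dmap3 g (T q) (Du (fun x => fst (T x)) q, Du (fun x => snd (T x)) q).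
Proof.
  intros HV [g1 [g2 g3]] HT Hq Hv; unfold Du3 at 1.
  rewrite (Du_comp U V (fun x => fst (fst (g x)))), (Du_comp U V (fun x => snd (fst (g x)))),
    (Du_comp U V (fun x => snd (g x))) by assumption.
  rewrite dmap3E.
  apply f_equal2; [apply f_equal2|]; ring.
Qed.

Lemma Dv3_comp (U V : R2 -> Prop) (g : R2 -> R3) (T : R2 -> R2) (q : R2) :
  open V -> smooth3 V g -> smooth2 U T -> U q -> V (T q) ->
  Dv3 (fun x => g (T x)) q
  = dmap3 g (T q) (Dv (fun x => fst (T x)) q, Dv (fun x => snd (T x)) q).
Proof.
  intros HV [g1 [g2 g3]] HT Hq Hv; unfold Dv3 at 1.
  rewrite (Dv_comp U V (fun x => fst (fst (g x)))), (Dv_comp U V (fun x => snd (fst (g x)))),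
    (Dv_comp U V (fun x => snd (g x))) by assumption.
  rewrite dmap3E.
  apply f_equal2; [apply f_equal2|]; ring.
Qed.

(** * The bounded principal curvature *)

(** A point of the axis is approached along its vertical line, which meets the axis nowhere else. *)
Lemma smooth_zero_on_axis (W : R2 -> Prop) (Z : R2 -> R) :
  open W -> smooth W Z -> (forall q, W q -> snd q <> 0 -> Z q = 0) -> forall q, W q -> Z q = 0.
Proof.
  intros HW HZ H0 [x y] Hq.
  apply (continuous_eq_off_point (fun t => Z (x, t)) y).
  - apply (continuous_comp (fun t => (x, t)) Z); [|now apply (smooth_continuous W)].
    apply continuous_pair; [apply continuous_const|apply continuous_id].
  - destruct (Req_dec y 0) as [E|E].
    + eapply filter_imp; [|exact (open_slice_v _ _ HW Hq)]; cbn [fst snd]; intros t Ht Hn.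
      apply H0; [exact Ht|cbn; rewrite <- E; exact Hn].
    + assert (L : locally y (fun t => t <> 0)) by now apply (open_neq 0).
      generalize (filter_and _ _ L (open_slice_v _ _ HW Hq)); apply filter_imp.
      cbn [fst snd]; intros t [Ht1 Ht2] _; now apply H0.
Qed.

Lemma smooth_Ehat (U : R2 -> Prop) (phi : R2 -> R3) :
  open U -> smooth3 U phi -> smooth U (Ehat phi).
Proof.
  intros HU Sphi.
  now apply (smooth_dot U phi phi).
Qed.

Lemma smooth_Fhat (U : R2 -> Prop) (F phi : R2 -> R3) :
  open U -> smooth3 U F -> smooth3 U phi -> smooth U (Fhat F phi).
Proof.
  intros HU SF Sphi.
  apply (smooth_dot U phi (Dv3 F)); auto using smooth3_Dv3.
Qed.

Lemma smooth_Ghat (U : R2 -> Prop) (F : R2 -> R3) :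
  open U -> smooth3 U F -> smooth U (Ghat F).
Proof.
  intros HU SF.
  apply (smooth_dot U (Dv3 F) (Dv3 F)); auto using smooth3_Dv3.
Qed.

Lemma smooth_Lhat (U : R2 -> Prop) (n phi : R2 -> R3) :
  open U -> smooth3 U n -> smooth3 U phi -> smooth U (Lhat n phi).
Proof.
  intros HU Sn Sphi.
  apply (smooth_opp U (fun q => dot (phi q) (Du3 n q))); auto.
  apply smooth_dot; auto using smooth3_Du3.
Qed.

Lemma smooth_Mhat (U : R2 -> Prop) (n phi : R2 -> R3) :
  open U -> smooth3 U n -> smooth3 U phi -> smooth U (Mhat n phi).
Proof.
  intros HU Sn Sphi.
  apply (smooth_opp U (fun q => dot (phi q) (Dv3 n q))); auto.
  apply smooth_dot; auto using smooth3_Dv3.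
Qed.

Lemma smooth_Nhat (U : R2 -> Prop) (F n : R2 -> R3) :
  open U -> smooth3 U F -> smooth3 U n -> smooth U (Nhat F n).
Proof.
  intros HU SF Sn.
  apply (smooth_opp U (fun q => dot (Dv3 F q) (Dv3 n q))); auto.
  apply smooth_dot; auto using smooth3_Dv3.
Qed.

Lemma smooth_Qhat (U : R2 -> Prop) (F n : R2 -> R3) (eps : R -> R) (phi : R2 -> R3) :
  open U -> smooth3 U F -> smooth3 U n -> smooth3 U phi ->
  smooth U (fun q => eps (fst q)) ->
  smooth U (Qhat F n eps phi).
Proof.
  intros HU SF Sn Sphi Seps.
  unfold Qhat; smooth_auto; auto using smooth_Lhat, smooth_Mhat, smooth_Nhat.
Qed.

Lemma smooth_Ahat (U : R2 -> Prop) (F n : R2 -> R3) (eps : R -> R) (phi : R2 -> R3) :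
  open U -> smooth3 U F -> smooth3 U n -> smooth3 U phi ->
  smooth U (fun q => eps (fst q)) ->
  smooth U (Ahat F n eps phi).
Proof.
  intros HU SF Sn Sphi Seps.
  unfold Ahat; smooth_auto;
    auto using smooth_Lhat, smooth_Mhat, smooth_Nhat, smooth_Ehat, smooth_Fhat, smooth_Ghat.
Qed.

(** With H = E G - F^2, [kappa_plus] is a root of v H k^2 - A k + Q = 0 written with the radical in
    the denominator. Eliminating the radical gives the equation off the axis, and both sides are
    smooth across it. *)
Lemma kappa_quadratic (U : R2 -> Prop) (F n : R2 -> R3) (eps : R -> R) (phi : R2 -> R3)
    (kappa : R2 -> R) :
  open U -> smooth3 U F -> smooth3 U n -> smooth3 U phi -> smooth U (fun q => eps (fst q)) ->
  U (0, 0) -> Ahat F n eps phi (0, 0) <> 0 ->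
  bounded_extension U (kappa_plus F n eps phi) kappa -> kappa (0, 0) <> 0 ->
  exists W : R2 -> Prop, open W /\ W (0, 0) /\ (forall q, W q -> U q) /\ smooth W kappa
    /\ forall q, W q -> Qhat F n eps phi q = Ahat F n eps phi q * kappa q
         - snd q * (Ehat phi q * Ghat F q - Fhat F phi q ^ 2) * kappa q ^ 2.
Proof.
  intros HU SF Sn Sphi Seps U0 A0 [W [OW [W0 [WU [Sk [_ Hk]]]]]] k0.
  set (A := Ahat F n eps phi) in *; set (Q := Qhat F n eps phi) in *.
  set (H := fun q => Ehat phi q * Ghat F q - Fhat F phi q ^ 2).
  assert (SH : smooth U H)
    by (unfold H; smooth_auto; auto using smooth_Ehat, smooth_Fhat, smooth_Ghat).
  assert (SA : smooth U A) by now apply smooth_Ahat.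
  assert (SQ : smooth U Q) by now apply smooth_Qhat.
  set (De := fun q => A q ^ 2 - 4 * snd q * H q * Q q).
  assert (SDe : smooth U De) by (unfold De; smooth_auto).
  (* On [W1] the curvature does not vanish and the radicand is positive; at the origin the radicand
     is [A (0, 0) ^ 2]. *)
  set (W1 := fun q => (W q /\ 0 < kappa (0, 0) * kappa q) /\ (U q /\ 0 < De q)).
  assert (OW1 : open W1).
  { assert (S : smooth W (fun q => kappa (0, 0) * kappa q)) by smooth_auto.
    apply open_and; apply open_Ck0_gt; auto. }
  assert (W1U : forall q, W1 q -> U q) by (intros q Hq; apply Hq).
  assert (Sk1 : smooth W1 kappa) by (apply smooth_subset with W; auto; intros q Hq; apply Hq).
  exists W1; split; [exact OW1|split; [|split; [exact W1U|split; [exact Sk1|]]]].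
  { split; split; auto; [nra|]; unfold De; cbn [snd].
    assert (0 < A (0, 0) ^ 2) by (apply pow2_gt_0; exact A0); lra. }
  cut (forall q, W1 q -> Q q - (A q * kappa q - snd q * H q * kappa q ^ 2) = 0).
  { intros X q Hq; specialize (X q Hq); unfold H in X; lra. }
  apply smooth_zero_on_axis; auto.
  { assert (S : forall g, smooth U g -> smooth W1 g)
      by (intros g Hg; now apply smooth_subset with U).
    smooth_auto; auto. }
  intros q [[Wq kq] [_ Dq]] Hv.
  assert (kn : kappa q <> 0) by (intros E; rewrite E in kq; lra).
  assert (Eq := Hk q Wq Hv); unfold kappa_plus in Eq; fold A Q in Eq.
  set (B := Bhat F n eps phi q) in *.
  assert (B2 : B * B = De q) by (apply sqrt_sqrt; apply Rlt_le, Dq).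
  (* Division by zero yields 0, so a vanishing denominator would give [kappa q = 0]. This spares any
     discussion of the sign of [A]. *)
  assert (AB : A q + B <> 0).
  { intros E; apply kn; rewrite Eq, E; unfold Rdiv; rewrite Rinv_0; ring. }
  assert (E1 : kappa q * (A q + B) = 2 * Q q) by (rewrite Eq; field; exact AB).
  (* (A - B)(A + B) = 4 v H Q, and [E1] replaces 2 Q by kappa (A + B), which then cancels. *)
  assert (E2 : A q - B = 2 * (snd q * H q * kappa q)).
  { apply (Rmult_eq_reg_r (A q + B)); [|exact AB].
    transitivity (A q ^ 2 - B * B); [ring|rewrite B2; unfold De].
    transitivity (2 * snd q * H q * (2 * Q q)); [ring|rewrite <- E1; ring]. }
  assert (E3 : B = A q - 2 * (snd q * H q * kappa q)) by lra.
  rewrite E3 in E1; lra.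
Qed.

(** * The third-order jet in an adapted chart *)

Lemma dot_minus_l (x y z : R3) : dot (minus x y) z = dot x z - dot y z.
Proof. destruct x as [[]], y as [[]], z as [[]]; unfold dot, minus, plus, opp; cbn; ring. Qed.

Lemma smooth3_minus (U : R2 -> Prop) (f g : R2 -> R3) :
  open U -> smooth3 U f -> smooth3 U g -> smooth3 U (fun q => minus (f q) (g q)).
Proof.
  intros HU [f1 [f2 f3]] [g1 [g2 g3]]; split; [|split].
  - exact (smooth_minus U _ _ HU f1 g1).
  - exact (smooth_minus U _ _ HU f2 g2).
  - exact (smooth_minus U _ _ HU f3 g3).
Qed.

Lemma smooth3_scal (U : R2 -> Prop) (c : R) (f : R2 -> R3) :
  open U -> smooth3 U f -> smooth3 U (fun q => scal c (f q)).
Proof.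
  intros HU [f1 [f2 f3]]; split; [|split].
  - exact (smooth_mult U _ _ HU (smooth_const U c HU) f1).
  - exact (smooth_mult U _ _ HU (smooth_const U c HU) f2).
  - exact (smooth_mult U _ _ HU (smooth_const U c HU) f3).
Qed.

Lemma smooth3_const (U : R2 -> Prop) (x : R3) : open U -> smooth3 U (fun _ => x).
Proof. intros HU; split; [|split]; now apply smooth_const. Qed.

Lemma Du3_minus (U : R2 -> Prop) (f g : R2 -> R3) (q : R2) :
  smooth3 U f -> smooth3 U g -> U q ->
  Du3 (fun x => minus (f x) (g x)) q = minus (Du3 f q) (Du3 g q).
Proof.
  intros [f1 [f2 f3]] [g1 [g2 g3]] Hq.
  apply (f_equal2 pair); [apply (f_equal2 pair)|].
  - exact (Du_minus U _ _ q f1 g1 Hq).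
  - exact (Du_minus U _ _ q f2 g2 Hq).
  - exact (Du_minus U _ _ q f3 g3 Hq).
Qed.

Lemma Dv3_minus (U : R2 -> Prop) (f g : R2 -> R3) (q : R2) :
  smooth3 U f -> smooth3 U g -> U q ->
  Dv3 (fun x => minus (f x) (g x)) q = minus (Dv3 f q) (Dv3 g q).
Proof.
  intros [f1 [f2 f3]] [g1 [g2 g3]] Hq.
  apply (f_equal2 pair); [apply (f_equal2 pair)|].
  - exact (Dv_minus U _ _ q f1 g1 Hq).
  - exact (Dv_minus U _ _ q f2 g2 Hq).
  - exact (Dv_minus U _ _ q f3 g3 Hq).
Qed.

Lemma Du3_scal (c : R) (f : R2 -> R3) (q : R2) :
  Du3 (fun x => scal c (f x)) q = scal c (Du3 f q).
Proof.
  apply (f_equal2 pair); [apply (f_equal2 pair)|].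
  - exact (Du_scal c _ q).
  - exact (Du_scal c _ q).
  - exact (Du_scal c _ q).
Qed.

Lemma Dv3_scal (c : R) (f : R2 -> R3) (q : R2) :
  Dv3 (fun x => scal c (f x)) q = scal c (Dv3 f q).
Proof.
  apply (f_equal2 pair); [apply (f_equal2 pair)|].
  - exact (Dv_scal c _ q).
  - exact (Dv_scal c _ q).
  - exact (Dv_scal c _ q).
Qed.

Lemma Du3_const (x : R3) (q : R2) : Du3 (fun _ => x) q = zero.
Proof. unfold Du3; now rewrite !Du_const. Qed.

Lemma Dv3_const (x : R3) (q : R2) : Dv3 (fun _ => x) q = zero.
Proof. unfold Dv3; now rewrite !Dv_const. Qed.

Lemma sqnorm_eq_0 (x : R3) : sqnorm x = 0 -> x = zero.
Proof.
  destruct x as [[a b] d]; unfold sqnorm, dot; cbn; intros H.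
  assert (a = 0) by nra; assert (b = 0) by nra; assert (d = 0) by nra.
  subst; reflexivity.
Qed.

Lemma det3_zero_m (x z : R3) : det3 x zero z = 0.
Proof. destruct x as [[]], z as [[]]; unfold det3, zero; cbn; ring. Qed.

(** As r vanishes at the origin, a first derivative there of the product of r with a vector field X
    is the product of dr with X. So neither phi nor F_vv is ever differentiated in computing the jet
    of J. *)
Lemma D4_iff_not_ridge (U : R2 -> Prop) (F n phi : R2 -> R3) (eps : R -> R) (kappa : R2 -> R) :
  open U -> U (0, 0) -> smooth3 U F -> smooth3 U n -> smooth3 U phi ->
  smooth U (fun q => eps (fst q)) -> eps 0 = 0 ->
  (forall q, U q -> dot (n q) (n q) = 1 /\ dot (Du3 F q) (n q) = 0 /\ dot (Dv3 F q) (n q) = 0) ->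
  (forall q, U q -> plus (Du3 F q) (scal (eps (fst q)) (Dv3 F q)) = scal (snd q) (phi q)) ->
  det3 (phi (0, 0)) (Dv3 F (0, 0)) (n (0, 0)) <> 0 -> Du3 n (0, 0) <> zero ->
  bounded_extension U (kappa_plus F n eps phi) kappa -> kappa (0, 0) <> 0 ->
  has_D4 (psi F (plus (F (0, 0)) (scal (/ kappa (0, 0)) (n (0, 0)))) (/ kappa (0, 0))) (0, 0)
  <-> ~ ridge F n eps phi kappa (0, 0).
Proof.
  intros HU U0 SF Sn Sphi Seps eps0 Hn Hphi Hdet Hnu Hbd k0.
  assert (SFu := smooth3_Du3 U F SF); assert (SFv := smooth3_Dv3 U F SF).
  assert (Snu := smooth3_Du3 U n Sn); assert (Snv := smooth3_Dv3 U n Sn).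
  set (E := Ehat phi); set (Fh := Fhat F phi); set (G := Ghat F).
  set (L := Lhat n phi); set (M := Mhat n phi); set (N := Nhat F n).
  assert (SE : smooth U E) by now apply smooth_Ehat.
  assert (SFh : smooth U Fh) by now apply smooth_Fhat.
  assert (SG : smooth U G) by now apply smooth_Ghat.
  assert (SL : smooth U L) by now apply smooth_Lhat.
  assert (SM : smooth U M) by now apply smooth_Mhat.
  assert (SN : smooth U N) by now apply smooth_Nhat.
  set (e := fun q : R2 => eps (fst q)) in *.
  assert (e0 : e (0, 0) = 0) by exact eps0.
  (* Vector identities are used in tested form, against an arbitrary [X], which reduces them to
     scalar equations. *)
  assert (Fu : forall q X, U q -> dot (Du3 F q) X = snd q * dot (phi q) X - e q * dot (Dv3 F q) X).
  { intros q X Hq; assert (H := f_equal (fun z => dot z X) (Hphi q Hq)); cbv beta in H.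
    rewrite dot_plus_l, !dot_scal_l in H; unfold e; lra. }
  assert (Fu0 : forall X, dot (Du3 F (0, 0)) X = 0).
  { intros X; rewrite Fu, e0 by exact U0; cbn [snd]; ring. }
  assert (nun : dot (Du3 n (0, 0)) (n (0, 0)) = 0).
  { assert (H := Du_dot U n n (0, 0) HU Sn Sn U0).
    rewrite (Du_ext_on U _ (fun _ => 1)), Du_const in H; auto; [|apply Hn].
    rewrite (dot_comm (n (0, 0))) in H; lra. }
  (* Differentiating the two orthogonality relations expresses the product of F_uv with n in two
     ways, so the product of n_u with F_v equals that of n_v with F_u, and F_u is zero at the
     origin. *)
  assert (nuFv : dot (Du3 n (0, 0)) (Dv3 F (0, 0)) = 0).
  { assert (H1 := Du_dot U (Dv3 F) n (0, 0) HU SFv Sn U0).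
    rewrite (Du_ext_on U _ (fun _ => 0)), Du_const in H1; auto; [|apply Hn].
    assert (H2 := Dv_dot U (Du3 F) n (0, 0) HU SFu Sn U0).
    rewrite (Dv_ext_on U _ (fun _ => 0)), Dv_const in H2; auto; [|apply Hn].
    rewrite Fu0 in H2; rewrite (Du3_Dv3_comm U) in H1 by auto.
    rewrite (dot_comm (Du3 n (0, 0))); lra. }
  assert (L0 : L (0, 0) <> 0).
  { intros H; apply Hnu; apply (orthogonal_to_frame _ _ _ _ Hdet); auto.
    rewrite dot_comm; unfold L, Lhat in H; lra. }
  assert (G0 : G (0, 0) <> 0).
  { intros H; apply sqnorm_eq_0 in H; apply Hdet; rewrite H; apply det3_zero_m. }
  destruct (kappa_quadratic U F n eps phi kappa) as [W [OW [W0 [WU [Sk Quad]]]]]; auto.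
  { replace (Ahat F n eps phi (0, 0)) with (G (0, 0) * L (0, 0));
      [now apply Rmult_integral_contrapositive|].
    unfold Ahat; fold G L M Fh E N; cbn [fst snd]; rewrite eps0; ring. }
  assert (SW : forall g, smooth U g -> smooth W g)
    by (intros g Hg; now apply smooth_subset with U).
  set (c := / kappa (0, 0)) in *.
  assert (Hc : c * kappa (0, 0) = 1) by (unfold c; now apply Rinv_l).
  (* For dn + kappa dF, the direction (1, e) has inner products -b and v a with phi and F_v, and the
     direction (0, 1) has a and -h. *)
  set (a := fun q => kappa q * Fh q - M q).
  set (b := fun q => L q + e q * M q - kappa q * snd q * E q).
  set (h := fun q => N q - kappa q * G q).
  assert (Sa : smooth W a) by (unfold a; smooth_auto; auto).
  assert (Sb : smooth W b) by (unfold b; smooth_auto; auto).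
  assert (Sh : smooth W h) by (unfold h; smooth_auto; auto).
  (* The quadratic equation of [kappa], factored through the rows of the matrix
     of [dn + kappa dF] in the frame [phi, F_v]. *)
  assert (Fac : forall q, W q -> b q * h q - snd q * (a q * a q) = 0).
  { intros q Hq; specialize (Quad q Hq); unfold Qhat, Ahat in Quad.
    fold E Fh G L M N in Quad; fold (e q) in Quad; unfold a, b, h; lra. }
  assert (b0 : b (0, 0) = L (0, 0)) by (unfold b; cbn [snd]; rewrite e0; ring).
  assert (h0 : h (0, 0) = 0).
  { assert (H := Fac _ W0); cbn [snd] in H; rewrite b0 in H.
    apply (Rmult_eq_reg_l (L (0, 0))); [lra|exact L0]. }
  assert (Shh : smooth W (fun q => b q * h q)) by smooth_auto.
  assert (Saa : smooth W (fun q => a q * a q)) by smooth_auto.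
  assert (Sva : smooth W (fun q => snd q * (a q * a q))) by smooth_auto.
  assert (Ssnd : smooth W (fun q => snd q)) by smooth_auto.
  assert (hu : Du h (0, 0) = 0).
  { assert (H := Du_ext_on W _ (fun _ => 0) (0, 0) OW Fac W0).
    rewrite Du_const, (Du_minus W), (Du_mult W), (Du_mult W _ (fun q => a q * a q)), Du_snd in H
      by assumption.
    rewrite h0, b0 in H; cbn [snd] in H.
    apply (Rmult_eq_reg_l (L (0, 0))); [lra|exact L0]. }
  assert (hv : L (0, 0) * Dv h (0, 0) = a (0, 0) ^ 2).
  { assert (H := Dv_ext_on W _ (fun _ => 0) (0, 0) OW Fac W0).
    rewrite Dv_const, (Dv_minus W), (Dv_mult W), (Dv_mult W _ (fun q => a q * a q)), Dv_snd in H
      by assumption.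
    rewrite h0, b0 in H; cbn [snd] in H; lra. }
  assert (SkG : smooth W (fun q => kappa q * G q)) by (smooth_auto; auto).
  unfold h in hu, hv.
  rewrite (Du_minus W), (Du_mult W) in hu by auto.
  rewrite (Dv_minus W), (Dv_mult W) in hv by auto.
  set (x0 := plus (F (0, 0)) (scal c (n (0, 0)))).
  set (P := fun q => minus x0 (F q)); set (r := fun q => minus (P q) (scal c (n q))).
  assert (Scn := smooth3_scal U c n HU Sn).
  assert (Sx0 := smooth3_const U x0 HU).
  assert (SP : smooth3 U P) by now apply smooth3_minus.
  assert (Sr : smooth3 U r) by now apply smooth3_minus.
  assert (r0 : forall X, dot (r (0, 0)) X = 0).
  { intros X; unfold r, P, x0; rewrite !dot_minus_l, dot_plus_l; ring. }
  assert (Pu : forall q X, U q -> dot (Du3 P q) X = - dot (Du3 F q) X).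
  { intros q X Hq; unfold P; rewrite (Du3_minus U), Du3_const, dot_minus_l, dot_zero_l by auto; ring. }
  assert (Pv : forall q X, U q -> dot (Dv3 P q) X = - dot (Dv3 F q) X).
  { intros q X Hq; unfold P; rewrite (Dv3_minus U), Dv3_const, dot_minus_l, dot_zero_l by auto; ring. }
  assert (ru : forall q X, U q -> dot (Du3 r q) X = - dot (Du3 F q) X - c * dot (Du3 n q) X).
  { intros q X Hq; unfold r.
    rewrite (Du3_minus U), dot_minus_l, Du3_scal, dot_scal_l, Pu by auto; ring. }
  assert (rv : forall q X, U q -> dot (Dv3 r q) X = - dot (Dv3 F q) X - c * dot (Dv3 n q) X).
  { intros q X Hq; unfold r.
    rewrite (Dv3_minus U), dot_minus_l, Dv3_scal, dot_scal_l, Pv by auto; ring. }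
  assert (rP : forall q X, dot (r q) X = dot (P q) X - c * dot (n q) X).
  { intros q X; unfold r; now rewrite dot_minus_l, dot_scal_l. }
  set (m := fun q => dot (r q) (phi q)); set (k := fun q => dot (r q) (Dv3 F q)).
  assert (Sm : smooth U m) by now apply smooth_dot.
  assert (Sk' : smooth U k) by now apply smooth_dot.
  set (J := psi F x0 c).
  assert (SPP : smooth U (fun q => dot (P q) (P q))) by now apply smooth_dot.
  assert (Sc2 : smooth U (fun _ => c ^ 2)) by now apply smooth_const.
  assert (SJ : smooth U J).
  { apply (smooth_mult U (fun _ => - (1 / 2)) (fun q => dot (P q) (P q) - c ^ 2)); auto;
      smooth_auto. }
  assert (Ju : forall q, U q -> Du J q = snd q * m q - e q * k q).
  { intros q Hq; unfold J.
    change (Du (fun q => - (1 / 2) * (dot (P q) (P q) - c ^ 2)) q = snd q * m q - e q * k q).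
    rewrite Du_scal, (Du_minus U), Du_const, (Du_dot U), (dot_comm (P q)), Pu by auto.
    unfold m, k; rewrite !(dot_comm (r q)).
    transitivity (dot (Du3 F q) (r q)); [|now apply Fu].
    rewrite (dot_comm _ (r q)), rP, (dot_comm (n q)).
    destruct (Hn q Hq) as [_ [H _]]; rewrite H, (dot_comm (P q)); field. }
  assert (Jv : forall q, U q -> Dv J q = k q).
  { intros q Hq; unfold J.
    change (Dv (fun q => - (1 / 2) * (dot (P q) (P q) - c ^ 2)) q = k q).
    rewrite Dv_scal, (Dv_minus U), Dv_const, (Dv_dot U), (dot_comm (P q)), Pv by auto.
    unfold k; rewrite rP, (dot_comm (n q)).
    destruct (Hn q Hq) as [_ [_ H]]; rewrite H, (dot_comm (P q)); field. }
  assert (ev : forall q, Dv e q = 0) by (intros q; exact (Derive_const (eps (fst q)) (snd q))).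
  assert (S1 : smooth U (fun q => snd q * m q)) by smooth_auto.
  assert (S2 : smooth U (fun q => e q * k q)) by smooth_auto.
  assert (Ssn : smooth U (fun q => snd q)) by smooth_auto.
  assert (Su : smooth U (Du m)) by smooth_auto.
  assert (Sv : smooth U (Dv m)) by smooth_auto.
  assert (Tu : smooth U (Du k)) by smooth_auto.
  assert (Tv : smooth U (Dv k)) by smooth_auto.
  assert (Se : smooth U (Du e)) by now apply smooth_Du.
  assert (Juu : forall q, U q -> Du (Du J) q = snd q * Du m q - (Du e q * k q + e q * Du k q)).
  { intros q Hq; rewrite (Du_ext_on U _ _ q HU Ju Hq).
    rewrite (Du_minus U), (Du_mult U), (Du_mult U e k), Du_snd by assumption; ring. }
  assert (Juv : forall q, U q -> Dv (Du J) q = m q + snd q * Dv m q - e q * Dv k q).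
  { intros q Hq; rewrite (Dv_ext_on U _ _ q HU Ju Hq).
    rewrite (Dv_minus U), (Dv_mult U), (Dv_mult U e k), Dv_snd, ev by assumption; ring. }
  assert (Jvv : forall q, U q -> Dv (Dv J) q = Dv k q)
    by (intros q Hq; exact (Dv_ext_on U _ _ q HU Jv Hq)).
  (* At the origin the bracket is c h, because c is the inverse of kappa there, and so it vanishes
     with h. The last term is where F_vv enters. *)
  assert (kv : forall q, U q -> Dv k q = (c * N q - G q) + dot (r q) (Dv3 (Dv3 F) q)).
  { intros q Hq; unfold k; rewrite (Dv_dot U), rv by auto.
    unfold N, G, Nhat, Ghat, sqnorm; rewrite (dot_comm (Dv3 n q)); ring. }
  assert (m0 : m (0, 0) = 0) by apply r0.
  assert (k0' : k (0, 0) = 0) by apply r0.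
  assert (ku0 : Du k (0, 0) = 0).
  { unfold k; rewrite (Du_dot U), ru, Fu0, nuFv, r0 by auto; ring. }
  assert (kv0 : Dv k (0, 0) = 0).
  { rewrite kv, r0 by auto; unfold h in h0.
    replace (N (0, 0)) with (kappa (0, 0) * G (0, 0)) by lra.
    rewrite <- Rmult_assoc, Hc; ring. }
  assert (mu0 : Du m (0, 0) = c * L (0, 0)).
  { unfold m; rewrite (Du_dot U), ru, Fu0, r0 by auto.
    unfold L, Lhat; rewrite (dot_comm (phi (0, 0))); ring. }
  assert (mv0 : Dv m (0, 0) = - c * a (0, 0)).
  { unfold m; rewrite (Dv_dot U), rv, r0 by auto.
    unfold a, M, Mhat, Fh, Fhat; rewrite !(dot_comm (phi (0, 0))).
    transitivity (- (c * kappa (0, 0)) * dot (Dv3 F (0, 0)) (phi (0, 0))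
                  - c * dot (Dv3 n (0, 0)) (phi (0, 0))); [rewrite Hc; ring|ring]. }
  assert (SkU : smooth U (fun q => snd q * Du m q)) by smooth_auto.
  assert (S3 : smooth U (fun q => Du e q * k q)) by smooth_auto.
  assert (S4 : smooth U (fun q => e q * Du k q)) by smooth_auto.
  assert (S5 : smooth U (fun q => Du e q * k q + e q * Du k q)) by smooth_auto.
  assert (S6 : smooth U (fun q => snd q * Dv m q)) by smooth_auto.
  assert (S7 : smooth U (fun q => e q * Dv k q)) by smooth_auto.
  assert (S8 : smooth U (fun q => m q + snd q * Dv m q)) by smooth_auto.
  assert (Juuu0 : Du (Du (Du J)) (0, 0) = 0).
  { rewrite (Du_ext_on U _ _ _ HU Juu U0).
    rewrite (Du_minus U), (Du_plus U), (Du_mult U (fun q => snd q)), Du_snd,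
      (Du_mult U (Du e)), (Du_mult U e) by assumption.
    rewrite k0', ku0, e0; cbn [snd]; ring. }
  assert (Juuv0 : Dv (Du (Du J)) (0, 0) = c * L (0, 0)).
  { rewrite (Dv_ext_on U _ _ _ HU Juu U0).
    rewrite (Dv_minus U), (Dv_plus U), (Dv_mult U (fun q => snd q)), Dv_snd,
      (Dv_mult U (Du e)), (Dv_mult U e) by assumption.
    rewrite k0', ku0, kv0, e0, mu0; cbn [snd]; ring. }
  assert (Juvv0 : Dv (Dv (Du J)) (0, 0) = - 2 * c * a (0, 0)).
  { rewrite (Dv_ext_on U _ _ _ HU Juv U0).
    rewrite (Dv_minus U), (Dv_plus U), (Dv_mult U (fun q => snd q)), Dv_snd,
      (Dv_mult U e) by assumption.
    rewrite kv0, e0, mv0; cbn [snd]; ring. }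
  set (Fvv := Dv3 (Dv3 F)).
  assert (SFvv : smooth3 U Fvv) by now apply smooth3_Dv3.
  assert (S9 : smooth U (fun q => c * N q)) by smooth_auto.
  assert (S10 : smooth U (fun q => c * N q - G q)) by smooth_auto.
  assert (S11 : smooth U (fun q => dot (r q) (Fvv q))) by now apply smooth_dot.
  assert (ku' : Du (Dv k) (0, 0) = c * Du N (0, 0) - Du G (0, 0) + dot (Du3 r (0, 0)) (Fvv (0, 0))).
  { rewrite (Du_ext_on U _ _ _ HU kv U0); fold Fvv.
    rewrite (Du_plus U (fun q => c * N q - G q)), (Du_minus U (fun q => c * N q)), Du_scal,
      (Du_dot U), r0 by assumption; ring. }
  assert (kv' : Dv (Dv k) (0, 0) = c * Dv N (0, 0) - Dv G (0, 0) + dot (Dv3 r (0, 0)) (Fvv (0, 0))).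
  { rewrite (Dv_ext_on U _ _ _ HU kv U0); fold Fvv.
    rewrite (Dv_plus U (fun q => c * N q - G q)), (Dv_minus U (fun q => c * N q)), Dv_scal,
      (Dv_dot U), r0 by assumption; ring. }
  (* J_uvv once more, now differentiated from J_v = k. Set against [ku'] this gives the product of
     r_u with F_vv. *)
  assert (Sym : Du (Dv k) (0, 0) = - 2 * c * a (0, 0)).
  { rewrite <- Juvv0, (Du_Dv_comm U) by auto.
    apply (Dv_ext_on U); auto; intros q Hq.
    rewrite <- (Du_Dv_comm U J) by auto; symmetry.
    now rewrite (Du_ext_on U _ _ q HU Jv Hq). }
  (* [a dr_u + L dr_v] is minus [c] times [dn + kappa dF] on the principal vector. *)
  assert (Ker : forall X, a (0, 0) * dot (Du3 r (0, 0)) X + L (0, 0) * dot (Dv3 r (0, 0)) X = 0).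
  { intros X.
    rewrite <- !dot_scal_l, <- dot_plus_l.
    rewrite (orthogonal_to_frame _ _ _ _ Hdet); [apply dot_zero_l| | |];
      rewrite dot_plus_l, !dot_scal_l.
    - assert (H1 := mu0); assert (H2 := mv0); unfold m in H1, H2.
      rewrite (Du_dot U), r0 in H1 by auto; rewrite (Dv_dot U), r0 in H2 by auto.
      replace (dot (Du3 r (0, 0)) (phi (0, 0))) with (c * L (0, 0)) by lra.
      replace (dot (Dv3 r (0, 0)) (phi (0, 0))) with (- c * a (0, 0)) by lra; ring.
    - assert (H1 := ku0); assert (H2 := kv0); unfold k in H1, H2.
      rewrite (Du_dot U), r0 in H1 by auto; rewrite (Dv_dot U), r0 in H2 by auto.
      replace (dot (Du3 r (0, 0)) (Dv3 F (0, 0))) with 0 by lra.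
      replace (dot (Dv3 r (0, 0)) (Dv3 F (0, 0))) with 0 by lra; ring.
    - assert (nvn : dot (Dv3 n (0, 0)) (n (0, 0)) = 0).
      { assert (H := Dv_dot U n n (0, 0) HU Sn Sn U0).
        rewrite (Dv_ext_on U _ (fun _ => 1)), Dv_const in H; auto; [|apply Hn].
        rewrite (dot_comm (n (0, 0))) in H; lra. }
      rewrite ru, rv, Fu0, nun, nvn by auto.
      destruct (Hn _ U0) as [_ [_ H]]; rewrite H; ring. }
  specialize (Ker (Fvv (0, 0))).
  set (D := a (0, 0) * Du kappa (0, 0) + L (0, 0) * Dv kappa (0, 0)).
  assert (Main : L (0, 0) * Dv (Dv k) (0, 0) = c * G (0, 0) * D + 3 * c * a (0, 0) ^ 2).
  { set (R1 := dot (Du3 r (0, 0)) (Fvv (0, 0))) in *.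
    set (R2 := dot (Dv3 r (0, 0)) (Fvv (0, 0))) in *.
    rewrite Sym in ku'; rewrite kv'; unfold D.
    assert (Nu : Du N (0, 0) = Du kappa (0, 0) * G (0, 0) + kappa (0, 0) * Du G (0, 0)) by lra.
    assert (Nv : L (0, 0) * Dv N (0, 0) = a (0, 0) ^ 2 + L (0, 0) *
       (Dv kappa (0, 0) * G (0, 0) + kappa (0, 0) * Dv G (0, 0))) by lra.
    assert (R1' : R1 = - 2 * c * a (0, 0) - c * Du kappa (0, 0) * G (0, 0)).
    { rewrite Nu in ku'.
      replace (c * (Du kappa (0, 0) * G (0, 0) + kappa (0, 0) * Du G (0, 0)))
        with (c * Du kappa (0, 0) * G (0, 0) + (c * kappa (0, 0)) * Du G (0, 0)) in ku' by ring.
      rewrite Hc in ku'; lra. }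
    transitivity (c * (L (0, 0) * Dv N (0, 0)) - L (0, 0) * Dv G (0, 0) + L (0, 0) * R2); [ring|].
    replace (L (0, 0) * R2) with (- (a (0, 0) * R1)) by lra.
    rewrite Nv, R1'.
    transitivity (c * a (0, 0) ^ 2 + c * L (0, 0) * Dv kappa (0, 0) * G (0, 0)
      + (c * kappa (0, 0)) * L (0, 0) * Dv G (0, 0) - L (0, 0) * Dv G (0, 0)
      + 2 * c * a (0, 0) ^ 2 + c * a (0, 0) * Du kappa (0, 0) * G (0, 0)); [ring|].
    rewrite Hc; ring. }
  assert (c0 : c <> 0) by (now apply Rinv_neq_0_compat).
  assert (Ridge : ridge F n eps phi kappa (0, 0) <-> D = 0).
  { unfold ridge, principal_vector; cbn [fst snd]; fold L M Fh E; unfold D, a.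
    rewrite eps0.
    replace ((- M (0, 0) + kappa (0, 0) * Fh (0, 0)) * Du kappa (0, 0)
      + (L (0, 0) - kappa (0, 0) * (0 * E (0, 0) - 0 * Fh (0, 0))) * Dv kappa (0, 0))
      with ((kappa (0, 0) * Fh (0, 0) - M (0, 0)) * Du kappa (0, 0)
            + L (0, 0) * Dv kappa (0, 0)) by ring.
    tauto. }
  rewrite Ridge, (D4_criterion U J); auto.
  - rewrite Juuv0, Juvv0.
    rewrite (Dv_ext_on U (Dv (Dv J)) (Dv k)) by auto.
    assert (Q : 4 * (c * L (0, 0)) * Dv (Dv k) (0, 0)
      - 3 * (- 2 * c * a (0, 0)) ^ 2 = 4 * c ^ 2 * G (0, 0) * D).
    { transitivity (4 * c * (L (0, 0) * Dv (Dv k) (0, 0)) - 12 * c ^ 2 * a (0, 0) ^ 2); [ring|].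
      rewrite Main; ring. }
    assert (X : 4 * c ^ 2 * G (0, 0) <> 0).
    { apply Rmult_integral_contrapositive; split; [|exact G0].
      apply Rmult_integral_contrapositive; split; [lra|now apply pow_nonzero]. }
    split; intros H1 H2; apply H1.
    + rewrite H2 in Q; lra.
    + rewrite H2 in Q; rewrite Rminus_diag in Q; symmetry in Q.
      apply Rmult_integral in Q; tauto.
  (* At the origin P and c n have equal products with every vector; testing with P and with n gives
     the squared norm c^2. *)
  - change (- (1 / 2) * (dot (P (0, 0)) (P (0, 0)) - c ^ 2) = 0).
    assert (H := r0 (P (0, 0))); rewrite rP in H.
    assert (H' := r0 (n (0, 0))); rewrite rP in H'.
    destruct (Hn _ U0) as [H1 _]; rewrite H1 in H'; rewrite (dot_comm (n (0, 0))) in H.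
    replace (dot (P (0, 0)) (n (0, 0))) with c in H by lra.
    replace (dot (P (0, 0)) (P (0, 0))) with (c * c) by lra; ring.
  - rewrite Ju, e0 by exact U0; cbn [snd]; ring.
  - rewrite Jv by exact U0; exact k0'.
  - rewrite Juu, k0', e0 by exact U0; cbn [snd]; ring.
  - rewrite Juv, m0, e0 by exact U0; cbn [snd]; ring.
  - rewrite Jvv by exact U0; exact kv0.
  - rewrite Juuv0; now apply Rmult_integral_contrapositive.
Qed.

(** * Change of coordinates *)

Lemma smooth3_comp (U V : R2 -> Prop) (g : R2 -> R3) (T : R2 -> R2) :
  open U -> open V -> (forall q, U q -> V (T q)) ->
  smooth3 V g -> smooth2 U T -> smooth3 U (fun q => g (T q)).
Proof.
  intros HU HV HUV [g1 [g2 g3]] HT; split; [|split].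
  - now apply (smooth_comp_map U V (fun q => fst (fst (g q)))).
  - now apply (smooth_comp_map U V (fun q => snd (fst (g q)))).
  - now apply (smooth_comp_map U V (fun q => snd (g q))).
Qed.

Lemma smooth_det3 (U : R2 -> Prop) (f g h : R2 -> R3) :
  open U -> smooth3 U f -> smooth3 U g -> smooth3 U h ->
  smooth U (fun q => det3 (f q) (g q) (h q)).
Proof.
  intros HU [f1 [f2 f3]] [g1 [g2 g3]] [h1 [h2 h3]]; unfold det3; smooth_auto; assumption.
Qed.

Lemma smooth_jacobian (U : R2 -> Prop) (T : R2 -> R2) :
  open U -> smooth2 U T -> smooth U (jacobian T).
Proof. intros HU [H1 H2]; unfold jacobian; smooth_auto; assumption. Qed.

Lemma det3_dmap3 (f : R2 -> R3) (q : R2) (a b a' b' : R) (z : R3) :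
  det3 (dmap3 f q (a, b)) (dmap3 f q (a', b')) z
  = (a * b' - a' * b) * det3 (Du3 f q) (Dv3 f q) z.
Proof. rewrite !dmap3E; unfold det3, Du3, Dv3; cbn [fst snd]; ring. Qed.

Lemma det3_combination (x y w z : R3) (e v : R) :
  plus x (scal e y) = scal v w -> det3 x y z = v * det3 w y z.
Proof.
  destruct x as [[x1 x2] x3], y as [[y1 y2] y3], w as [[w1 w2] w3], z as [[z1 z2] z3].
  intros H; unfold det3; cbn [fst snd].
  assert (H1 : x1 + e * y1 = v * w1) by exact (f_equal (fun p : R3 => fst (fst p)) H).
  assert (H2 : x2 + e * y2 = v * w2) by exact (f_equal (fun p : R3 => snd (fst p)) H).
  assert (H3 : x3 + e * y3 = v * w3) by exact (f_equal (fun p : R3 => snd p) H).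
  replace x1 with (v * w1 - e * y1) by lra; replace x2 with (v * w2 - e * y2) by lra.
  replace x3 with (v * w3 - e * y3) by lra; ring.
Qed.

(* In the chart, [lambda = v * mu] with [mu] proportional to [det(phi, f_v, nu)],
   so [d lambda] vanishes at [p] when [mu] does. *)
Lemma frame_independent (Sigma : R2 -> Prop) (f nu : R2 -> R3) (U V : R2 -> Prop)
    (Phi : R2 -> R2) (phi : R2 -> R3) (eps : R -> R) :
  open Sigma -> smooth3 Sigma f -> smooth3 Sigma nu -> diffeo U V Phi ->
  (forall q, V q -> Sigma q) -> U (0, 0) -> smooth3 U phi ->
  (forall q, U q -> plus (Du3 (fun x => f (Phi x)) q) (scal (eps (fst q)) (Dv3 (fun x => f (Phi x)) q))
                    = scal (snd q) (phi q)) ->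
  nondegenerate Sigma f nu (Phi (0, 0)) ->
  det3 (phi (0, 0)) (Dv3 (fun x => f (Phi x)) (0, 0)) (nu (Phi (0, 0))) <> 0.
Proof.
  intros HSig Sf Snu DPhi VS U0 Sphi Hphi [_ Hnd] H0; apply Hnd.
  assert (Jnz : forall q, U q -> jacobian Phi q <> 0)
    by (intros q; now apply diffeo_jacobian with V).
  destruct (diffeo_inv _ _ _ DPhi) as [h [[OV [OU [Sh _]]] [Hph Hhp]]].
  assert (SPhi : smooth2 U Phi) by apply DPhi.
  assert (SfV : smooth3 V f) by now apply smooth3_subset with Sigma.
  assert (SnV : smooth3 V nu) by now apply smooth3_subset with Sigma.
  assert (UV : forall q, U q -> V (Phi q)) by (intros q Hq; apply Hph, Hq).
  assert (VU : forall q, V q -> U (h q)) by (intros q Hq; apply Hhp, Hq).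
  set (F := fun x => f (Phi x)) in *; set (n := fun x => nu (Phi x)).
  assert (SF : smooth3 U F) by exact (smooth3_comp U V f Phi OU OV UV SfV SPhi).
  assert (Sn : smooth3 U n) by exact (smooth3_comp U V nu Phi OU OV UV SnV SPhi).
  set (mu := fun q => det3 (phi q) (Dv3 F q) (n q) / jacobian Phi q).
  assert (Smu : smooth U mu).
  { apply (smooth_div U (fun q => det3 (phi q) (Dv3 F q) (n q)) (jacobian Phi)); auto.
    - apply smooth_det3; auto using smooth3_Dv3.
    - now apply smooth_jacobian. }
  assert (Hlam : forall q, V q -> lambda f nu q = snd (h q) * mu (h q)).
  { intros q Hq; assert (Hu := VU q Hq); destruct (Hhp q Hq) as [_ E].
    assert (X := det3_combination _ _ _ (n (h q)) _ _ (Hphi _ Hu)).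
    unfold F at 1 2 in X.
    rewrite (Du3_comp U V f Phi), (Dv3_comp U V f Phi), det3_dmap3 in X by auto.
    unfold n at 1 in X; rewrite E in X; specialize (Jnz _ Hu).
    unfold lambda, mu; apply (Rmult_eq_reg_l (jacobian Phi (h q))); [|exact Jnz].
    transitivity (snd (h q) * det3 (phi (h q)) (Dv3 F (h q)) (n (h q))); [|field; exact Jnz].
    rewrite <- X; unfold jacobian; ring. }
  assert (Vp : V (Phi (0, 0))) by now apply UV.
  destruct (Hph _ U0) as [_ hp].
  assert (Sh2 : smooth V (fun q => snd (h q))) by apply Sh.
  assert (Smuh : smooth V (fun q => mu (h q))) by now apply (smooth_comp_map V U).
  assert (mu0 : mu (0, 0) = 0) by (unfold mu, n; rewrite H0; unfold Rdiv; ring).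
  split.
  - rewrite (Du_ext_on V _ _ _ OV Hlam Vp), (Du_mult V) by assumption.
    rewrite hp, mu0; cbn [snd]; ring.
  - rewrite (Dv_ext_on V _ _ _ OV Hlam Vp), (Dv_mult V) by assumption.
    rewrite hp, mu0; cbn [snd]; ring.
Qed.

Theorem theorem5p3
  (Sigma : R2 -> Prop) (f nu : R2 -> R3) (p : R2)
  (U : R2 -> Prop) (Phi : R2 -> R2) (eps : R -> R) (phi : R2 -> R3)
  (kappa : R2 -> R)
  (HSigma : plane_domain Sigma)
  (Hfront : front Sigma f nu)
  (Hp : second_kind Sigma f nu p)
  (Hadapted : adapted Sigma f p U Phi eps)
  (Hphi : phi_of U (fun q => f (Phi q)) eps phi)
  (Hkappa : bounded_extension U
     (kappa_plus (fun q => f (Phi q)) (fun q => nu (Phi q)) eps phi) kappa)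
  (Hkappa0 : kappa (0, 0) <> 0) :
  has_D4 (psi f (plus (f p) (scal (/ kappa (0, 0)) (nu p))) (/ kappa (0, 0))) p
  <-> ~ ridge (fun q => f (Phi q)) (fun q => nu (Phi q)) eps phi kappa (0, 0).
Proof.
  destruct HSigma as [OS _].
  destruct Hfront as [[Sf [Snu Hnu]] Himm], Hp as [Hnd _], Hphi as [Sphi Hphi].
  destruct Hadapted as [[V [DPhi VS]] [_ [U0 [Ep [_ [Seps [eps0 _]]]]]]]; subst p.
  assert (OU : open U) by apply DPhi; assert (OV : open V) by apply DPhi.
  assert (SPhi : smooth2 U Phi) by apply DPhi.
  assert (UV : forall q, U q -> V (Phi q)).
  { destruct (diffeo_inv _ _ _ DPhi) as [h [_ [H _]]]; intros q Hq; apply H, Hq. }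
  assert (SfV : smooth3 V f) by now apply smooth3_subset with Sigma.
  assert (SnV : smooth3 V nu) by now apply smooth3_subset with Sigma.
  assert (Hphi' : forall q, U q ->
    plus (Du3 (fun x => f (Phi x)) q) (scal (eps (fst q)) (Dv3 (fun x => f (Phi x)) q))
    = scal (snd q) (phi q)) by (intros q Hq; apply Hphi, Hq).
  rewrite <- (has_D4_chart U V Phi _ (0, 0) DPhi U0).
  apply (D4_iff_not_ridge U (fun q => f (Phi q)) (fun q => nu (Phi q)) phi eps kappa); auto.
  - exact (smooth3_comp U V f Phi OU OV UV SfV SPhi).
  - exact (smooth3_comp U V nu Phi OU OV UV SnV SPhi).
  - intros k; apply (Ck_of_fst k (fun u => exists v, U (u, v))); auto.
    intros [u v] Hq; now exists v.
  - intros q Hq; destruct (Hnu _ (VS _ (UV q Hq))) as [H1 H2].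
    split; [exact H1|].
    rewrite (Du3_comp U V f Phi), (Dv3_comp U V f Phi) by auto; now split.
  - now apply (frame_independent Sigma f nu U V Phi phi eps).
  (* At the origin v and eps vanish, so F_u = 0. If n_u were zero too, the front condition would
     make the u-derivative of [Phi] zero, against its non-vanishing Jacobian. *)
  - intros H.
    rewrite (Du3_comp U V nu Phi) in H by auto.
    assert (H' := Hphi' _ U0); cbn [fst snd] in H'; rewrite eps0 in H'.
    rewrite (@scal_zero_l R_AbsRing), plus_zero_r, (@scal_zero_l R_AbsRing) in H'.
    rewrite (Du3_comp U V f Phi) in H' by auto.
    assert (Hw := Himm _ (VS _ (UV _ U0)) _ H' H).
    apply (diffeo_jacobian U V Phi (0, 0) DPhi U0); unfold jacobian.
    assert (W1 := f_equal (fun w : R2 => fst w) Hw); assert (W2 := f_equal (fun w : R2 => snd w) Hw).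
    cbn [fst snd] in W1, W2; change (fst zero) with 0 in W1; change (snd zero) with 0 in W2.
    rewrite W1, W2; ring.
Qed.
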